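(* Every four-dimensional power-commutative real division algebra is isomorphic to precisely one algebra in the set $$\left\{\mathcal{F}(\mathbb{R}^3,\xi_x,\eta_{yd},\sigma_z,\lambda)\right\}_{(x,y,z,d,\lambda)\in\mathcal{S}}.$$ Conversely, all these are power-commutative division algebras of dimension four.
   Context: An algebra is a finite-dimensional real vector space with a bilinear multiplication (not necessarily associative, commutative or unital). A division algebra is an algebra $A$ in which $x\mapsto ax$ and $x\mapsto xa$ are bijective for every non-zero $a\in A$. An algebra is power-commutative if every subalgebra generated by a single element is commutative. Vectors in $\mathbb{R}^3$ are columns and $\langle\,,\rangle$ is the standard inner product. Let $\mathcal{T}=\{d\in\mathbb{R}^3\mid 0<d_1\leqslant d_2\leqslant d_3\}$. For $x,y,z\in\mathbb{R}^3$, $d\in\mathcal{T}$ set $$\delta_d=\begin{pmatrix}d_1&0&0\\0&d_2&0\\0&0&d_3\end{pmatrix},\qquad \epsilon_x=\begin{pmatrix}0&-x_3&x_2\\ x_3&0&-x_1\\-x_2&x_1&0\end{pmatrix},$$ $\xi_x(u\wedge v)=\langle\epsilon_x(u),v\rangle$, $\eta_{yd}(u\wedge v)=(\epsilon_y+\delta_d)\pi(u\wedge v)$, where $\pi(u\wedge v)=u\times v$ is the standard vector product in $\mathbb{R}^3$, and $\sigma_z(u)=\langle z,u\rangle$. For $\lambda\in\mathbb{R}\setminus\{0\}$, $\mathcal{F}(\mathbb{R}^3,\xi,\eta,\sigma,\lambda)$ is the vector space $\mathbb{R}\times\mathbb{R}^3$ with multiplication $$\begin{pmatrix}\alpha\\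 u\end{pmatrix}\circ\begin{pmatrix}\beta\\ v\end{pmatrix}=\begin{pmatrix}\alpha\beta+\alpha\sigma(v)+\beta\sigma(u)+\sigma(u)\sigma(v)+\lambda^2\xi(u\wedge v)-\lambda^2\langle u,v\rangle\\ \lambda(\alpha+\sigma(u))v+\lambda(\beta+\sigma(v))u+\lambda^2\eta(u\wedge v)\end{pmatrix}.$$ Definition of $\mathcal{S}$. Let $\mathcal{T}_1=\{d\in\mathcal{T}\mid d_1=d_2=d_3\}$, $\mathcal{T}_2=\{d\in\mathcal{T}\mid d_1=d_2<d_3\}$, $\mathcal{T}_3=\{d\in\mathcal{T}\mid d_1<d_2=d_3\}$, $\mathcal{T}_4=\{d\in\mathcal{T}\mid d_1<d_2<d_3\}$. For $i\in\{1,2,3,4\}$ let $G_i=\{\varphi\in \mathrm{SO}(\mathbb{R}^3)\mid\varphi\delta_d\varphi^{-1}=\delta_d\}$ for any $d\in\mathcal{T}_i$ (this does not depend on the choice of $d\in\mathcal{T}_i$). A transversal for the orbit set of a group action on a set $X$ is a subset of $X$ meeting every orbit in exactly one point. For each $i$, let $\mathcal{Q}_i$ be a fixed transversal for the orbit set of the action of $G_i$ on $\mathbb{R}^3\times\mathbb{R}^3$ given by $\varphi\cdot(y,z)=(\varphi(y),\varphi(z))$, and put $\mathcal{C}_{i0}=\{0\}\times\mathcal{Q}_i\subset\mathbb{R}^3\times\mathbb{R}^3\times\mathbb{R}^3$. Let $N$ be the set of non-negative real numbers and $P$ the set of positive real numbers; write $R=\mathbb{R}$. Identify $(x,y,z)\in\mathbb{R}^3\times\mathbb{R}^3\times\mathbb{R}^3$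 with the $3\times3$-matrix with columns $x,y,z$. A matrix with entries among the symbols $0,N,P,R$ denotes the set of all real $3\times3$-matrices whose entries lie in the respective sets ($0$ standing for $\{0\}$). Set $$\mathcal{C}_1=\mathcal{C}_{10}\cup\begin{pmatrix}P&R&R\\0&0&N\\0&0&0\end{pmatrix}\cup\begin{pmatrix}P&R&R\\0&P&R\\0&0&R\end{pmatrix},$$ $$\mathcal{C}_2=\mathcal{C}_{20}\cup\begin{pmatrix}0&0&0\\0&0&N\\P&R&R\end{pmatrix}\cup\begin{pmatrix}0&0&R\\0&P&R\\P&R&R\end{pmatrix}\cup\begin{pmatrix}0&0&0\\P&R&R\\0&0&N\end{pmatrix}\cup\begin{pmatrix}0&0&P\\P&R&R\\0&0&R\end{pmatrix}\cup\begin{pmatrix}0&0&R\\P&R&R\\0&P&R\end{pmatrix}\cup\begin{pmatrix}0&P&R\\P&R&R\\0&R&R\end{pmatrix}\cup\begin{pmatrix}0&R&R\\P&R&R\\P&R&R\end{pmatrix},$$ $$\mathcal{C}_3=\mathcal{C}_{30}\cup\begin{pmatrix}P&R&R\\0&0&N\\0&0&0\end{pmatrix}\cup\begin{pmatrix}P&R&R\\0&P&R\\0&0&R\end{pmatrix}\cup\begin{pmatrix}0&0&R\\0&0&P\\P&R&R\end{pmatrix}\cup\begin{pmatrix}0&0&N\\0&0&0\\P&R&R\end{pmatrix}\cup\begin{pmatrix}0&P&R\\0&0&R\\P&R&R\end{pmatrix}\cup\begin{pmatrix}0&R&R\\0&P&R\\P&R&R\end{pmatrix}\cup\begin{pmatrix}P&R&R\\0&R&R\\P&R&R\end{pmatrix},$$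 $$\mathcal{C}_4=\mathcal{C}_{40}\cup\begin{pmatrix}P&R&R\\0&0&P\\0&0&R\end{pmatrix}\cup\begin{pmatrix}P&R&R\\0&0&0\\0&0&N\end{pmatrix}\cup\begin{pmatrix}P&R&R\\0&P&R\\0&R&R\end{pmatrix}\cup\begin{pmatrix}P&R&R\\0&0&R\\0&P&R\end{pmatrix}\cup\begin{pmatrix}0&0&P\\P&R&R\\0&0&R\end{pmatrix}\cup\begin{pmatrix}0&0&0\\P&R&R\\0&0&N\end{pmatrix}\cup\begin{pmatrix}0&P&R\\P&R&R\\0&R&R\end{pmatrix}\cup\begin{pmatrix}0&0&R\\P&R&R\\0&P&R\end{pmatrix}$$ $$\cup\begin{pmatrix}0&0&P\\0&0&R\\P&R&R\end{pmatrix}\cup\begin{pmatrix}0&0&0\\0&0&N\\P&R&R\end{pmatrix}\cup\begin{pmatrix}0&P&R\\0&R&R\\P&R&R\end{pmatrix}\cup\begin{pmatrix}0&0&R\\0&P&R\\P&R&R\end{pmatrix}\cup\begin{pmatrix}0&R&R\\P&R&R\\P&R&R\end{pmatrix}\cup\begin{pmatrix}P&R&R\\0&R&R\\P&R&R\end{pmatrix}\cup\begin{pmatrix}P&R&R\\P&R&R\\R&R&R\end{pmatrix}.$$ Finally $\mathcal{S}=\bigcup_{i=1}^4\mathcal{C}_i\times\mathcal{T}_i\times(\mathbb{R}\setminus\{0\})$, whose elements are written $(x,y,z,d,\lambda)$ with $(x,y,z)\in\mathcal{C}_i$, $d\in\mathcal{T}_i$, $\lambda\in\mathbb{R}\setminus\{0\}$.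 *)

(* Defs.v *)
From HB Require Import structures.
From mathcomp Require Import all_boot all_order all_algebra ring.
From mathcomp Require Import boolp classical_sets reals.

Set Implicit Arguments.
Unset Strict Implicit.
Unset Printing Implicit Defensive.

Import Order.TTheory GRing.Theory Num.Theory.

Local Open Scope classical_set_scope.
Local Open Scope ring_scope.

Record algebra (R : realType) := Algebra {
  carrier :> vectType R;
  amul : {bilinear carrier -> carrier -> carrier} }.
Arguments amul {R a}.

Definition algdim (R : realType) (A : algebra R) : nat := \dim {:A}.

Definition division_algebra (R : realType) (A : algebra R) : Prop :=
  forall a : A, a != 0 ->
    bijective (fun x => amul a x) /\ bijective (fun x => amul x a).

Definition subalgebra (R : realType) (A : algebra R) (U : {vspace A}) : Prop :=
  forall x y : A, x \in U -> y \in U -> amul x y \in U.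

Definition generated (R : realType) (A : algebra R) (a : A) : set A :=
  [set x | forall U : {vspace A}, subalgebra U -> a \in U -> x \in U].

Definition power_commutative (R : realType) (A : algebra R) : Prop :=
  forall (a x y : A), generated a x -> generated a y -> amul x y = amul y x.

Definition isomorphic (R : realType) (A B : algebra R) : Prop :=
  exists f : {linear A -> B},
    bijective f /\ forall x y : A, f (amul x y) = amul (f x) (f y).

Notation vec3 R := 'cV[R]_3.

Definition dot (R : realType) (u v : vec3 R) : R := \sum_i u i 0 * v i 0.

Definition mx3 (R : realType) (a00 a01 a02 a10 a11 a12 a20 a21 a22 : R) :
    'M[R]_3 :=
  \matrix_(i, j) (nth [::] [:: [:: a00; a01; a02];
                               [:: a10; a11; a12];
                               [:: a20; a21; a22]] i)`_j.

Definition cross (R : realType) (u v : vec3 R) : vec3 R :=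
  \col_i [:: u 1 0 * v 2 0 - u 2 0 * v 1 0;
             u 2 0 * v 0 0 - u 0 0 * v 2 0;
             u 0 0 * v 1 0 - u 1 0 * v 0 0]`_i.

Definition delta (R : realType) (d : vec3 R) : 'M[R]_3 :=
  mx3 (d 0 0) 0       0
      0       (d 1 0) 0
      0       0       (d 2 0).

Definition epsilon (R : realType) (x : vec3 R) : 'M[R]_3 :=
  mx3 0         (- x 2 0) (x 1 0)
      (x 2 0)   0         (- x 0 0)
      (- x 1 0) (x 0 0)   0.

(* A linear map on the exterior square of R^3 is represented by the
   corresponding alternating bilinear map (u, v) |-> f (u /\ v). *)
Definition xi (R : realType) (x : vec3 R) (u v : vec3 R) : R^o :=
  dot (epsilon x *m u) v.

Definition eta (R : realType) (y d : vec3 R) (u v : vec3 R) : vec3 R :=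
  (epsilon y + delta d) *m cross u v.

Definition sigma (R : realType) (z : vec3 R) (u : vec3 R) : R^o := dot z u.

Lemma dotDr (R : realType) (a : R) (u v w : vec3 R) :
  dot u (a *: v + w) = a * dot u v + dot u w.
Proof.
rewrite /dot mulr_sumr -big_split; apply: eq_bigr => i _.
by rewrite !mxE /=; ring.
Qed.

Lemma dotC (R : realType) (u v : vec3 R) : dot u v = dot v u.
Proof. by apply: eq_bigr => i _; rewrite mulrC. Qed.

Lemma dotDl (R : realType) (a : R) (u v w : vec3 R) :
  dot (a *: v + w) u = a * dot v u + dot w u.
Proof. by rewrite dotC dotDr !(dotC u). Qed.

Lemma crossDr (R : realType) (a : R) (u v w : vec3 R) :
  cross u (a *: v + w) = a *: cross u v + cross u w.
Proof.
apply/matrixP => i j; rewrite !mxE.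
by case: i => [[|[|[|//]]] ?] /=; ring.
Qed.

Lemma crossN (R : realType) (u v : vec3 R) : cross u v = - cross v u.
Proof.
apply/matrixP => i j; rewrite !mxE.
by case: i => [[|[|[|//]]] ?] /=; ring.
Qed.

Lemma crossDl (R : realType) (a : R) (u v w : vec3 R) :
  cross (a *: v + w) u = a *: cross v u + cross w u.
Proof. by rewrite crossN crossDr opprD -scalerN -!crossN. Qed.

Lemma sigma_linear (R : realType) (z : vec3 R) : linear (sigma z).
Proof. by move=> a u v; rewrite /sigma dotDr. Qed.

HB.instance Definition _ (R : realType) (z : vec3 R) :=
  GRing.isLinear.Build R (vec3 R) R^o *:%R (sigma z) (sigma_linear z).

Lemma xi_bilinear (R : realType) (x : vec3 R) :
  bilinear_for (GRing.Scale.Law.clone _ _ ( *:%R ) _)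
    (GRing.Scale.Law.clone _ _ ( *:%R ) _) (xi x).
Proof.
split=> [u a v w | u a v w]; rewrite /xi.
  by rewrite mulmxDr -scalemxAr dotDl.
by rewrite dotDr.
Qed.

HB.instance Definition _ (R : realType) (x : vec3 R) :=
  bilinear_isBilinear.Build R (vec3 R) (vec3 R) R^o *:%R *:%R (xi x)
    (xi_bilinear x).

Lemma eta_bilinear (R : realType) (y d : vec3 R) :
  bilinear_for (GRing.Scale.Law.clone _ _ ( *:%R ) _)
    (GRing.Scale.Law.clone _ _ ( *:%R ) _) (eta y d).
Proof.
split=> [u a v w | u a v w]; rewrite /eta.
  by rewrite crossDl mulmxDr -scalemxAr.
by rewrite crossDr mulmxDr -scalemxAr.
Qed.

HB.instance Definition _ (R : realType) (y d : vec3 R) :=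
  bilinear_isBilinear.Build R (vec3 R) (vec3 R) (vec3 R) *:%R *:%R (eta y d)
    (eta_bilinear y d).

Definition Fmul (R : realType) (f : {bilinear vec3 R -> vec3 R -> R^o})
    (g : {bilinear vec3 R -> vec3 R -> vec3 R}) (s : {linear vec3 R -> R^o})
    (l : R) (p q : R^o * vec3 R) : R^o * vec3 R :=
  let: (a, u) := p in let: (b, v) := q in
  (a * b + a * s v + b * s u + s u * s v + l ^+ 2 * f u v - l ^+ 2 * dot u v,
   (l * (a + s u)) *: v + (l * (b + s v)) *: u + l ^+ 2 *: g u v).

Lemma Fmul_bilinear (R : realType) (f : {bilinear vec3 R -> vec3 R -> R^o})
    (g : {bilinear vec3 R -> vec3 R -> vec3 R}) (s : {linear vec3 R -> R^o})
    (l : R) :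
  bilinear_for (GRing.Scale.Law.clone _ _ ( *:%R ) _)
    (GRing.Scale.Law.clone _ _ ( *:%R ) _) (Fmul f g s l).
Proof.
split=> [[b v] a [a1 u1] [a2 u2] | [b v] a [a1 u1] [a2 u2]].
  rewrite /Fmul /= linearP linearPl dotDl linearPl; congr pair.
    by rewrite /= /GRing.scale /=; ring.
  by apply/matrixP => i j; rewrite !mxE /= /GRing.scale /=; ring.
rewrite /Fmul /= linearP linearPr dotDr linearPr; congr pair.
  by rewrite /= /GRing.scale /=; ring.
by apply/matrixP => i j; rewrite !mxE /= /GRing.scale /=; ring.
Qed.

HB.instance Definition _ (R : realType)
    (f : {bilinear vec3 R -> vec3 R -> R^o})
    (g : {bilinear vec3 R -> vec3 R -> vec3 R}) (s : {linear vec3 R -> R^o})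
    (l : R) :=
  bilinear_isBilinear.Build R _ _ _ *:%R *:%R (Fmul f g s l)
    (Fmul_bilinear f g s l).

Definition calF (R : realType) (f : {bilinear vec3 R -> vec3 R -> R^o})
    (g : {bilinear vec3 R -> vec3 R -> vec3 R}) (s : {linear vec3 R -> R^o})
    (l : R) : algebra R :=
  @Algebra R (R^o * vec3 R)%type (Fmul f g s l).

Definition calT (R : realType) : set (vec3 R) :=
  [set d : vec3 R | 0 < d 0 0 /\ d 0 0 <= d 1 0 <= d 2 0].
Definition T1 (R : realType) : set (vec3 R) :=
  [set d : vec3 R | calT d /\ (d 0 0 = d 1 0 /\ d 1 0 = d 2 0)].
Definition T2 (R : realType) : set (vec3 R) :=
  [set d : vec3 R | calT d /\ (d 0 0 = d 1 0 /\ d 1 0 < d 2 0)].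
Definition T3 (R : realType) : set (vec3 R) :=
  [set d : vec3 R | calT d /\ (d 0 0 < d 1 0 /\ d 1 0 = d 2 0)].
Definition T4 (R : realType) : set (vec3 R) :=
  [set d : vec3 R | calT d /\ (d 0 0 < d 1 0 /\ d 1 0 < d 2 0)].

Definition SO3 (R : realType) : set 'M[R]_3 :=
  [set phi | phi^T *m phi = 1%:M /\ \det phi = 1].

(* For D one of T1, .., T4 the condition is the same for every d in D. *)
Definition stab (R : realType) (D : set (vec3 R)) : set 'M[R]_3 :=
  [set phi | SO3 phi /\
    forall d, D d -> phi *m delta d *m invmx phi = delta d].

Definition orbit2 (R : realType) (G : set 'M[R]_3) (p : vec3 R * vec3 R) :
    set (vec3 R * vec3 R) :=
  [set (phi *m p.1, phi *m p.2) | phi in G].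

Definition transversal2 (R : realType) (G : set 'M[R]_3)
    (Q : set (vec3 R * vec3 R)) : Prop :=
  forall p, exists! q, (Q `&` orbit2 G p) q.

Definition triple (R : realType) : Type := (vec3 R * vec3 R * vec3 R)%type.

Definition C0 (R : realType) (Q : set (vec3 R * vec3 R)) : set (triple R) :=
  [set (0, q.1, q.2) | q in Q].

(* The matrix with columns x, y, z has i-th row (x_i, y_i, z_i). *)
Definition rowin (R : realType) (i : 'I_3) (A B C : set R) : set (triple R) :=
  [set w : triple R | [/\ A (w.1.1 i 0), B (w.1.2 i 0) & C (w.2 i 0)]].

Definition matset (R : realType) (a00 a01 a02 a10 a11 a12 a20 a21 a22 : set R) :
    set (triple R) :=
  rowin 0 a00 a01 a02 `&` rowin 1 a10 a11 a12 `&` rowin 2 a20 a21 a22.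

Section Patterns.
Context (K : realType).
Implicit Types Q : set (vec3 K * vec3 K).

Local Notation O := ([set 0] : set K) (only parsing).
Local Notation N := ([set t | 0 <= t] : set K) (only parsing).
Local Notation P := ([set t | 0 < t] : set K) (only parsing).
Local Notation R := ([set: K] : set K) (only parsing).

Definition C1 Q : set (triple K) :=
  C0 Q
  `|` matset P R R
             O O N
             O O O
  `|` matset P R R
             O P R
             O O R.

Definition C2 Q : set (triple K) :=
  C0 Q
  `|` matset O O O
             O O N
             P R R
  `|` matset O O R
             O P R
             P R R
  `|` matset O O O
             P R R
             O O N
  `|` matset O O P
             P R R
             O O R
  `|` matset O O R
             P R R
             O P R
  `|` matset O P R
             P R R
             O R R
  `|` matset O R R
             P R R
             P R R.

Definition C3 Q : set (triple K) :=
  C0 Q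
  `|` matset P R R
             O O N
             O O O
  `|` matset P R R
             O P R
             O O R
  `|` matset O O R
             O O P
             P R R
  `|` matset O O N
             O O O
             P R R
  `|` matset O P R
             O O R
             P R R
  `|` matset O R R
             O P R
             P R R
  `|` matset P R R
             O R R
             P R R.

Definition C4 Q : set (triple K) :=
  C0 Q
  `|` matset P R R
             O O P
             O O R
  `|` matset P R R
             O O O
             O O N
  `|` matset P R R
             O P R
             O R R
  `|` matset P R R
             O O R
             O P R
  `|` matset O O P
             P R R
             O O R
  `|` matset O O O
             P R R
             O O N
  `|` matset O P R
             P R R
             O R R
  `|` matset O O R
             P R R
             O P R
  `|` matset O O P
             O O R
             P R R
  `|` matset O O O
             O O N
             P R R
  `|` matset O P R
             O R R
             P R R
  `|` matset O O R
             O P R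
             P R R
  `|` matset O R R
             P R R
             P R R
  `|` matset P R R
             O R R
             P R R
  `|` matset P R R
             P R R
             R R R.

End Patterns.

Definition params (R : realType) : Type := (triple R * vec3 R * R)%type.

Definition calS (R : realType) (Q1 Q2 Q3 Q4 : set (vec3 R * vec3 R)) :
    set (params R) :=
  (C1 Q1 `*` @T1 R `*` [set l | l != 0])
  `|` (C2 Q2 `*` @T2 R `*` [set l | l != 0])
  `|` (C3 Q3 `*` @T3 R `*` [set l | l != 0])
  `|` (C4 Q4 `*` @T4 R `*` [set l | l != 0]).

Definition Falg (R : realType) (w : params R) : algebra R :=
  let: (x, y, z, d, l) := w in calF (xi x) (eta y d) (sigma z) l.

(* Membership in {Falg w | w in calS}; a predicate because classical sets of
   algebras would be universe inconsistent. *)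
Definition familyF (R : realType) (Q1 Q2 Q3 Q4 : set (vec3 R * vec3 R))
    (B : algebra R) : Prop :=
  exists2 w, calS Q1 Q2 Q3 Q4 w & Falg w = B.

(* Main.v *)
(* Let A be a four-dimensional power-commutative division algebra.  By Hopf's
   theorem, proved here by elementary means, commutative division algebras have
   dimension at most two, so every element lies in a plane subalgebra, also for
   the symmetrised product.  An idempotent e is universal if x^2 is in <e, x>
   for all x.  The operator T = 2 L_e - 1 of an idempotent e of the symmetrised
   algebra acts on T(A) modulo e as a scalar, because the planes <e, Tv> are
   limits of plane subalgebras; a discussion of its rank produces a universal
   idempotent.  Multiplication by it is a scalar lambda modulo e and untwists A
   into a quadratic algebra R + R^3, whose product is described by a vector x
   and a matrix epsilon_y + M with M symmetric; the division property makes M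
   definite, and a rotation diagonalises it.  Since e is the only universal
   idempotent of F(x,y,z,d,lambda), isomorphisms within the family are rotations
   commuting with delta_d, and the sets C_i are normal forms for the action of
   the group of these rotations on the triples (x,y,z). *)
Require Import Defs.
From HB Require Import structures.
From mathcomp Require Import all_boot all_order all_algebra.
From mathcomp Require Import ring lra.
From mathcomp Require Import boolp classical_sets reals polyrcf.

Set Implicit Arguments.
Unset Strict Implicit.
Unset Printing Implicit Defensive.

Import Order.TTheory GRing.Theory Num.Theory.
Local Open Scope ring_scope.

(** An idempotent found by solving a cubic need not be universal, so the proof must be able to pass
    to another one. The tool is the identity [(e + t v)^2 - (e + t v) = t (T v + t v^2)]: for
    [t != 0] the plane algebra of [e + t v] contains [T v + t v^2], so at [t = 0] the span of [e]
    and [T v] is a subalgebra whenever it is a plane, and [e] is universal as soon as [T] is onto.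
    In lower rank, hyperplane arguments and the squares of elements of the kernel of [T] exclude the
    case, supply a better idempotent, or show that [e] is universal after all. Limits are algebraic:
    linear dependence is the vanishing of minors, these are polynomials in [t], and a polynomial
    that vanishes off 0 vanishes at 0. Hopf's theorem becomes elementary because [x^2 = y^2] forces
    [x = y] or [x = - y] in a commutative algebra without zero divisors: in dimension three or four
    one finds either an eigenvector of a multiplication or two essentially different elements with
    equal squares. *)

Section PolyFun.
Context (R : realType).

Definition polyfun (u : R -> R) := exists p : {poly R}, forall t, u t = p.[t].

Lemma polyfunC c : polyfun (fun _ => c).
Proof. by exists c%:P => t; rewrite hornerC. Qed.

Lemma polyfunX : polyfun id.
Proof. by exists 'X => t; rewrite hornerX. Qed.

Lemma polyfunD u v : polyfun u -> polyfun v -> polyfun (fun t => u t + v t).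
Proof. by move=> [p hp] [q hq]; exists (p + q) => t; rewrite hornerD hp hq. Qed.

Lemma polyfunM u v : polyfun u -> polyfun v -> polyfun (fun t => u t * v t).
Proof. by move=> [p hp] [q hq]; exists (p * q) => t; rewrite hornerM hp hq. Qed.

Lemma polyfunN u : polyfun u -> polyfun (fun t => - u t).
Proof. by move=> [p hp]; exists (- p) => t; rewrite hornerN hp. Qed.

Lemma polyfun_sum (I : finType) (u : I -> R -> R) :
  (forall i, polyfun (u i)) -> polyfun (fun t => \sum_i u i t).
Proof.
move=> h; have {h} /choice[p hp] : forall i, exists p : {poly R}, forall t, u i t = p.[t] by [].
by exists (\sum_i p i) => t; rewrite horner_sum; apply: eq_bigr => i _.
Qed.

(** The integers [1, ..., size p] are more roots than a non-zero [p] can have. *)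
Lemma polyfun_eq0 u :
  polyfun u -> (forall t, t != 0 -> u t = 0) -> forall t, u t = 0.
Proof.
move=> [p hp] h t; rewrite hp; suff -> : p = 0 by rewrite horner0.
apply: (@roots_geq_poly_eq0 _ _ [seq i.+1%:R | i <- iota 0 (size p)]).
- by apply/allP=> x /mapP[i _ ->]; rewrite rootE -hp h // pnatr_eq0.
- rewrite map_inj_uniq ?iota_uniq // => i j /eqP.
  by rewrite eqr_nat => /eqP[].
- by rewrite size_map size_iota.
Qed.

Lemma cubic_root (a b c d : R) : a != 0 ->
  exists t, a * t ^+ 3 + b * t ^+ 2 + c * t + d = 0.
Proof.
move=> a0; pose p := Poly [:: d; c; b; a].
have sp : size p = 4%N by rewrite (@PolyK _ 0).
have [|t /rootP ht] := @odd_poly_root R p; first by rewrite sp.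
by exists t; rewrite -ht horner_Poly /=; ring.
Qed.

Lemma cubic_pos_root (a b c d : R) : 0 < a -> d < 0 ->
  exists2 t, 0 < t & a * t ^+ 3 + b * t ^+ 2 + c * t + d = 0.
Proof.
move=> a0 d0; pose p := Poly [:: d; c; b; a].
have pE t : p.[t] = a * t ^+ 3 + b * t ^+ 2 + c * t + d.
  by rewrite horner_Poly /=; ring.
(* A Cauchy-type bound: at [M] the cubic term dominates the other three, while the value at 0 is
   [d < 0]. *)
pose M := 1 + (`|b| + `|c| + `|d|) / a.
have M1 : 1 <= M by rewrite lerDl divr_ge0 ?addr_ge0 // ltW.
have aM : a * M = a + `|b| + `|c| + `|d|.
  by rewrite /M mulrDr mulr1 mulrC mulfVK ?gt_eqF // !addrA.
have hM : 0 <= p.[M].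
  rewrite pE.
  have hb : - `|b| <= b by rewrite lerNl -normrN ler_norm.
  have hc : - `|c| <= c by rewrite lerNl -normrN ler_norm.
  have hd : - `|d| <= d by rewrite lerNl -normrN ler_norm.
  have M2 : 1 <= M ^+ 2 by rewrite exprn_ege1.
  have MM2 : M <= M ^+ 2 by rewrite expr2 ler_peMl // (le_trans ler01).
  have e3 : a * M ^+ 3 = (a + `|b| + `|c| + `|d|) * M ^+ 2.
    by rewrite -aM; ring.
  rewrite e3.
  have nb := normr_ge0 b; have nc := normr_ge0 c; have nd := normr_ge0 d.
  have k1 : 0 <= (b + `|b|) * M ^+ 2 by rewrite mulr_ge0 // ?sqr_ge0 //; lra.
  have k2 : 0 <= `|c| * (M ^+ 2 - M) by rewrite mulr_ge0 // subr_ge0.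
  have k3 : 0 <= (c + `|c|) * M by rewrite mulr_ge0 //; lra.
  have k4 : 0 <= `|d| * (M ^+ 2 - 1) by rewrite mulr_ge0 // subr_ge0.
  have k5 : 0 <= a * M ^+ 2 by rewrite mulr_ge0 // ?sqr_ge0 // ltW.
  have k6 : 0 <= d + `|d| by lra.
  nra.
have [||t ht /rootP pt] := @poly_ivt R p 0 M; first lra.
  by rewrite hM andbT pE; lra.
exists t; last by rewrite -pE.
move: ht => /andP[t0 _].
rewrite lt_neqAle t0 andbT; apply/eqP => t00.
by move: pt; rewrite pE -t00; lra.
Qed.

(** Five values determine a polynomial of degree four. The point 0 is avoided because [star_coef]
    obtains its identity after a division by [s]. *)
Lemma poly4_eq0 (a b c d e : R) :
  (forall s, s != 0 -> a + b * s + c * s ^+ 2 + d * s ^+ 3 + e * s ^+ 4 = 0) ->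
  [/\ a = 0, b = 0, c = 0, d = 0 & e = 0].
Proof.
move=> h.
have h1 := h 1 (oner_neq0 _).
have h2 := h 2 ltac:(by rewrite pnatr_eq0).
have h3 := h 3 ltac:(by rewrite pnatr_eq0).
have h4 := h 4 ltac:(by rewrite pnatr_eq0).
have h5 := h 5 ltac:(by rewrite pnatr_eq0).
split; lra.
Qed.

End PolyFun.

Ltac vec := apply/rowP => ?; rewrite !mxE; ring.
Ltac vecf := apply/rowP => ?; rewrite !mxE; field.

(** * Spans and independence of a few row vectors *)

Section Indep.
Context (R : realType) (n : nat).
Local Notation V := 'rV[R]_n.
Implicit Types x y z w v : V.

(** Coefficients are kept explicit so that later identities between vectors can be checked
    coordinatewise by [vec]. *)
Definition in1 x w := exists a, w = a *: x.
Definition in2 x y w := exists a b, w = a *: x + b *: y.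
Definition in3 x y z w := exists a b c, w = a *: x + b *: y + c *: z.
Definition in4 x y z v w :=
  exists a b c d, w = a *: x + b *: y + c *: z + d *: v.

Definition fr2 x y := forall a b, a *: x + b *: y = 0 -> a = 0 /\ b = 0.
Definition fr3 x y z := forall a b c, a *: x + b *: y + c *: z = 0 ->
  [/\ a = 0, b = 0 & c = 0].
Definition fr4 x y z w := forall a b c d,
  a *: x + b *: y + c *: z + d *: w = 0 -> [/\ a = 0, b = 0, c = 0 & d = 0].

Lemma solve_for (d : R) (u w : V) : d != 0 -> u + d *: w = 0 ->
  w = (- d^-1) *: u.
Proof.
move=> d0 h; have -> : u = - (d *: w) by rewrite -[u](addrK (d *: w)) h add0r.
by rewrite scalerN scaleNr opprK scalerA mulVf // scale1r.
Qed.

Lemma in1_or_fr2 x w : x != 0 -> in1 x w \/ fr2 x w.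
Proof.
move=> x0; case: (pselect (in1 x w)) => [|nin]; [by left|right => a b h].
case: (eqVneq b 0) => [b0|b0].
  split=> //; move: h; rewrite b0 scale0r addr0 => /eqP.
  by rewrite scaler_eq0 (negPf x0) orbF => /eqP.
case: nin; rewrite (solve_for b0 h); exists (- b^-1 * a).
by rewrite scalerA.
Qed.

Lemma in2_or_fr3 x y w : fr2 x y -> in2 x y w \/ fr3 x y w.
Proof.
move=> f; case: (pselect (in2 x y w)) => [|nin]; [by left|right => a b c h].
case: (eqVneq c 0) => [c0|c0].
  by move: h; rewrite c0 scale0r addr0 => /f[-> ->].
case: nin; rewrite (solve_for c0 h); exists (- c^-1 * a), (- c^-1 * b).
by rewrite scalerDr !scalerA.
Qed.

Lemma in3_or_fr4 x y z w : fr3 x y z -> in3 x y z w \/ fr4 x y z w.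
Proof.
move=> f; case: (pselect (in3 x y z w)) => [|nin]; [by left|right => a b c d h].
case: (eqVneq d 0) => [d0|d0].
  by move: h; rewrite d0 scale0r addr0 => /f[-> -> ->].
case: nin; rewrite (solve_for d0 h).
by exists (- d^-1 * a), (- d^-1 * b), (- d^-1 * c); rewrite !scalerDr !scalerA.
Qed.

Lemma fr2_neq0 x y : fr2 x y -> x != 0.
Proof.
move=> f; apply/eqP => x0; have [] := f 1 0; first by rewrite x0; vec.
by move/eqP; rewrite oner_eq0.
Qed.

Lemma fr2C x y : fr2 x y -> fr2 y x.
Proof. by move=> f a b; rewrite addrC => /f[]. Qed.

Lemma fr3_12 x y z : fr3 x y z -> fr2 x y.
Proof.
by move=> f a b h; case: (f a b 0) => //; rewrite -h; vec.
Qed.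

Lemma fr4_123 x y z w : fr4 x y z w -> fr3 x y z.
Proof.
by move=> f a b c h; case: (f a b c 0) => //; rewrite -h; vec.
Qed.

Lemma fr2_nin x y : fr2 x y -> ~ in1 x y.
Proof.
move=> f [a h]; have [] := f a (-1); first by rewrite h; vec.
by move=> _ /eqP; rewrite oppr_eq0 oner_eq0.
Qed.

Lemma fr3_nin x y z : fr3 x y z -> ~ in2 x y z.
Proof.
move=> f [a [b h]]; have [] := f a b (-1); first by rewrite h; vec.
by move=> _ _ /eqP; rewrite oppr_eq0 oner_eq0.
Qed.

Lemma fr4_nin x y z w : fr4 x y z w -> ~ in3 x y z w.
Proof.
move=> f [a [b [c h]]]; have [] := f a b c (-1); first by rewrite h; vec.
by move=> _ _ _ /eqP; rewrite oppr_eq0 oner_eq0.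
Qed.

(* Linear dependence in terms of minors, hence preserved by limits. *)
Definition dep2 x y := forall i j, x 0 i * y 0 j - x 0 j * y 0 i = 0.
Definition dep3 x y z := forall i j k,
  (x 0 i * y 0 j - x 0 j * y 0 i) * z 0 k
  + (x 0 j * y 0 k - x 0 k * y 0 j) * z 0 i
  + (x 0 k * y 0 i - x 0 i * y 0 k) * z 0 j = 0.

Lemma dep2_in1 x y : x != 0 -> dep2 x y -> in1 x y.
Proof.
move=> /rV0Pn[i xi] h; exists (y 0 i / x 0 i).
apply/rowP => j; rewrite !mxE; apply: (mulfI xi).
have := h i j; move/eqP; rewrite subr_eq0 => /eqP ->.
by field.
Qed.

(** Some minor of [x] and [y] is non-zero, and Cramer's rule with this minor gives the
    coefficients. *)
Lemma dep3_in2 x y z : fr2 x y -> dep3 x y z -> in2 x y z.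
Proof.
move=> f h.
have [i [j ij]] : exists i j, x 0 i * y 0 j - x 0 j * y 0 i != 0.
  apply: contrapT => hn; apply: (fr2_nin f); apply: dep2_in1.
    exact: fr2_neq0 f.
  move=> i j; apply: contrapT => /eqP hij; apply: hn.
  by exists i, j.
pose D := x 0 i * y 0 j - x 0 j * y 0 i.
exists ((y 0 j * z 0 i - y 0 i * z 0 j) / D), ((x 0 i * z 0 j - x 0 j * z 0 i) / D).
apply/rowP => k; rewrite !mxE; apply: (mulfI ij).
have -> : (x 0 i * y 0 j - x 0 j * y 0 i) * z 0 k =
  - ((x 0 j * y 0 k - x 0 k * y 0 j) * z 0 i
  + (x 0 k * y 0 i - x 0 i * y 0 k) * z 0 j).
  by apply/eqP; rewrite -addr_eq0 addrA; apply/eqP; exact: h.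
rewrite -/D; field; exact: ij.
Qed.

Lemma in2_dep3 x y u v w : in2 x y u -> in2 x y v -> in2 x y w -> dep3 u v w.
Proof.
by move=> [a [b ->]] [c [d ->]] [e [f ->]] i j k; rewrite !mxE; ring.
Qed.

Lemma in1_dep2 x u v : in1 x u -> in1 x v -> dep2 u v.
Proof. by move=> [a ->] [b ->] i j; rewrite !mxE; ring. Qed.

Lemma in2_l x y : in2 x y x. Proof. by exists 1, 0; vec. Qed.
Lemma in2_r x y : in2 x y y. Proof. by exists 0, 1; vec. Qed.
Lemma in2_D x y u v : in2 x y u -> in2 x y v -> in2 x y (u + v).
Proof. by move=> [a [b ->]] [c [d ->]]; exists (a + c), (b + d); vec. Qed.
Lemma in2_Z x y a u : in2 x y u -> in2 x y (a *: u).
Proof. by move=> [c [d ->]]; exists (a * c), (a * d); vec. Qed.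
Lemma in2_B x y u v : in2 x y u -> in2 x y v -> in2 x y (u - v).
Proof. by move=> [a [b ->]] [c [d ->]]; exists (a - c), (b - d); vec. Qed.

Lemma in2_trans x y u v w : in2 x y u -> in2 x y v -> in2 u v w -> in2 x y w.
Proof.
by move=> hu hv [a [b ->]]; apply: in2_D; apply: in2_Z.
Qed.

Lemma in2_swap x y u v : in2 x y u -> in2 x y v -> fr2 u v ->
  in2 u v x /\ in2 u v y.
Proof.
move=> hu hv f; split; apply: (dep3_in2 f); apply: in2_dep3 hu hv _.
  exact: in2_l.
exact: in2_r.
Qed.

Context (n4 : n = 4%N).

Lemma span_in1 x w : (w \in <<[:: x]>>%VS) -> in1 x w.
Proof. by rewrite span_seq1 => /vlineP[a ->]; exists a. Qed.

Lemma span_in2 x y w : (w \in <<[:: x; y]>>%VS) -> in2 x y w.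
Proof.
rewrite span_cons => /memv_addP[u /vlineP[a ->]] [v /span_in1[b ->] ->].
by exists a, b.
Qed.

Lemma span_in3 x y z w : (w \in <<[:: x; y; z]>>%VS) -> in3 x y z w.
Proof.
rewrite span_cons => /memv_addP[u /vlineP[a ->]] [v /span_in2[b [c ->]] ->].
by exists a, b, c; rewrite addrA.
Qed.

Lemma span_in4 x y z v w : (w \in <<[:: x; y; z; v]>>%VS) -> in4 x y z v w.
Proof.
rewrite span_cons => /memv_addP[u /vlineP[a ->]] [t /span_in3[b [c [d ->]]] ->].
by exists a, b, c, d; rewrite !addrA.
Qed.

Lemma ex_notin_span (X : seq V) : (size X < 4)%N -> exists w, w \notin <<X>>%VS.
Proof.
move=> sX; apply: contrapT => h.
have : (\dim {:V} <= size X)%N.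
  apply: leq_trans (dim_span X); apply: dimvS; apply/subvP => w _.
  by apply: contrapT => /negP hw; apply: h; exists w.
by rewrite dimvf => h4; move: (leq_ltn_trans h4 sX); rewrite /dim /= mul1n n4.
Qed.

Lemma ex_fr2 x : x != 0 -> exists y, fr2 x y.
Proof.
move=> x0; have [//|w hw] := @ex_notin_span [:: x].
exists w; case: (in1_or_fr2 w x0) => // -[a e].
by move: hw; rewrite e span_seq1 memvZ // memv_line.
Qed.

Lemma ex_fr3 x y : fr2 x y -> exists z, fr3 x y z.
Proof.
move=> f; have [//|w hw] := @ex_notin_span [:: x; y].
exists w; case: (in2_or_fr3 w f) => // -[a [b e]].
by move: hw; rewrite e memvD // memvZ // memv_span // !inE eqxx ?orbT.
Qed.

Lemma ex_fr4 x y z : fr3 x y z -> exists w, fr4 x y z w.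
Proof.
move=> f; have [//|w hw] := @ex_notin_span [:: x; y; z].
exists w; case: (in3_or_fr4 w f) => // -[a [b [c e]]].
by move: hw; rewrite e !memvD // memvZ // memv_span // !inE eqxx ?orbT.
Qed.

Lemma fr4_span x y z w : fr4 x y z w -> forall v, in4 x y z w v.
Proof.
move=> f v; apply: span_in4.
have fre : free [:: x; y; z; w].
  apply/freeP => k; rewrite !big_ord_recl big_ord0 /= addr0 !addrA => /f[h0 h1 h2 h3].
  move=> [[|[|[|[|//]]]] hi]; [rewrite -[RHS]h0|rewrite -[RHS]h1|
    rewrite -[RHS]h2|rewrite -[RHS]h3]; congr k; exact: val_inj.
have -> : <<[:: x; y; z; w]>>%VS = fullv.
  apply/eqP; rewrite eqEdim subvf (eqP fre) dimvf /dim /= mul1n.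
  by apply: eq_leq.
exact: memvf.
Qed.

End Indep.

(** * Universal idempotents of commutative algebras *)

Section CommAlg.
Context (R : realType) (n : nat).
Local Notation V := 'rV[R]_n.
Implicit Types x y z w v u e : V.
Context (m : V -> V -> V).
Context (mC : forall x y, m x y = m y x).
Context (mDl : forall x y z, m (x + y) z = m x z + m y z).
Context (mZl : forall a x y, m (a *: x) y = a *: m x y).
Context (mnz : forall x, m x x = 0 -> x = 0).

Lemma mDr x y z : m x (y + z) = m x y + m x z.
Proof. by rewrite mC mDl !(mC _ x). Qed.
Lemma mZr a x y : m x (a *: y) = a *: m x y.
Proof. by rewrite mC mZl mC. Qed.
Lemma mNl x y : m (- x) y = - m x y.
Proof. by rewrite -scaleN1r mZl scaleN1r. Qed.
Lemma mNr x y : m x (- y) = - m x y.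
Proof. by rewrite mC mNl mC. Qed.
Lemma m0l x : m 0 x = 0.
Proof. by apply: (addrI (m 0 x)); rewrite -mDl !addr0. Qed.
Lemma m0r x : m x 0 = 0.
Proof. by rewrite mC m0l. Qed.
Let mE := (mDl, mDr, mZl, mZr, mNl, mNr, m0l, m0r).

(** Since [u] and [v] may be dependent, subalgebras of dimension zero and one count as planes
    too. *)
Definition plane u v :=
  [/\ in2 u v (m u u), in2 u v (m u v) & in2 u v (m v v)].

Lemma plane_closed u v x y :
  plane u v -> in2 u v x -> in2 u v y -> in2 u v (m x y).
Proof.
move=> [h1 h2 h3] [a [b ->]] [c [d ->]]; rewrite !mE (mC v u).
by do ![apply: in2_D | apply: in2_Z].
Qed.

Context (hpl : forall x, exists u v, plane u v /\ in2 u v x).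

(** Plays the role of the subalgebra generated by [x], tested on plane subalgebras only; [hpl]
    guarantees that there is one through [x]. *)
Definition gen x y := forall u v, plane u v -> in2 u v x -> in2 u v y.

Lemma gen_refl x : gen x x. Proof. by []. Qed.
Lemma gen_Z x a y : gen x y -> gen x (a *: y).
Proof. by move=> h1 u v p ux; apply: in2_Z; apply: h1. Qed.
Lemma gen_B x y z : gen x y -> gen x z -> gen x (y - z).
Proof. by move=> h1 h2 u v p ux; apply: in2_B; [apply: h1|apply: h2]. Qed.
Lemma gen_m x y z : gen x y -> gen x z -> gen x (m y z).
Proof.
by move=> h1 h2 u v p ux; apply: plane_closed => //; [apply: h1|apply: h2].
Qed.

Lemma gen_plane x y z :
  gen x y -> gen x z -> fr2 y z -> plane y z /\ in2 y z x.
Proof.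
move=> g1 g2 f; have [u [v [p ux]]] := hpl x.
have uy := g1 _ _ p ux; have uz := g2 _ _ p ux.
have sw w : in2 u v w -> in2 y z w.
  by move=> uw; apply: (dep3_in2 f); apply: in2_dep3 uy uz uw.
by split; [split; apply: sw; apply: plane_closed|exact: sw].
Qed.

(** The polynomial curves along which the limit at 0 is taken. *)
Definition VP (F : R -> V) := forall i, polyfun (fun t => F t 0 i).

Lemma VPC v : VP (fun _ => v).
Proof. by move=> i; apply: polyfunC. Qed.
Lemma VPD F G : VP F -> VP G -> VP (fun t => F t + G t).
Proof.
move=> hF hG i; have [p hp] := polyfunD (hF i) (hG i).
by exists p => t; rewrite -hp mxE.
Qed.
Lemma VPZ (a : R -> R) F : polyfun a -> VP F -> VP (fun t => a t *: F t).
Proof.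
move=> hu hF i; have [p hp] := polyfunM hu (hF i).
by exists p => t; rewrite -hp mxE.
Qed.
Lemma VPX F : VP F -> VP (fun t => t *: F t).
Proof. by apply: VPZ; apply: polyfunX. Qed.

Lemma VPm F G : VP F -> VP G -> VP (fun t => m (F t) (G t)).
Proof.
move=> hF hG i.
have m_suml (I : finType) (f : I -> V) y : m (\sum_j f j) y = \sum_j m (f j) y.
  by elim/big_rec2: _ => [|j a b _ <-]; rewrite ?m0l ?mDl.
have m_sumr (I : finType) (f : I -> V) y : m y (\sum_j f j) = \sum_j m y (f j).
  by rewrite mC m_suml; apply: eq_bigr => j _; rewrite mC.
pose d j : V := delta_mx 0 j.
have E t : m (F t) (G t) 0 i =
    \sum_j \sum_k F t 0 j * (G t 0 k * m (d j) (d k) 0 i).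
  rewrite (row_sum_delta (F t)) (row_sum_delta (G t)) m_suml summxE.
  apply: eq_bigr => j _; rewrite m_sumr summxE; apply: eq_bigr => k _.
  by rewrite -!row_sum_delta mZl mZr !mxE.
have [p hp] : polyfun (fun t => \sum_j \sum_k F t 0 j * (G t 0 k * m (d j) (d k) 0 i)).
  do 2![apply: polyfun_sum => ?]; apply: polyfunM => //; apply: polyfunM => //.
  exact: polyfunC.
by exists p => t; rewrite E hp.
Qed.

Lemma dep3_lim F G H : VP F -> VP G -> VP H ->
  (forall t, t != 0 -> dep3 (F t) (G t) (H t)) -> dep3 (F 0) (G 0) (H 0).
Proof.
move=> hF hG hH h i j k.
apply: (polyfun_eq0 (u := fun t => (F t 0 i * G t 0 j - F t 0 j * G t 0 i) * H t 0 k
  + (F t 0 j * G t 0 k - F t 0 k * G t 0 j) * H t 0 i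
  + (F t 0 k * G t 0 i - F t 0 i * G t 0 k) * H t 0 j)).
  by do ?[apply: polyfunD|apply: polyfunM|apply: polyfunN|exact: hF|exact: hG|exact: hH].
by move=> t t0; apply: h.
Qed.

Lemma dep2_lim F G : VP F -> VP G ->
  (forall t, t != 0 -> dep2 (F t) (G t)) -> dep2 (F 0) (G 0).
Proof.
move=> hF hG h i j.
apply: (polyfun_eq0 (u := fun t => F t 0 i * G t 0 j - F t 0 j * G t 0 i)).
  by do ?[apply: polyfunD|apply: polyfunM|apply: polyfunN|exact: hF|exact: hG].
by move=> t t0; apply: h.
Qed.

Lemma gen_dep3 x y z w : gen x y -> gen x z -> gen x w -> dep3 y z w.
Proof.
move=> gy gz gw; have [u [v [p ux]]] := hpl x.
by apply: (in2_dep3 (x := u) (y := v)); [exact: gy|exact: gz|exact: gw].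
Qed.

(* Being a two-dimensional subalgebra is a closed condition on planes. *)
Lemma plane_lim F G : VP F -> VP G -> (forall t, t != 0 -> gen (F t) (G t)) ->
  fr2 (F 0) (G 0) -> plane (F 0) (G 0).
Proof.
move=> hF hG h f; split; apply: (dep3_in2 f).
- apply: (dep3_lim (H := fun t => m (F t) (F t))) => //; first exact: VPm.
  move=> t t0; apply: (gen_dep3 (x := F t)); [exact: gen_refl|exact: h|].
  by apply: gen_m; exact: gen_refl.
- apply: (dep3_lim (H := fun t => m (F t) (G t))) => //; first exact: VPm.
  move=> t t0; apply: (gen_dep3 (x := F t)); [exact: gen_refl|exact: h|].
  by apply: gen_m; [exact: gen_refl|exact: h].
- apply: (dep3_lim (H := fun t => m (G t) (G t))) => //; first exact: VPm.
  move=> t t0; apply: (gen_dep3 (x := F t)); [exact: gen_refl|exact: h|].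
  by apply: gen_m; exact: h.
Qed.

Definition idem e := e != 0 /\ m e e = e.
(** The first-order term of [(e + t v)^2 - (e + t v)]; it is locked so that rewriting treats [T e v]
    as an atom. *)
Definition T : V -> V -> V := locked (fun e v => 2 *: m e v - v).
Definition univ_idem e := idem e /\ forall x, in2 e x (m x x).
Definition has_univ_idem := exists e, univ_idem e.

Lemma TdE e v : T e v = 2 *: m e v - v. Proof. by rewrite /T -lock. Qed.
Lemma TD e x y : T e (x + y) = T e x + T e y.
Proof. by rewrite !TdE mE; vec. Qed.
Lemma TZ e a x : T e (a *: x) = a *: T e x.
Proof. by rewrite !TdE mE; vec. Qed.
Lemma TN e x : T e (- x) = - T e x.
Proof. by rewrite !TdE mE; vec. Qed.
Lemma Te e : idem e -> T e e = e.
Proof. by move=> [_ h]; rewrite TdE h; vec. Qed.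
Lemma mT e v : m e v = 2^-1 *: (T e v + v).
Proof. by rewrite TdE; vecf. Qed.
Lemma T0 e : T e 0 = 0.
Proof. by rewrite TdE m0r scaler0 subr0. Qed.
Let TE := (TD, TZ, TN).

Lemma T_plane e v : idem e -> fr2 e (T e v) -> plane e (T e v).
Proof.
move=> [_ ee].
have := @plane_lim (fun t => e + t *: v) (fun t => T e v + t *: m v v).
rewrite !scale0r !addr0; apply.
- by apply: VPD; [|apply: VPX]; apply: VPC.
- by apply: VPD; [|apply: VPX]; apply: VPC.
move=> t t0.
have -> : T e v + t *: m v v = t^-1 *: (m (e + t *: v) (e + t *: v) - (e + t *: v)).
  by rewrite !mE ee (mC v e) TdE; vecf.
by apply: gen_Z; apply: gen_B; rewrite ?ee; [apply: gen_m|]; apply: gen_refl.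
Qed.

(** On the kernel the first-order term is absent, [(e + t z)^2 - (e + t z) = t^2 z^2], so [z^2]
    replaces [T e z] in the limit. *)
Lemma kerT_plane e z : idem e -> T e z = 0 -> fr2 e (m z z) -> plane e (m z z).
Proof.
move=> [_ ee] Tz.
have := @plane_lim (fun t => e + t *: z) (fun t => m z z).
rewrite !scale0r !addr0; apply.
- by apply: VPD; [|apply: VPX]; apply: VPC.
- exact: VPC.
move=> t t0.
have -> : m z z = t^-2 *: (m (e + t *: z) (e + t *: z) - (e + t *: z)).
  by rewrite !mE ee (mC z e) (mT e z) Tz; vecf.
by apply: gen_Z; apply: gen_B; [apply: gen_m|]; apply: gen_refl.
Qed.

Lemma T_eigen e v : idem e -> fr2 e (T e v) ->
  exists t c, T e (T e v) = t *: T e v + c *: e.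
Proof.
move=> he f; have [_ [a [b h]] _] := T_plane he f.
exists (2 * b - 1), (2 * a); rewrite TdE h; vec.
Qed.

(** A map all of whose vectors are eigenvectors is a scalar: compare the eigenvalues at [T e v1], at
    [T e v] and at their sum, modulo [e]. *)
Lemma T_eigen_unif e v1 t c : idem e -> fr2 e (T e v1) ->
  T e (T e v1) = t *: T e v1 + c *: e ->
  forall v, exists c', T e (T e v) = t *: T e v + c' *: e.
Proof.
move=> he f h v; have e0 := proj1 he.
case: (in1_or_fr2 (T e v) e0) => [[x ->]|fb].
  by exists (x - t * x); rewrite TZ Te //; vec.
case: (in2_or_fr3 (T e v) f) => [[x [y ->]]|f3].
  by exists (x + y * c - t * x); rewrite !TE Te // h; vec.
have [s [d hb]] := T_eigen he fb.
have fab : fr2 e (T e (v1 + v)).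
  by move=> p q; rewrite TD => k; have [] := f3 p q q; [rewrite -k; vec|].
have [r [d' hab]] := T_eigen he fab.
move: hab; rewrite !TD h hb => hab.
have [_ tr sr] : [/\ c + d - d' = 0, t - r = 0 & s - r = 0].
  apply: f3; transitivity (t *: T e v1 + c *: e + (s *: T e v + d *: e)
     - (r *: (T e v1 + T e v) + d' *: e)); first by vec.
  by rewrite hab subrr.
exists d; have -> : s = t by lra.
by [].
Qed.

Context (n4 : n = 4%N).

Lemma in3_D x y z u v : in3 x y z u -> in3 x y z v -> in3 x y z (u + v).
Proof.
by move=> [a [b [c ->]]] [a' [b' [c' ->]]]; exists (a + a'), (b + b'), (c + c'); vec.
Qed.
Lemma in3_Z x y z a u : in3 x y z u -> in3 x y z (a *: u).
Proof.
by move=> [b [c [d ->]]]; exists (a * b), (a * c), (a * d); vec.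
Qed.
Lemma in3_B x y z u v : in3 x y z u -> in3 x y z v -> in3 x y z (u - v).
Proof. by move=> hu hv; rewrite -scaleN1r; apply/in3_D/in3_Z. Qed.
Lemma in3_1 x y z : in3 x y z x. Proof. by exists 1, 0, 0; vec. Qed.
Lemma in3_2 x y z : in3 x y z y. Proof. by exists 0, 1, 0; vec. Qed.
Lemma in3_3 x y z : in3 x y z z. Proof. by exists 0, 0, 1; vec. Qed.

Lemma in2_in3 x y z u v w :
  in3 x y z u -> in3 x y z v -> in2 u v w -> in3 x y z w.
Proof. by move=> hu hv [a [b ->]]; apply: in3_D; apply: in3_Z. Qed.

Lemma dep2_comb u v (a b c d : R) : fr2 u v ->
  dep2 (a *: u + b *: v) (c *: u + d *: v) -> a * d - b * c = 0.
Proof.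
move=> f h; apply: contrapT => /eqP D0; apply: (fr2_nin f).
apply: dep2_in1; first exact: fr2_neq0 f.
move=> i j; apply: (mulfI D0); rewrite mulr0 -(h i j) !mxE; ring.
Qed.

(** Here [T] is onto, so every [x] off the line of [e] has the form [T e v] required by
    [T_plane]. *)
Lemma univ_idem_of_rank4 e v1 v2 v3 :
  idem e -> fr4 e (T e v1) (T e v2) (T e v3) -> univ_idem e.
Proof.
move=> he f; split=> // x.
have [a [b [c [d hx]]]] := fr4_span n4 f x.
have {}hx : x = T e (a *: e + b *: v1 + c *: v2 + d *: v3).
  by rewrite !TE Te.
case: (in1_or_fr2 x (proj1 he)) => [[k ->]|].
  by exists (k ^+ 2), 0; rewrite !mE (proj2 he); vec.
by rewrite {1}hx => /(T_plane he)[]; rewrite -hx.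
Qed.

(** Otherwise [p] and [p^2] would span the plane algebra of [x]; but both lie in the span of the
    [x_i], and [x] does not. *)
Lemma dep2_outside x1 x2 x3 x p :
  (forall w, in3 x1 x2 x3 w -> in3 x1 x2 x3 (m w w)) ->
  ~ in3 x1 x2 x3 x -> in3 x1 x2 x3 p -> gen x p -> dep2 p (m p p).
Proof.
move=> cl nx hp gp; case: (eqVneq p 0) => [->|p0].
  by move=> i j; rewrite !mxE; ring.
case: (in1_or_fr2 (m p p) p0) => [h|f].
  by apply: (in1_dep2 (x := p)) => //; exists 1; rewrite scale1r.
have [_ hx] := gen_plane gp (gen_m gp gp) f.
by case: nx; apply: in2_in3 hx => //; apply: cl.
Qed.

(* For x = w + t g outside the hyperplane W of the x_i, a combination p of
   x and m x x lies in W, and the plane algebra of x meets W only in the line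
   of p; t -> 0. *)
Lemma dep2_hyper x1 x2 x3 g w w' r : fr4 x1 x2 x3 g ->
  (forall w, in3 x1 x2 x3 w -> in3 x1 x2 x3 (m w w)) ->
  in3 x1 x2 x3 w -> in3 x1 x2 x3 w' -> 2 *: m g w = r *: g + w' ->
  dep2 (r *: w - m w w) (m (r *: w - m w w) (r *: w - m w w)).
Proof.
move=> f cl hw hw' hg.
have [a [b [c [s hgg]]]] := fr4_span n4 f (m g g).
have hwg : in3 x1 x2 x3 (a *: x1 + b *: x2 + c *: x3) by exists a, b, c.
move: (a *: x1 + _ + _) hwg hgg => wg hwg hgg {a b c}.
(* This is [(r + t s) x - x^2] for [x = w + t g], the combination in which the coefficient of [g]
   cancels. *)
pose P t := r *: w - m w w + t *: ((s *: w - w') + t *: - wg).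
have VPP : VP P.
  rewrite /P; apply: VPD; first exact: VPC.
  by apply: VPX; apply: VPD; [exact: VPC|apply: VPX; exact: VPC].
have := dep2_lim VPP (VPm VPP VPP).
rewrite /P !scale0r !addr0; apply=> t t0.
have hP : in3 x1 x2 x3 (P t).
  apply: in3_D; first by apply: in3_B; [exact: in3_Z|exact: cl].
  apply/in3_Z/in3_D; first by apply: in3_B => //; exact: in3_Z.
  by rewrite -scaleN1r; do 2!apply: in3_Z.
apply: (dep2_outside (x := w + t *: g) cl _ hP).
  move=> h; apply: (fr4_nin f).
  have -> : g = t^-1 *: (w + t *: g - w) by vecf.
  by apply/in3_Z/in3_B.
have -> : P t = (r + t * s) *: (w + t *: g) - m (w + t *: g) (w + t *: g).
  have hwg2 : m g w = 2^-1 *: (r *: g + w') by rewrite -hg; vecf.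
  by rewrite !mE (mC w g) hwg2 hgg /P; vecf.
by apply: gen_B; [apply: gen_Z|apply: gen_m]; apply: gen_refl.
Qed.

(** * A hyperplane on which [e] already behaves like a universal idempotent *)

Section Star.
Context (e b c g : V) (he : idem e) (f : fr4 e b c g).
Context (star : forall w, in3 e b c w -> in2 e w (m w w)).
Context (psi : R) (we : V) (hwe : in3 e b c we).
Context (hge : 2 *: m g e = psi *: g + we).

Let ee : m e e = e. Proof. exact: (proj2 he). Qed.
Let cl w : in3 e b c w -> in3 e b c (m w w).
Proof. by move=> hw; apply: in2_in3 (star hw) => //; exact: in3_1. Qed.

(** [dep2_hyper] at [e + s u] gives a polynomial identity in [s] with top coefficient
    [q^2 (th - 1)]; if [th = 1], the coefficients of [s] and [s^2] force [q = 0]. That the same [l]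
    occurs in [u^2] and in [2 g u] is arranged by [star_shift]. *)
Lemma star_coef (u w : V) th nu q l : fr2 e u -> in3 e b c u -> in3 e b c w ->
  2 *: m e u = th *: u + nu *: e -> m u u = q *: e + l *: u ->
  2 *: m g u = l *: g + w -> psi != th -> q = 0.
Proof.
move=> fu hu hw heu huu hgu k0.
have heu2 : m e u = 2^-1 *: (th *: u + nu *: e) by rewrite -heu; vecf.
have key s : s != 0 ->
  let P := (psi - 1) + s * (l - nu) - s ^+ 2 * q in
  P ^+ 2 * (th - 1) + P * s * (psi - th) * (l - nu) - s ^+ 2 * (psi - th) ^+ 2 * q = 0.
  move=> s0 P.
  have := @dep2_hyper e b c g (e + s *: u) (we + s *: w) (psi + s * l) f cl.
  have -> : (psi + s * l) *: (e + s *: u) - m (e + s *: u) (e + s *: u) =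
     P *: e + (s * (psi - th)) *: u.
    by rewrite !mE ee (mC u e) heu2 huu /P; vecf.
  have -> : m (P *: e + (s * (psi - th)) *: u) (P *: e + (s * (psi - th)) *: u)
     = (P ^+ 2 + P * s * (psi - th) * nu + s ^+ 2 * (psi - th) ^+ 2 * q) *: e +
       (P * s * (psi - th) * th + s ^+ 2 * (psi - th) ^+ 2 * l) *: u.
    by rewrite !mE ee (mC u e) heu2 huu; vecf.
  move=> h; have {}h := dep2_comb fu (h _ _ _).
  have k : s * (psi - th) != 0 by rewrite mulf_neq0 // subr_eq0.
  apply: (mulfI k); rewrite mulr0 -[RHS]h; first ring.
  - by apply: in3_D; [exact: in3_1|exact: in3_Z].
  - by apply: in3_D => //; exact: in3_Z.
  - by rewrite mDr mZr scalerDr hge scalerA mulrC -scalerA hgu; vec.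
pose k := psi - th; pose A := psi - 1; pose B := l - nu.
have k1 : k != 0 by rewrite subr_eq0.
have [] := @poly4_eq0 R (A ^+ 2 * (th - 1)) (2 * A * B * (th - 1) + A * k * B)
  ((B ^+ 2 - 2 * A * q) * (th - 1) + k * B ^+ 2 - k ^+ 2 * q)
  (- 2 * B * q * (th - 1) - k * B * q) (q ^+ 2 * (th - 1)).
  by move=> s s0; rewrite -[RHS](key s s0) /k /A /B; ring.
move=> h0 h1 h2 h3 /eqP; rewrite mulf_eq0 expf_eq0 /= => /orP[/eqP //|/eqP th1].
have Ak : A = k by rewrite /A /k; lra.
move: h1 h2; rewrite th1 Ak !mulr0 !add0r => /eqP.
rewrite mulf_eq0 mulf_eq0 (negPf k1) /= => /eqP ->.
rewrite expr0n /= mulr0 sub0r => /eqP; rewrite oppr_eq0 mulf_eq0.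
by rewrite expf_eq0 /= (negPf k1) /= => /eqP.
Qed.

(** Passing from [u] to [u + r e] adds [r th] to the coefficient of [u] in its square and [r psi] to
    that of [g] in [2 g u]. As [psi != th], one value of [r] makes the two equal. *)
Lemma star_shift (u : V) th nu : fr2 e u -> in3 e b c u ->
  2 *: m e u = th *: u + nu *: e -> psi != th ->
  exists r l w, [/\ in3 e b c w, m (u + r *: e) (u + r *: e) = l *: (u + r *: e)
    & 2 *: m g (u + r *: e) = l *: g + w].
Proof.
move=> fu hu heu k0.
have heu2 : m e u = 2^-1 *: (th *: u + nu *: e) by rewrite -heu; vecf.
have [q [l huu]] := star hu.
have [x [y [z [s hgu]]]] := fr4_span n4 f (2 *: m g u).
pose r := (l - s) / (psi - th).
have k1 : psi - th != 0 by rewrite subr_eq0.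
pose w := x *: e + y *: b + z *: c + r *: we.
have hw : in3 e b c w by apply: in3_D; [exists x, y, z|exact: in3_Z].
have fr : fr2 e (u + r *: e).
  move=> i j h; have [|hi hj] := fu (i + j * r) j; first by rewrite -h; vec.
  by split=> //; move: hi; rewrite hj mul0r addr0.
have hv : in3 e b c (u + r *: e) by apply: in3_D => //; exact/in3_Z/in3_1.
have hev : 2 *: m e (u + r *: e) = th *: (u + r *: e) + (nu + 2 * r - th * r) *: e.
  by rewrite !mE ee heu2; vecf.
have hvv : m (u + r *: e) (u + r *: e) =
  (q + r * nu + r ^+ 2 - (l + r * th) * r) *: e + (l + r * th) *: (u + r *: e).
  by rewrite !mE ee (mC u e) heu2 huu; vecf.
have hgv : 2 *: m g (u + r *: e) = (l + r * th) *: g + w.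
  rewrite mDr scalerDr hgu mZr scalerA mulrC -scalerA hge /w.
  have -> : l = s + r * (psi - th) by rewrite /r mulfVK //; ring.
  by vec.
exists r, (l + r * th), w; split=> //.
by rewrite {1}hvv (star_coef fr hv hw hev hvv hgv k0) scale0r add0r.
Qed.

(** After shifting, [u1], [u2] and [u1 + u2] are all proportional to their squares, with additive
    factors [l1], [l2], [l1 + l2]. Hence [l2 u1 - l1 u2] squares to zero, which [mnz] forbids. *)
Lemma star_False th nu nu' : 2 *: m e b = th *: b + nu *: e ->
  2 *: m e c = th *: c + nu' *: e -> psi != th -> False.
Proof.
move=> heb hec k0; have f3 := fr4_123 f.
have fb : fr2 e b := fr3_12 f3.
have fc : fr2 e c.
  by move=> x y h; have [] := f3 x 0 y; [rewrite -h; vec|].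
have [r1 [l1 [w1 [hw1 h1 g1]]]] := star_shift fb (in3_2 _ _ _) heb k0.
have [r2 [l2 [w2 [hw2 h2 g2]]]] := star_shift fc (in3_3 _ _ _) hec k0.
have heb2 : m e b = 2^-1 *: (th *: b + nu *: e) by rewrite -heb; vecf.
have hec2 : m e c = 2^-1 *: (th *: c + nu' *: e) by rewrite -hec; vecf.
have hu1 : in3 e b c (b + r1 *: e).
  by apply: in3_D; [exact: in3_2|exact/in3_Z/in3_1].
have hu2 : in3 e b c (c + r2 *: e).
  by apply: in3_D; [exact: in3_3|exact/in3_Z/in3_1].
have f3u : fr3 e (b + r1 *: e) (c + r2 *: e).
  move=> x y z h; have [|hx hy hz] := f3 (x + y * r1 + z * r2) y z.
    by rewrite -h; vec.
  by split=> //; move: hx; rewrite hy hz !mul0r !addr0.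
have eu1 : 2 *: m e (b + r1 *: e) =
   th *: (b + r1 *: e) + (nu + 2 * r1 - th * r1) *: e.
  by rewrite !mE ee heb2; vecf.
have eu2 : 2 *: m e (c + r2 *: e) =
   th *: (c + r2 *: e) + (nu' + 2 * r2 - th * r2) *: e.
  by rewrite !mE ee hec2; vecf.
move: (b + r1 *: e) (c + r2 *: e) (nu + _ - _) (nu' + _ - _) h1 g1 h2 g2 hu1 hu2 f3u eu1 eu2
  => u1 u2 n1 n2 h1 g1 h2 g2 hu1 hu2 f3u eu1 eu2.
have [q [l hp]] := star (in3_D hu1 hu2).
have [q' [l' hm]] := star (in3_B hu1 hu2).
have [_ ll1 ll2] : [/\ q + q' = 0, l + l' - 2 * l1 = 0 & l - l' - 2 * l2 = 0].
  apply: f3u; transitivity ((q *: e + l *: (u1 + u2)) + (q' *: e + l' *: (u1 - u2))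
    - 2 *: (l1 *: u1) - 2 *: (l2 *: u2)); first by vec.
  by rewrite -hp -hm -h1 -h2 !mE (mC u2 u1); vec.
have hl : l = l1 + l2 by lra.
have fs : fr2 e (u1 + u2).
  by move=> x y h; have [] := f3u x y y; [rewrite -h; vec|].
have q0 : q = 0.
  apply: (star_coef (w := w1 + w2) (nu := n1 + n2) fs _ _ _ hp _ k0).
  - exact: in3_D.
  - exact: in3_D.
  - by rewrite mDr scalerDr eu1 eu2; vec.
  - by rewrite mDr scalerDr g1 g2 hl; vec.
have h12 : m u1 u2 = 2^-1 *: (l2 *: u1 + l1 *: u2).
  have -> : m u1 u2 = 2^-1 *: (m (u1 + u2) (u1 + u2) - m u1 u1 - m u2 u2).
    by rewrite !mE (mC u2 u1); vecf.
  by rewrite hp q0 h1 h2 hl; vec.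
have /mnz v0 : m (l2 *: u1 - l1 *: u2) (l2 *: u1 - l1 *: u2) = 0.
  by rewrite !mE (mC u2 u1) h1 h2 h12; vecf.
have [_ _ /eqP] : [/\ 0 = 0 :> R, l2 = 0 & - l1 = 0].
  by apply: f3u; rewrite -v0; vec.
rewrite oppr_eq0 => /eqP l10.
have /mnz u10 : m u1 u1 = 0 by rewrite h1 l10 scale0r.
have [_ /eqP] : [/\ 0 = 0 :> R, (1 : R) = 0 & 0 = 0 :> R].
  by apply: f3u; rewrite u10; vec.
by rewrite oner_eq0.
Qed.

End Star.

Lemma T0_half e z : T e z = 0 -> m e z = 2^-1 *: z.
Proof. by move=> h; rewrite mT h add0r. Qed.

Lemma fr2_ker e z : idem e -> T e z = 0 -> z != 0 -> fr2 e z.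
Proof.
move=> he Tz z0; case: (in1_or_fr2 z (proj1 he)) => // -[a za].
by move: z0; rewrite -Tz za TZ Te // eqxx.
Qed.

(** Rank three does not occur: the image of [T] would be a hyperplane as in [star_False], with
    [psi = 1] because [2 g e = g + T e g], and [th = 1 + t]. *)
Lemma has_univ_idem_of_rank3 e v1 v2 : idem e -> fr3 e (T e v1) (T e v2) -> has_univ_idem.
Proof.
move=> he f3.
case: (pselect (exists v, fr4 e (T e v1) (T e v2) (T e v))) => [[v3 f4]|no4].
  by exists e; exact: univ_idem_of_rank4 he f4.
have imT v : in3 e (T e v1) (T e v2) (T e v).
  by case: (in3_or_fr4 (T e v) f3) => // f4; case: no4; exists v.
exfalso; have [g f4] := ex_fr4 n4 f3.
have fa := fr3_12 f3.
have [t [c1 ha]] := T_eigen he fa.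
have [c2 hb] := T_eigen_unif he fa ha v2.
(* With [t = 0] the whole image of [T] would lie in the span of [e] and [T e g]. *)
have t0 : t != 0.
  apply/eqP => t0; rewrite t0 scale0r add0r in ha.
  rewrite t0 scale0r add0r in hb.
  have im v : in2 e (T e g) (T e v).
    have [a [b [c [d ->]]]] := fr4_span n4 f4 v.
    by exists (a + b * c1 + c * c2), d; rewrite !TE ha hb Te //; vec.
  apply: (fr3_nin f3); apply: (dep3_in2 fa).
  by apply: in2_dep3 (im v1) (im v2); exact: in2_l.
apply: (@star_False e (T e v1) (T e v2) g he f4 _ 1 (T e g) (imT g) _ (1 + t) c1 c2).
- move=> w [a [b [c hw]]].
  have {}hw : w = T e (a *: e + b *: v1 + c *: v2) by rewrite !TE Te.
  case: (in1_or_fr2 w (proj1 he)) => [[k ->]|].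
    by exists (k ^+ 2), 0; rewrite !mE (proj2 he); vec.
  by rewrite {1}hw => /(T_plane he)[]; rewrite -hw.
- by rewrite mC TdE; vec.
- by rewrite mT ha; vecf.
- by rewrite mT hb; vecf.
by apply/eqP; move/eqP: t0; lra.
Qed.

(* If e, z, z^2 are independent, all the planes <a e + z, z^2> are subalgebras,
   so their common line is spanned by an idempotent. *)
Lemma pencil e z r s : idem e -> T e z = 0 -> fr3 e z (m z z) ->
  2 *: m e (m z z) = r *: m z z + s *: e ->
  has_univ_idem \/ m (m z z) (m z z) = s *: m z z.
Proof.
move=> he Tz f eE; have ee := proj2 he; have ez := T0_half Tz.
have {}eE : m e (m z z) = 2^-1 *: (r *: m z z + s *: e) by rewrite -eE; vecf.
have z0 : z != 0.
  by apply/eqP => z0; move: (fr2_nin (fr3_12 f)); apply; exists 0; rewrite z0 scale0r.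
have fa (a : R) : fr2 (a *: e + z) (m z z).
  by move=> x y h; have [] := f (x * a) x y; [rewrite -h; vec|].
have pa (a : R) : plane (a *: e + z) (m z z).
  apply: (proj1 (@gen_plane (a *: e + z) _ _ _ _ (fa a))); first exact: gen_refl.
  have -> : m z z = m (a *: e + z) (a *: e + z) - a *: (a *: e + z).
    by rewrite !mE ee (mC z e) ez; vecf.
  by apply: gen_B; [apply: gen_m|apply: gen_Z]; apply: gen_refl.
have [_ [B [C hB]] [k' [k hk]]] := pa 0.
have [_ [B' [C' hB']] [l' [l hl]]] := pa 1.
move: hB hk hB' hl; rewrite scale0r add0r scale1r => hB hk hB' hl.
have E0 : m z z != 0 by apply/eqP => /mnz z00; rewrite z00 eqxx in z0.
move: (m z z) f eE hB hk hB' hl E0 {fa pa} => E f eE hB hk hB' hl E0.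
(* The square of [E] lies in the planes for [a = 0] and [a = 1], hence on their common line. *)
have k'0 : k' = 0.
  have [] := f (- l') (k' - l') (k - l); last by move=> *; lra.
  by rewrite -[RHS](subrr (m E E)) {1}hk hl; vec.
rewrite {k' hl l' l}k'0 scale0r add0r in hk.
have Bq : B = s / 2.
  have [] := f (s / 2 - B') (B - B') (r / 2 + C - C'); last by move=> *; lra.
  by rewrite -[RHS](subrr (m (e + z) E)) {1}mDl eE hB hB'; vecf.
case: (eqVneq s k) => [->|qk]; [by right|left].
have k0 : k != 0.
  by apply/eqP => k0; move: hk E0; rewrite k0 scale0r => /mnz ->; rewrite eqxx.
have hE : idem (k^-1 *: E).
  split; first by rewrite scaler_eq0 negb_or invr_eq0 k0.
  by rewrite !mE hk; vecf.
(* Modulo [E], the operator of the new idempotent multiplies both [e] and [z] by [s / k - 1], which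
   is non-zero, so its rank is at least three. *)
apply: (has_univ_idem_of_rank3 (e := k^-1 *: E) (v1 := e) (v2 := z)) => //.
have h0 : s / k - 1 != 0.
  by rewrite subr_eq0; apply/eqP => h; case/eqP: qk; rewrite -[RHS]mul1r -h mulfVK.
have -> : T (k^-1 *: E) e = (s / k - 1) *: e + (r / k) *: E.
  by rewrite TdE !mE (mC E e) eE; vecf.
have -> : T (k^-1 *: E) z = (s / k - 1) *: z + (2 * C / k) *: E.
  by rewrite TdE !mE (mC E z) hB Bq; vecf.
move=> x y w h.
have [] := f (y * (s / k - 1)) (w * (s / k - 1)) (x / k + y * (r / k) + w * (2 * C / k)).
  by rewrite -h; vecf.
move=> /eqP; rewrite mulf_eq0 (negPf h0) orbF => /eqP y0.
move=> /eqP; rewrite mulf_eq0 (negPf h0) orbF => /eqP w0.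
rewrite y0 w0 !mul0r !addr0 => /eqP; rewrite mulf_eq0 invr_eq0 (negPf k0) orbF.
by move=> /eqP.
Qed.

(** If [e], [z], [z^2] are independent, [pencil] yields a universal idempotent or [(z^2)^2 = q z^2].
    The latter gives [u^2 = 0], so [z^2 = q e], against independence. *)
Lemma ker_sqr e z q u : idem e -> T e z = 0 -> m z z = q *: e + u ->
  T e u = 0 -> in2 e z (m z z) \/ has_univ_idem.
Proof.
move=> he Tz hzz Tu; case: (eqVneq z 0) => [->|z0].
  by left; rewrite m0l; exists 0, 0; vec.
case: (in2_or_fr3 (m z z) (fr2_ker he Tz z0)) => [|f]; first by left.
right; have ee := proj2 he; have eu := T0_half Tu.
case: (@pencil e z 1 q he Tz f) => //.
  by rewrite hzz !mE ee eu; vecf.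
move=> h; have /mnz u0 : m u u = 0.
  have -> : m u u = m (m z z) (m z z) - q *: m z z.
    by rewrite hzz !mE ee (mC u e) eu; vecf.
  by rewrite h subrr.
by case: (fr3_nin f); rewrite hzz u0; exists q, 0; vec.
Qed.

(** * Rank two with a non-zero eigenvalue modulo [e] *)

Section Rank2.
Context (e v1 : V) (t c : R) (he : idem e) (fa : fr2 e (T e v1)).
Context (ha : T e (T e v1) = t *: T e v1 + c *: e) (t0 : t != 0).
Context (imT : forall v, in2 e (T e v1) (T e v)) (no_univ_idem : ~ has_univ_idem).
Local Notation a := (T e v1).

Let ee : m e e = e. Proof. exact: (proj2 he). Qed.
Let Tee : T e e = e. Proof. exact: Te. Qed.
Let ea : m e a = 2^-1 *: ((1 + t) *: a + c *: e).
Proof. by rewrite mT ha; vecf. Qed.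

(** As [t != 0], [T] is invertible on the span of [e] and [a], which is therefore a complement of
    the kernel. *)
Lemma decomp v : exists q r u, v = q *: e + r *: a + u /\ T e u = 0.
Proof.
have [x [y hv]] := imT v.
exists (x - y * c / t), (y / t), (v - (x - y * c / t) *: e - (y / t) *: a).
split; first by vec.
by rewrite !TE Tee ha hv; vecf.
Qed.

Lemma ea_ker0 (x y : R) u : x *: e + y *: a + u = 0 -> T e u = 0 ->
  [/\ x = 0, y = 0 & u = 0].
Proof.
move=> h Tu.
have [h1 h2] : x + y * c = 0 /\ y * t = 0.
  apply: fa; have := congr1 (T e) h.
  rewrite !TE Tee ha Tu => h'; transitivity (T e 0); last exact: T0.
  by rewrite -h'; vec.
have y0 : y = 0 by move/eqP: h2; rewrite mulf_eq0 (negPf t0) orbF => /eqP.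
have x0 : x = 0 by move: h1; rewrite y0 mul0r addr0.
by move: h; rewrite x0 y0 !scale0r !add0r.
Qed.

(** By [kerT_plane] the square is an eigenvector of [T] modulo [e]; its part along [a] has
    eigenvalue [t], its part [u] has eigenvalue 0. *)
Lemma ker_sqr_cases z q r u : T e z = 0 -> m z z = q *: e + r *: a + u ->
  T e u = 0 -> r != 0 -> u = 0.
Proof.
move=> Tz hzz Tu r0.
case: (in1_or_fr2 (m z z) (proj1 he)) => [[x h]|f].
  have [] := @ea_ker0 (q - x) r u _ Tu => //.
  by rewrite -[RHS](subrr (m z z)) {1}hzz h; vec.
have [_ [x [y h]] _] := kerT_plane he Tz f.
rewrite (mT e) hzz !TE Tee ha Tu in h.
have Tu' : T e ((1 - 2 * y) *: u) = 0 by rewrite TZ Tu scaler0.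
have h0 : (2 * q + r * c - 2 * (x + y * q)) *: e + (r * t + r - 2 * y * r) *: a
    + (1 - 2 * y) *: u = 0.
  transitivity (2 *: (2^-1 *: (q *: e + r *: (t *: a + c *: e) + 0
      + (q *: e + r *: a + u))) - 2 *: (x *: e + y *: (q *: e + r *: a + u))).
    by vecf.
  by rewrite h subrr.
have [_ hy /eqP] := ea_ker0 h0 Tu'.
rewrite scaler_eq0 => /orP[/eqP y1|/eqP //].
have : r * t = 0.
  have y2 : 2 * y = 1 by lra.
  by rewrite y2 in hy; lra.
by move/eqP; rewrite mulf_eq0 (negPf r0) (negPf t0).
Qed.

(** In the absence of a universal idempotent [pencil] leaves [(z^2)^2 = s z^2], and [s] cannot
    vanish, so [z^2] can be normalised. *)
Lemma ker_idem z q r : T e z = 0 -> m z z = q *: e + r *: a -> r != 0 ->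
  exists k : R, [/\ k != 0, idem (k^-1 *: m z z) &
    2 *: m e (k^-1 *: m z z) = (1 + t) *: (k^-1 *: m z z) + e].
Proof.
move=> Tz hzz r0.
pose s := q + r * c - t * q.
have eE : 2 *: m e (m z z) = (1 + t) *: m z z + s *: e.
  by rewrite hzz !mE ee ea /s; vecf.
have E0 : m z z != 0.
  apply/eqP => E0; case/eqP: r0.
  by have [] : [/\ q = 0, r = 0 & (0 : V) = 0] by apply: ea_ker0; rewrite ?T0 // addr0 -hzz.
have z0 : z != 0 by apply/eqP => z0; rewrite z0 m0l eqxx in E0.
have f : fr3 e z (m z z).
  move=> x y w; rewrite hzz => h.
  have [h1 h2 h3] : [/\ x + w * q = 0, w * r = 0 & y *: z = 0].
    by apply: ea_ker0; rewrite ?TZ ?Tz ?scaler0 // -h; vec.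
  have w0 : w = 0 by move/eqP: h2; rewrite mulf_eq0 (negPf r0) orbF => /eqP.
  have y0 : y = 0 by move/eqP: h3; rewrite scaler_eq0 (negPf z0) orbF => /eqP.
  by split=> //; move: h1; rewrite w0 mul0r addr0.
case: (pencil he Tz f eE) => // hk.
have s0 : s != 0.
  by apply/eqP => s0; move: hk E0; rewrite s0 scale0r => /mnz ->; rewrite eqxx.
exists s; split=> //.
  split; first by rewrite scaler_eq0 negb_or invr_eq0 s0.
  by rewrite !mE hk; vecf.
by rewrite mZr scalerA mulrC -scalerA eE; vecf.
Qed.

(* On the plane algebra <e, a> such an idempotent is a double root of the cubic
   form det(x, x^2), while e is a simple one; hence it is unique. *)
Lemma double_root E E' : idem E -> idem E' -> fr2 e E' ->
  in2 e a E -> in2 e a E' ->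
  2 *: m e E = (1 + t) *: E + e -> 2 *: m e E' = (1 + t) *: E' + e ->
  in1 E E'.
Proof.
move=> hE hE' fE' inE inE' h h'.
case: (in1_or_fr2 E' (proj1 hE)) => // f; exfalso.
have [[x [y hxy]] _] := in2_swap inE inE' f.
have he1 : e = x *: E + y *: E' by [].
have [x0|x0] := eqVneq x 0.
  apply: (fr2_nin (fr2C fE')); exists y.
  by rewrite {1}he1 x0 scale0r add0r.
have h4 := ee; have h5 := h.
rewrite he1 !mE (proj2 hE) (proj2 hE') (mC E' E) in h4 h5.
have k : x *: (2 *: (x *: E + y *: m E E'))
    - (x *: (x *: E + y *: m E E') + y *: (x *: m E E' + y *: E'))
  = x *: ((1 + t) *: E + (x *: E + y *: E')) - (x *: E + y *: E').
  by congr (x *: _ - _); [rewrite -h5; vec|rewrite -[RHS]h4; vec].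
have [|/eqP xt _] := f (x * t) (x * y - y + y ^+ 2).
  transitivity (x *: ((1 + t) *: E + (x *: E + y *: E')) - (x *: E + y *: E')
    - (x *: (2 *: (x *: E + y *: m E E'))
    - (x *: (x *: E + y *: m E E') + y *: (x *: m E E' + y *: E')))); first by vec.
  by rewrite k subrr.
by move: xt; rewrite mulf_eq0 (negPf x0) (negPf t0).
Qed.

Lemma ker_sqr_line1 z0 q0 r0 z q r u :
  T e z0 = 0 -> m z0 z0 = q0 *: e + r0 *: a -> r0 != 0 ->
  T e z = 0 -> m z z = q *: e + r *: a + u -> T e u = 0 -> r != 0 ->
  in1 (m z0 z0) (m z z).
Proof.
move=> Tz0 h0 r00 Tz h Tu r1.
have u0 := ker_sqr_cases Tz h Tu r1; rewrite u0 addr0 in h.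
have [k0 [k00 hE0 eE0]] := ker_idem Tz0 h0 r00.
have [k [k1 hE eE]] := ker_idem Tz h r1.
have fE : fr2 e (k^-1 *: m z z).
  rewrite h => x y hh.
  have [] := @fa (x + y * (k^-1 * q)) (y * (k^-1 * r)); first by rewrite -hh; vec.
  move=> hx /eqP; rewrite mulf_eq0 mulf_eq0 invr_eq0 (negPf k1) (negPf r1) !orbF.
  by move=> /eqP y0; move: hx; rewrite y0 mul0r addr0.
have i1 : in2 e a (k0^-1 *: m z0 z0).
  by rewrite h0; exists (k0^-1 * q0), (k0^-1 * r0); vec.
have i2 : in2 e a (k^-1 *: m z z).
  by rewrite h; exists (k^-1 * q), (k^-1 * r); vec.
have [x hx] := double_root hE0 hE fE i1 i2 eE0 eE.
by exists (k * (x / k0)); rewrite -scalerA -scalerA -hx scalerA divff // scale1r.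
Qed.

(** The preceding lemma applies to [z + s z0] unless its [a]-coefficient, a polynomial in [s] with
    leading coefficient [r0], vanishes. So it applies for all but finitely many [s], and its
    conclusion extends to [s = 0]. *)
Lemma ker_sqr_line z0 q0 r0 z :
  T e z0 = 0 -> m z0 z0 = q0 *: e + r0 *: a -> r0 != 0 ->
  T e z = 0 -> in1 (m z0 z0) (m z z).
Proof.
move=> Tz0 h0 r00 Tz.
have E0 : m z0 z0 != 0.
  apply/eqP => E0; case/eqP: r00.
  by have [] : [/\ q0 = 0, r0 = 0 & (0 : V) = 0] by apply: ea_ker0; rewrite ?T0 // addr0 -h0.
have [q [r [u [h Tu]]]] := decomp (m z z).
have [q1 [r1 [u1 [h1 Tu1]]]] := decomp (m z z0).
apply: dep2_in1 => // i j.
pose E := m z0 z0.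
pose d0 := E 0 i * m z z 0 j - E 0 j * m z z 0 i.
pose d1 := 2 * (E 0 i * m z z0 0 j - E 0 j * m z z0 0 i).
(* [d0 + s d1] is a minor of [z0^2] and [(z + s z0)^2]; the term in [s^2] drops out since it is
   proportional to [z0^2]. *)
have key s : (r + 2 * s * r1 + s ^+ 2 * r0) * (d0 + s * d1) = 0.
  apply/eqP; rewrite mulf_eq0; case: eqVneq => //= rs; apply/eqP.
  have hs : m (z + s *: z0) (z + s *: z0) = (q + 2 * s * q1 + s ^+ 2 * q0) *: e
      + (r + 2 * s * r1 + s ^+ 2 * r0) *: a + (u + (2 * s) *: u1).
    by rewrite !mE (mC z0 z) h h1 h0; vec.
  have [||x hx] := ker_sqr_line1 Tz0 h0 r00 _ hs _ rs.
  - by rewrite !TE Tz Tz0 scaler0 addr0.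
  - by rewrite !TE Tu Tu1 scaler0 addr0.
  have hx2 : m z z = x *: E - (2 * s) *: m z z0 - s ^+ 2 *: E.
    by rewrite /E -hx !mE (mC z0 z); vec.
  by rewrite /d0 /d1 hx2 !mxE; ring.
have [hh0 hh1 hh2 hh3 _] := @poly4_eq0 R (r * d0) (2 * r1 * d0 + r * d1)
  (r0 * d0 + 2 * r1 * d1) (r0 * d1) 0
  ltac:(by move=> s _; rewrite -[RHS](key s); ring).
have d10 : d1 = 0 by move/eqP: hh3; rewrite mulf_eq0 (negPf r00) => /eqP.
move: hh2; rewrite d10 mulr0 addr0 => /eqP; rewrite mulf_eq0 (negPf r00) /= => /eqP.
by [].
Qed.

(** Up to a multiple of the idempotent [E] on the line of [z0^2], any [x] is [al e + z] with [z] in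
    the kernel. For [z != 0] the square of [z] is a non-zero multiple of [E], so [al e + z] and [E]
    span a subalgebra. *)
Lemma univ_idem_of_ker z0 q0 r0 :
  T e z0 = 0 -> m z0 z0 = q0 *: e + r0 *: a -> r0 != 0 -> has_univ_idem.
Proof.
move=> Tz0 h0 r00.
have [k [k0 hE eE]] := ker_idem Tz0 h0 r00.
exists (k^-1 *: m z0 z0); split=> // x.
have fE : fr2 e (m z0 z0).
  rewrite h0 => y w hh.
  have [] := @fa (y + w * q0) (w * r0); first by rewrite -hh; vec.
  move=> hx /eqP; rewrite mulf_eq0 (negPf r00) orbF.
  by move=> /eqP y0; move: hx; rewrite y0 mul0r addr0.
have [E EE] : exists E, E = k^-1 *: m z0 z0 by eexists.
rewrite -EE in hE eE *.
have fE' : fr2 e E.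
  move=> y w h; have [|-> /eqP] := fE y (w / k); first by rewrite -h EE; vecf.
  by rewrite mulf_eq0 invr_eq0 (negPf k0) orbF => /eqP.
have eE2 : m e E = 2^-1 *: ((1 + t) *: E + e) by rewrite -eE; vecf.
have TEE : T e E = t *: E + e by rewrite TdE eE; vec.
have [q [r [z [hx Tz]]]] := decomp x.
have {}hx : x = ((q - r * q0 / r0) *: e + z) + (r * k / r0) *: E.
  by rewrite hx EE h0; vecf; rewrite r00 k0.
move: (q - _) (r * k / r0) hx => al be hx {q r}.
have pl : plane (al *: e + z) E -> in2 E x (m x x).
  move=> p; have : in2 (al *: e + z) E (m x x).
    by apply: plane_closed => //; exists 1, be; rewrite scale1r.
  move=> [y [w ->]]; exists (w - y * be), y; rewrite hx; vec.
have [z00|z1] := eqVneq z 0.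
  rewrite hx z00 !mE (proj2 he) (proj2 hE) (mC E e) eE2.
  have [al0|al0] := eqVneq al 0.
    by exists (be ^+ 2), 0; rewrite al0; vec.
  by exists (be ^+ 2 + al * be * (1 + t) - (al + be) * be), (al + be); vecf.
apply: pl; have [y hy] := ker_sqr_line Tz0 h0 r00 Tz.
have y0 : y != 0.
  by apply/eqP => y0; move: hy z1; rewrite y0 scale0r => /mnz ->; rewrite eqxx.
have ez := T0_half Tz.
apply: (proj1 (@gen_plane (al *: e + z) _ _ (@gen_refl _) _ _)).
  have -> : E = (k^-1 / y) *: (m (al *: e + z) (al *: e + z) - al *: (al *: e + z)).
    by rewrite !mE (proj2 he) (mC z e) ez hy EE; vecf; rewrite y0 k0.
  by apply: gen_Z; apply: gen_B; [apply: gen_m|apply: gen_Z]; apply: gen_refl.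
move=> p w h; have := congr1 (T e) h.
rewrite !TE Tee Tz T0 TEE => h'.
have [|_ /eqP] := fE' (p * al + w) (w * t); first by rewrite -h'; vec.
rewrite mulf_eq0 (negPf t0) orbF => /eqP w0.
move: h; rewrite w0 scale0r addr0 => h; split=> //.
have f2 := fr2_ker he Tz z1; have [|_] := f2 (p * al) p; first by rewrite -h; vec.
by [].
Qed.

Lemma rank2_False : False.
Proof.
apply: no_univ_idem.
have [w0 f3] := ex_fr3 n4 fa; have [w1 f4] := ex_fr4 n4 f3.
have [q0 [r0 [z0 [hw0 Tz0]]]] := decomp w0.
have [q1 [r1 [z1 [hw1 Tz1]]]] := decomp w1.
case: (pselect (exists z q r u,
    [/\ T e z = 0, m z z = q *: e + r *: a + u, T e u = 0 & r != 0])).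
  move=> [z [q [r [u [Tz hz Tu r2]]]]].
  have u0 := ker_sqr_cases Tz hz Tu r2.
  by apply: (univ_idem_of_ker Tz _ r2 (q0 := q)); rewrite hz u0 addr0.
move=> no; exfalso.
have f4' : fr4 e z0 z1 a.
  move=> x y w s h.
  have [] := f4 (x - y * q0 - w * q1) (s - y * r0 - w * r1) y w.
    by rewrite -h hw0 hw1; vec.
  move=> hx hs y0 w0'; move: hx hs; rewrite y0 w0' !mul0r !subr0.
  by move=> -> ->.
(* Now squares of kernel elements have no component along [a], and the span of [e] and the kernel is
   the hyperplane, with [g = a], [psi = 1 + t] and [th = 1]. *)
apply: (@star_False e z0 z1 a he f4' _ (1 + t) (c *: e) _ _ 1 0 0).
- move=> w [x [y [s hw]]].
  have [z zE] : exists z, z = y *: z0 + s *: z1 by eexists.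
  have Tz : T e z = 0 by rewrite zE !TE Tz0 Tz1 !scaler0 addr0.
  have {}hw : w = x *: e + z by rewrite hw zE addrA.
  have [q [r [u [hz Tu]]]] := decomp (m z z).
  have r00 : r = 0.
    by apply: contrapT => /eqP r2; apply: no; exists z, q, r, u.
  rewrite r00 scale0r addr0 in hz.
  case: (ker_sqr he Tz hz Tu) => [[i [j hij]]|//].
  have ez := T0_half Tz.
  exists (x ^+ 2 + i - x * j - x ^+ 2), (x + j).
  by rewrite hw !mE (mC z e) ez ee hij; vecf.
- by exists c, 0, 0; vec.
- by rewrite (mC a) ea; vecf.
- by rewrite (T0_half Tz0); vecf.
- by rewrite (T0_half Tz1); vecf.
by apply/eqP; move/eqP: t0; lra.
Qed.

End Rank2.

Lemma has_univ_idem_of_eigen e v1 t c : idem e -> fr2 e (T e v1) ->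
  T e (T e v1) = t *: T e v1 + c *: e -> t != 0 -> has_univ_idem.
Proof.
move=> he fa ha t0; apply: contrapT => no_univ_idem.
apply: (rank2_False he fa ha t0 _ no_univ_idem) => v.
case: (in2_or_fr3 (T e v) fa) => // f3; case: no_univ_idem.
exact: has_univ_idem_of_rank3 he f3.
Qed.

(** [T] multiplies [z^2] by a scalar modulo [e], and [T] applied twice lands on the line of [e];
    either way [T e (m z z)] is on that line. So [z^2] is in the kernel up to a multiple of [e], as
    [ker_sqr] requires. *)
Lemma nil_ker_sqr e z : idem e -> (forall v, in1 e (T e (T e v))) ->
  T e z = 0 -> in2 e z (m z z) \/ has_univ_idem.
Proof.
move=> he nil Tz.
suff [x hx] : in1 e (T e (m z z)).
  apply: (@ker_sqr e z x (m z z - x *: e)) => //; first by vec.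
  by rewrite !TE Te // hx subrr.
case: (in1_or_fr2 (m z z) (proj1 he)) => [[x ->]|f].
  by exists x; rewrite TZ Te.
have [_ [i [j hij]] _] := kerT_plane he Tz f.
have hT : T e (m z z) = (2 * i) *: e + (2 * j - 1) *: m z z.
  by rewrite TdE hij; vec.
have [k hk] := nil (m z z).
have {}hk : (2 * j - 1) *: T e (m z z) = (k - 2 * i) *: e.
  move: hk; rewrite {1}hT !TE Te // => hk.
  by transitivity (k *: e - (2 * i) *: e); [rewrite -hk; vec|vec].
have [j0|j0] := eqVneq (2 * j - 1) 0.
  by exists (2 * i); rewrite hT j0; vec.
exists ((k - 2 * i) / (2 * j - 1)).
by rewrite mulrC -scalerA -hk scalerA mulVf // scale1r.
Qed.

(** The plane of [e] and [z] contains a second idempotent [E], on the line of [(q / l) e + z]. The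
    operator of [E] has the non-zero eigenvalue [- (l / k)] modulo [E], so the rank discussion
    succeeds there. *)
Lemma has_univ_idem_of_root e z q l : idem e -> T e z = 0 -> z != 0 ->
  m z z = q *: e + l *: z -> l != 0 -> has_univ_idem.
Proof.
move=> he Tz z0 hz l0; have ez := T0_half Tz; have ee := proj2 he.
have f := fr2_ker he Tz z0.
have [k kE] : exists k, k = q / l + l by eexists.
have [p pE] : exists p, p = (q / l) *: e + z by eexists.
have p0 : p != 0.
  apply/eqP => p0; have [|_ /eqP] := f (q / l) 1; first by rewrite -p0 pE; vec.
  by rewrite oner_eq0.
have hp : m p p = k *: p by rewrite pE !mE ee (mC z e) ez hz kE; vecf.
have k0 : k != 0.
  by apply/eqP => k0; move: hp p0; rewrite k0 scale0r => /mnz ->; rewrite eqxx.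
have [E EE] : exists E, E = k^-1 *: p by eexists.
have hE : idem E.
  split; first by rewrite EE scaler_eq0 negb_or invr_eq0 k0.
  by rewrite EE !mE hp; vecf.
have TEe : T E e = E - (l / k) *: e.
  have e1 : z = k *: E - (q / l) *: e by rewrite EE pE; vecf; rewrite ?k0 ?l0.
  have h1 : m E e = k^-1 *: ((q / l) *: e + 2^-1 *: z).
    by rewrite EE pE !mE ee (mC z e) ez; vec.
  have -> : l / k = 1 - (q / l) / k by rewrite -[1](divff k0) {2}kE; field; rewrite ?k0 ?l0.
  by rewrite TdE h1 e1; vecf; rewrite ?k0 ?l0.
have fE : fr2 E e.
  move=> x y h; have [|h1 h2] := f (x / k * (q / l) + y) (x / k).
    by rewrite -h EE pE; vec.
  move/eqP: h2; rewrite mulf_eq0 invr_eq0 (negPf k0) orbF => /eqP x0.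
  by split=> //; move: h1; rewrite x0 !mul0r add0r.
have lk : - (l / k) != 0 by rewrite oppr_eq0 mulf_neq0 // invr_neq0.
apply: (@has_univ_idem_of_eigen E e (- (l / k)) 1 hE) => //; rewrite TEe.
  move=> x y h; have [|h1 h2] := fE (x + y) (- (l / k) * y).
    by rewrite -h; vec.
  move/eqP: h2; rewrite mulf_eq0 (negPf lk) /= => /eqP y0.
  by split=> //; move: h1; rewrite y0 addr0.
by rewrite !TE Te // TEe; vec.
Qed.

Lemma univ_idem_star e z : idem e -> T e z = 0 -> in2 e z (m z z) ->
  forall a : R, in2 e (a *: e + z) (m (a *: e + z) (a *: e + z)).
Proof.
move=> he Tz [i [j h]] a; have ez := T0_half Tz.
exists (a ^+ 2 + i - a * (a + j)), (a + j).
by rewrite !mE (mC z e) ez (proj2 he) h; vecf.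
Qed.

Lemma has_univ_idem_of_idem e : idem e -> has_univ_idem.
Proof.
move=> he; have ee := proj2 he; have e0 := proj1 he.
apply: contrapT => no_univ_idem.
case: (pselect (exists v, fr2 e (T e v))) => [[v1 fa]|rk0]; last first.
  apply: (no_univ_idem); exists e; split=> // x.
  have im v : in1 e (T e v).
    by case: (in1_or_fr2 (T e v) e0) => // f; case: rk0; exists v.
  have [c hc] := im x.
  have Tz : T e (x - c *: e) = 0 by rewrite !TE Te // hc subrr.
  have nil v : in1 e (T e (T e v)) by exact: im.
  case: (nil_ker_sqr he nil Tz) => // h.
  by have := univ_idem_star he Tz h c; rewrite addrC subrK.
have [t [c ha]] := T_eigen he fa.
have t0 : t = 0.
  by apply: contrapT => /eqP t0; apply: no_univ_idem; exact: has_univ_idem_of_eigen he fa ha t0.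
have nil v : in1 e (T e (T e v)).
  have [c' hc'] := T_eigen_unif he fa ha v.
  by exists c'; rewrite hc' t0 scale0r add0r.
rewrite t0 scale0r add0r in ha.
have ker z : T e z = 0 -> in1 e (m z z).
  move=> Tz; case: (nil_ker_sqr he nil Tz) => // -[q [l h]].
  have [l0|l0] := eqVneq l 0; first by exists q; rewrite h l0 scale0r addr0.
  have [z0|z0] := eqVneq z 0; first by exists 0; rewrite z0 m0l scale0r.
  by case: no_univ_idem; exact: has_univ_idem_of_root he Tz z0 h l0.
have im v : in2 e (T e v1) (T e v).
  case: (in2_or_fr3 (T e v) fa) => // f3; case: no_univ_idem.
  exact: has_univ_idem_of_rank3 he f3.
have f3 : fr3 e (T e v1) v1.
  move=> x y z h; have := congr1 (T e) h; rewrite !TE Te // ha T0 => h'.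
  have [|h1 z0] := fa (x + y * c) z; first by rewrite -h'; vec.
  have [|x0 y0] := fa x y; first by rewrite -h z0; vec.
  by split.
have [w f4] := ex_fr4 n4 f3.
have [i [j hw]] := im w.
have [a aE] : exists a, a = T e v1 - c *: e by eexists.
have [z zE] : exists z, z = w - i *: e - j *: v1 by eexists.
have Ta : T e a = 0 by rewrite aE !TE ha Te // subrr.
have Tz : T e z = 0 by rewrite zE !TE hw Te //; vec.
have f4' : fr4 e a z v1.
  move=> x y s r h.
  have [] := f4 (x - y * c - s * i) y (r - s * j) s.
    by rewrite -h aE zE; vec.
  move=> h1 y0 h2 s0; move: h1 h2; rewrite y0 s0 !mul0r !subr0.
  by move=> -> ->.
have W x : in3 e a z x -> exists k y, x = k *: e + y /\ T e y = 0.
  move=> [k [y [s ->]]]; exists k, (y *: a + s *: z); split; first by rewrite addrA.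
  by rewrite !TE Ta Tz !scaler0 addr0.
have Wstar x : in3 e a z x -> in2 e x (m x x).
  move=> /W[k [y [-> Ty]]]; apply: univ_idem_star => //.
  by have [q ->] := ker _ Ty; exists q, 0; vec.
have Wcl x : in3 e a z x -> in3 e a z (m x x).
  by move=> hx; apply: in2_in3 (Wstar _ hx) => //; exact: in3_1.
apply: no_univ_idem; exists e; split=> // x.
case: (pselect (in3 e a z x)) => [|nx]; first exact: Wstar.
have [x1 [x2 [x3 [s hx]]]] := fr4_span n4 f4' x.
have [y1 [y2 [y3 [r hxx]]]] := fr4_span n4 f4' (m x x).
have s0 : s != 0.
  by apply/eqP => s0; apply: nx; exists x1, x2, x3; rewrite hx s0 scale0r addr0.
(* The coefficient of [v1] cancels, so [p = k e + y] lies in the hyperplane and [p^2] is a multiple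
   of [p]. As [y^2 = q e], this gives [q = 0], hence [y = 0]. *)
have [p pE] : exists p, p = (r / s) *: x - m x x by eexists.
have hp : in3 e a z p.
  exists (r / s * x1 - y1), (r / s * x2 - y2), (r / s * x3 - y3).
  by rewrite pE hxx hx; vecf.
have := dep2_outside Wcl nx hp.
have gp : gen x p.
  by rewrite pE; apply: gen_B; [apply: gen_Z|apply: gen_m]; apply: gen_refl.
move=> /(_ gp); have [k [y [hpy Ty]]] := W _ hp.
have [q hq] := ker _ Ty; have ey := T0_half Ty.
have hpp : m p p = (k ^+ 2 + q) *: e + k *: y.
  by rewrite hpy !mE (mC y e) ey ee hq; vecf.
have [y0 _|y0] := eqVneq y 0.
  exists (- k), (r / s).
  have -> : m x x = (r / s) *: x - p by rewrite pE; vec.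
  by rewrite hpy y0; vec.
rewrite hpp hpy -(scale1r y) scalerA mulr1 => /(dep2_comb (fr2_ker he Ty y0)).
move=> h; have q0 : q = 0 by move: h; rewrite expr2; lra.
by move: y0; rewrite (mnz (x := y)) ?eqxx // hq q0 scale0r.
Qed.

Lemma ex_idem : exists e, idem e.
Proof.
have [w hw] := @ex_notin_span R n n4 [::] isT.
have x0 : w != 0 by apply: contraNneq hw => ->; rewrite mem0v.
move: w x0 {hw} => x x0.
have scal y k : m y y = k *: y -> y != 0 -> exists e, idem e.
  move=> h y0; have k0 : k != 0.
    by apply/eqP => k0; move: h y0; rewrite k0 scale0r => /mnz ->; rewrite eqxx.
  exists (k^-1 *: y); split; first by rewrite scaler_eq0 negb_or invr_eq0 k0.
  by rewrite !mE h; vecf.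
case: (in1_or_fr2 (m x x) x0) => [[k h]|f]; first exact: scal h x0.
have [[_ [b1 [b2 hb]] [c1 [c2 hc]]] _] :=
  gen_plane (@gen_refl x) (gen_m (@gen_refl x) (@gen_refl x)) f.
have [y yE] : exists y, m x x = y by eexists.
rewrite yE in f hb hc.
have [c10|c10] := eqVneq c1 0.
  apply: (scal y c2); first by rewrite hc c10; vec.
  by apply: fr2_neq0 (fr2C f).
have nc1 : - c1 != 0 by rewrite oppr_eq0.
(* The cubic says that [(x + t y)^2] is proportional to [x + t y]. *)
have [t ht] := cubic_root (c2 - 2 * b1) (2 * b2) 1 nc1.
apply: (scal (x + t *: y) (2 * t * b1 + t ^+ 2 * c1)).
  have -> : m (x + t *: y) (x + t *: y) = (2 * t * b1 + t ^+ 2 * c1) *: x +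
      (1 + 2 * t * b2 + t ^+ 2 * c2) *: y.
    by rewrite !mE (mC y x) yE hb hc; vec.
  have -> : 1 + 2 * t * b2 + t ^+ 2 * c2 = (2 * t * b1 + t ^+ 2 * c1) * t.
    by apply/eqP; rewrite -subr_eq0 -ht; apply/eqP; ring.
  by vec.
apply/eqP => h; have [|/eqP] := f 1 t; first by rewrite -h; vec.
by rewrite oner_eq0.
Qed.

Theorem ex_univ_idem : exists e, univ_idem e.
Proof. by have [e /has_univ_idem_of_idem] := ex_idem. Qed.

End CommAlg.

(** * Commutative algebras without zero divisors have dimension at most two *)

Section Hopf.
Context (R : realType) (n : nat) (n4 : n = 4%N).
Local Notation V := 'rV[R]_n.
Implicit Types x y z w v u b c : V.

Lemma ex_notin_span_of (U : {vspace V}) (X : seq V) : (size X < \dim U)%N ->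
  exists2 w, w \in U & w \notin <<X>>%VS.
Proof.
move=> sX; apply: contrapT => h.
have : (\dim U <= size X)%N.
  apply: leq_trans (dim_span X); apply: dimvS; apply/subvP => w wU.
  by apply: contrapT => /negP hw; apply: h; exists w.
by move/(leq_ltn_trans)/(_ sX); rewrite ltnn.
Qed.

Section Unital.
Context (q : V -> V -> V) (U : {vspace V}) (i : V).
Context (qDl : forall x y z, q (x + y) z = q x z + q y z).
Context (qDr : forall x y z, q x (y + z) = q x y + q x z).
Context (qZl : forall a x y, q (a *: x) y = a *: q x y).
Context (qZr : forall a x y, q x (a *: y) = a *: q x y).
Context (qnz : forall x y, q x y = 0 -> x = 0 \/ y = 0).
Context (qC : forall x y, x \in U -> y \in U -> q x y = q y x).
Context (qU : forall x y, x \in U -> y \in U -> q x y \in U).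
Context (iU : i \in U) (i0 : i != 0) (qi : forall x, x \in U -> q i x = x).

Let qNl x y : q (- x) y = - q x y.
Proof. by rewrite -scaleN1r qZl scaleN1r. Qed.
Let qNr x y : q x (- y) = - q x y.
Proof. by rewrite -scaleN1r qZr scaleN1r. Qed.
Let qE := (qDl, qDr, qZl, qZr, qNl, qNr).
Let iq x : x \in U -> q x i = x.
Proof. by move=> xU; rewrite qC // qi. Qed.

(** By commutativity [(x - y) (x + y) = x^2 - y^2]. *)
Lemma sqr_inj x y : x \in U -> y \in U -> q x x = q y y -> x = y \/ x = - y.
Proof.
move=> xU yU h; case: (@qnz (x - y) (x + y)).
- by rewrite !qE h (qC yU xU); vec.
- by move=> /eqP; rewrite subr_eq0 => /eqP; left.
- by move=> /eqP; rewrite addr_eq0 => /eqP; right.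
Qed.

(* Multiplication by b on the three-dimensional invariant space <1, b, c>
   would have a real eigenvalue. *)
Lemma no_invariant3 b c : b \in U -> c \in U -> fr3 i b c ->
  in3 i b c (q b b) -> in3 i b c (q b c) -> False.
Proof.
move=> bU cU f hbb hbc; have f2 := fr3_12 f.
have nb t : b - t *: i <> 0.
  move=> h; have [|_ /eqP] := f2 (- t) 1; first by rewrite -h; vec.
  by rewrite oner_eq0.
case: (in2_or_fr3 (q b b) f2) => [[be [ga h]]|f3].
  have [al [de [ep h']]] := hbc.
  have ib : q i b = b := qi bU.
  have ic : q i c = c := qi cU.
  have ii : q i i = i := qi iU.
  have bi : q b i = b := iq bU.
  (* The value at [ep] of the quadratic polynomial that annihilates [b]. If it is zero the
     polynomial splits into zero divisors; otherwise [c] can be corrected to an eigenvector for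
     [ep]. *)
  pose D := ep ^+ 2 - ga * ep - be.
  have D0 : D != 0.
    apply/eqP => D0; case: (@qnz (b - ep *: i) (b - (ga - ep) *: i)) => [|/nb|/nb] //.
    rewrite !qE h ib bi ii; transitivity ((- D) *: i); last by rewrite D0 oppr0 scale0r.
    by rewrite /D; vec.
  pose y1 := - (al + ep * de) / D; pose y0 := de - (ga - ep) * y1.
  case: (@qnz (b - ep *: i) (c - (y0 *: i + y1 *: b))) => [|/nb //|/eqP].
    rewrite !qE h h' ib bi ii ic /y0.
    have e1 : al + ep * de = - (D * y1) by rewrite /y1; field.
    transitivity ((al + ep * de + D * y1) *: i).
      by rewrite /D; vec.
    by rewrite e1 addNr scale0r.
  by rewrite subr_eq0 => /eqP cE; apply: (fr3_nin f); exists y0, y1.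
have [x [y [z hx]]] := hbb.
have z0 : z != 0.
  by apply/eqP => z0; apply: (fr3_nin f3); exists x, y; rewrite hx z0 scale0r addr0.
have [al [de [ep h']]] := hbc.
have cE : c = z^-1 *: (q b b - x *: i - y *: b) by rewrite hx; vecf.
have bi : q b i = b := iq bU.
have bbb : exists a b' g : R, q b (q b b) = a *: i + b' *: b + g *: q b b.
  exists (z * al - ep * x), (x + z * de - ep * y), (y + ep).
  have -> : q b (q b b) = x *: b + y *: q b b + z *: q b c.
    by rewrite {1}hx !qE bi.
  by rewrite h' cE; vecf.
have [a [b' [g hb]]] := bbb.
(* A real root of the cubic relation [hb] splits it into [b - t i] times a quadratic expression in
   [b], both non-zero. *)
have [t ht] := cubic_root (- g) (- b') (- a) (oner_neq0 R).
case: (@qnz (b - t *: i) (q b b + (t - g) *: b + (t ^+ 2 - g * t - b') *: i)).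
- rewrite !qE bi hb !qi ?qU //.
  by rewrite -[RHS](scale0r i) -[X in _ = X *: i]oppr0 -ht; vec.
- exact: nb.
move=> h; have [|_ _ /eqP] := f3 (t ^+ 2 - g * t - b') (t - g) 1.
  by rewrite -h; vec.
by rewrite oner_eq0.
Qed.

Lemma no_real_square b be : b \in U -> fr2 i b -> q b b = be *: i -> be < 0.
Proof.
move=> bU f h; rewrite ltNge; apply/negP => be0.
have [|||e|e] := @sqr_inj b (Num.sqrt be *: i).
- by [].
- exact: memvZ.
- by rewrite h !qE qi // scalerA -expr2 sqr_sqrtr.
- by apply: (fr2_nin f); exists (Num.sqrt be).
- by apply: (fr2_nin f); exists (- Num.sqrt be); rewrite scaleNr.
Qed.

(** The span of [i] and [b] is a copy of the complex numbers, so [c^2] has a square root there, and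
    [sqr_inj] puts [c] there as well. *)
Lemma core_case0 b c be ga r : b \in U -> c \in U -> fr3 i b c ->
  q b b = be *: i -> q c c = ga *: i + r *: b -> False.
Proof.
move=> bU cU f hb hc.
have be0 := no_real_square bU (fr3_12 f) hb.
suff [u [v [h1 h2]]] : exists u v : R, u ^+ 2 + be * v ^+ 2 = ga /\ 2 * u * v = r.
  have [||e|e] := @sqr_inj c (u *: i + v *: b) cU.
  - by rewrite memvD // memvZ.
  - by rewrite !qE (iq bU) (qi bU) (qi iU) hb hc -h1 -h2; vec.
  - by apply: (fr3_nin f); exists u, v.
  - by apply: (fr3_nin f); exists (- u), (- v); rewrite e; vec.
(* The modulus of [c^2] in this complex plane; [t] below is to be [u^2]. For [t <= 0], [c^2] is a
   non-positive real with an imaginary root. *)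
pose S := Num.sqrt (ga ^+ 2 - be * r ^+ 2).
have D0 : 0 <= - be * r ^+ 2 by rewrite mulr_ge0 ?sqr_ge0 // oppr_ge0 ltW.
have SS : S ^+ 2 = ga ^+ 2 - be * r ^+ 2.
  by rewrite sqr_sqrtr //; have := sqr_ge0 ga; lra.
have S0 : 0 <= S by exact: sqrtr_ge0.
pose t := (ga + S) / 2.
have tt : t ^+ 2 - ga * t + be * r ^+ 2 / 4 = 0.
  rewrite /t; transitivity ((S ^+ 2 - (ga ^+ 2 - be * r ^+ 2)) / 4); first by field.
  by rewrite SS subrr mul0r.
case: (ltrP 0 t) => t0.
  exists (Num.sqrt t), (r / (2 * Num.sqrt t)).
  have s0 : Num.sqrt t != 0 by rewrite gt_eqF // sqrtr_gt0.
  split; last by field.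
  rewrite sqr_sqrtr ?ltW // expr_div_n exprMn sqr_sqrtr ?ltW //.
  have t1 : t != 0 by rewrite gt_eqF.
  apply: (mulfI t1); apply/eqP; rewrite -subr_eq0 -tt; apply/eqP; by field.
have gS : ga <= - S by move: t0; rewrite /t; lra.
have r0 : r = 0.
  have : S ^+ 2 <= ga ^+ 2 by nra.
  rewrite SS => h; have : be * r ^+ 2 >= 0 by lra.
  by rewrite nmulr_rge0 // => h2; apply/eqP; rewrite -sqrf_eq0 eq_le h2 sqr_ge0.
exists 0, (Num.sqrt (ga / be)); split; last by rewrite r0; ring.
rewrite sqr_sqrtr; last by rewrite ler_ndivlMr // mul0r; lra.
by field; rewrite lt_eqF.
Qed.

(** Seek [x = x0 i + v b] and [y = y0 i + c] with equal squares. The coefficients of [b] and [c]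
    determine [x0] and [y0]; that of [i] becomes a cubic equation for [t = v^2] with a positive
    root. *)
Lemma core_case b c be s ga r : b \in U -> c \in U -> fr3 i b c ->
  q b b = be *: i + s *: c -> q c c = ga *: i + r *: b -> False.
Proof.
move=> bU cU f hb hc.
have [s0|s0] := eqVneq s 0.
  by apply: (core_case0 bU cU f _ hc (be := be)); rewrite hb s0; vec.
have [r0|r0] := eqVneq r 0.
  apply: (@core_case0 c b ga be s cU bU _ _ hb).
    by move=> x y z h; have [] := f x z y; [rewrite -h; vec|].
  by rewrite hc r0; vec.
have [||t t0 ht] := @cubic_pos_root R (s ^+ 2) (- 4 * be) (4 * ga) (- r ^+ 2).
- by rewrite exprn_even_gt0.
- by rewrite oppr_lt0 exprn_even_gt0.
have v0 : Num.sqrt t != 0 by rewrite gt_eqF // sqrtr_gt0.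
have vv : Num.sqrt t ^+ 2 = t by rewrite sqr_sqrtr // ltW.
move: (Num.sqrt t) v0 vv => v v0 vv.
pose x := (r / (2 * v)) *: i + v *: b.
pose y := (t * s / 2) *: i + 1 *: c.
have xU : x \in U by rewrite memvD // memvZ.
have yU : y \in U by rewrite memvD // memvZ.
have h : q x x = q y y.
  rewrite /x /y !qE (iq bU) (iq cU) (qi bU) (qi cU) (qi iU) hb hc.
  have e1 : (r / (2 * v)) ^+ 2 + v ^+ 2 * be = (t * s / 2) ^+ 2 + ga.
    have k : 4 * v ^+ 2 != 0 by rewrite mulf_neq0 ?expf_neq0 ?pnatr_eq0.
    apply: (mulfI k); apply/eqP; rewrite -subr_eq0 -oppr_eq0 -ht -vv.
    by apply/eqP; field.
  transitivity (((r / (2 * v)) ^+ 2 + v ^+ 2 * be) *: i + r *: b + t *: (s *: c)).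
    by rewrite -vv; vecf.
  by rewrite e1; vecf.
have [e|e] := sqr_inj xU yU h.
  have [|_ /eqP] := f (r / (2 * v) - t * s / 2) v (-1).
    by transitivity (x - y); [rewrite /x /y; vec|rewrite e subrr].
  by rewrite (negPf v0).
have [|_ /eqP] := f (r / (2 * v) + t * s / 2) v 1.
  by transitivity (x + y); [rewrite /x /y; vec|rewrite e addNr].
by rewrite (negPf v0).
Qed.

(** Completing squares removes the [b]-part of [b^2] and the [c]-part of [c^2]. *)
Lemma in3_core b c : b \in U -> c \in U -> fr3 i b c ->
  in3 i b c (q b b) -> in3 i b c (q c c) -> False.
Proof.
move=> bU cU f [be [b2 [s hb]]] [ga [r [c3 hc]]].
have ib := qi bU; have bi := iq bU; have ic := qi cU; have ci := iq cU.
have ii := qi iU.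
apply: (@core_case (b - (b2 / 2) *: i) (c - (c3 / 2) *: i)
  (be + b2 ^+ 2 / 4 + s * c3 / 2) s (ga + r * b2 / 2 + c3 ^+ 2 / 4) r).
- by rewrite memvB // memvZ.
- by rewrite memvB // memvZ.
- move=> x y z h; have [|h1 y0 z0] := f (x - y * (b2 / 2) - z * (c3 / 2)) y z.
    by rewrite -h; vec.
  by split=> //; move: h1; rewrite y0 z0 !mul0r !subr0.
- by rewrite !qE ib bi ii hb; vecf.
- by rewrite !qE ic ci ii hc; vecf.
Qed.

Lemma span_mem3 b c x : \dim U = 3%N -> b \in U -> c \in U -> fr3 i b c ->
  x \in U -> in3 i b c x.
Proof.
move=> d3 bU cU f xU; apply: span_in3.
have fre : free [:: i; b; c].
  apply/freeP => k; rewrite !big_ord_recl big_ord0 /= addr0 !addrA => /f[h0 h1 h2].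
  by case=> [[|[|[|j]]] hj] //; [rewrite -[RHS]h0|rewrite -[RHS]h1|
    rewrite -[RHS]h2]; congr k; exact: val_inj.
suff -> : <<[:: i; b; c]>>%VS = U by [].
apply/eqP; rewrite eqEdim (eqP fre) d3 leqnn andbT.
by apply/span_subvP => y; rewrite !inE => /or3P[] /eqP ->.
Qed.

Lemma dim_le2 : (\dim U <= 2)%N.
Proof.
rewrite leqNgt; apply/negP => d3.
have [b bU nb] := ex_notin_span_of (X := [:: i]) (ltn_trans (isT : 1 < 2)%N d3).
have f2 : fr2 i b.
  case: (in1_or_fr2 b i0) => // -[a e].
  by move: nb; rewrite e span_seq1 memvZ // memv_line.
have [c cU nc] := ex_notin_span_of (X := [:: i; b]) d3.
have f3 : fr3 i b c.
  case: (in2_or_fr3 c f2) => // -[x [y e]].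
  by move: nc; rewrite e memvD // memvZ // memv_span // !inE eqxx ?orbT.
have d4 : (\dim U <= 4)%N.
  by apply: leq_trans (dimvS (subvf U)) _; rewrite dimvf /dim /= mul1n; apply: eq_leq.
have : \dim U = 3%N \/ \dim U = 4%N.
  by move: d3 d4; case: (\dim U) => [|[|[|[|[|k]]]]] // _ _; constructor.
case=> dU.
  apply: (no_invariant3 bU cU f3); apply: span_mem3 => //; exact: qU.
have allU x : x \in U.
  suff -> : U = fullv by exact: memvf.
  by apply/eqP; rewrite eqEdim subvf dU dimvf /dim /= mul1n; apply: eq_leq.
have [c' [f3' hb]] : exists c', fr3 i b c' /\ in3 i b c' (q b b).
  case: (in2_or_fr3 (q b b) f2) => [[x [y h]]|h].
    by exists c; split=> //; exists x, y, 0; rewrite h; vec.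
  by exists (q b b); split=> //; exists 0, 0, 1; vec.
move: c' f3' hb => {c cU nc f3} c f3 hb.
case: (in3_or_fr4 (q b c) f3) => [h|f4]; first exact: (no_invariant3 (allU _) (allU _) f3 hb h).
have [x [y [z [s hc]]]] := fr4_span n4 f4 (q c c).
have [be [ga [de hbb]]] := hb.
(* The shift cancels the component of [c^2] along [q b c]. *)
have f3' : fr3 i b (c - (s / 2) *: b).
  move=> k l o h; have [|k0 l0 o0] := f3 k (l - o * (s / 2)) o; first by rewrite -h; vec.
  by split=> //; move: l0; rewrite o0 mul0r subr0.
apply: (in3_core (allU _) (allU _) f3').
  by exists be, (ga + de * (s / 2)), de; rewrite hbb; vec.
exists (x + s ^+ 2 / 4 * be), (y + z * (s / 2) + s ^+ 2 / 4 * (ga + de * (s / 2))), (z + s ^+ 2 / 4 * de).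
by rewrite !qE (qC (allU c) (allU b)) hc hbb; vecf.
Qed.

End Unital.

End Hopf.

(** * Power-commutative algebras without zero divisors *)

Section PowerCommutative.
Context (R : realType) (n : nat) (n4 : n = 4%N).
Local Notation V := 'rV[R]_n.
Implicit Types x y z w v u e : V.
Context (p : V -> V -> V).
Context (pDl : forall x y z, p (x + y) z = p x z + p y z).
Context (pDr : forall x y z, p x (y + z) = p x y + p x z).
Context (pZl : forall a x y, p (a *: x) y = a *: p x y).
Context (pZr : forall a x y, p x (a *: y) = a *: p x y).
Context (pnz : forall x y, p x y = 0 -> x = 0 \/ y = 0).

Lemma pNl x y : p (- x) y = - p x y.
Proof. by rewrite -scaleN1r pZl scaleN1r. Qed.
Lemma pNr x y : p x (- y) = - p x y.
Proof. by rewrite -scaleN1r pZr scaleN1r. Qed.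
Lemma p0l x : p 0 x = 0.
Proof. by apply: (addrI (p 0 x)); rewrite -pDl !addr0. Qed.
Lemma p0r x : p x 0 = 0.
Proof. by apply: (addrI (p x 0)); rewrite -pDr !addr0. Qed.
Let pE := (pDl, pDr, pZl, pZr, pNl, pNr, p0l, p0r).

Definition leftmul a : 'End(V) :=
  linfun (mulmxr (\matrix_j p a (delta_mx 0 j))).

Lemma leftmulE a x : leftmul a x = p a x.
Proof.
have psum (I : finType) (f : I -> V) : p a (\sum_j f j) = \sum_j p a (f j).
  by elim/big_rec2: _ => [|j u v _ <-]; rewrite ?p0r ?pDr.
rewrite lfunE /= mulmx_sum_row {2}(row_sum_delta x) psum.
by apply: eq_bigr => j _; rewrite rowK pZr.
Qed.

Lemma leftmul_ker a : a != 0 -> lker (leftmul a) == 0%VS.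
Proof.
move=> a0; rewrite -subv0; apply/subvP => x; rewrite memv_ker leftmulE => /eqP.
by case/pnz => [/eqP|->]; [rewrite (negPf a0)|rewrite mem0v].
Qed.

Definition leftdiv a : 'End(V) := (leftmul a)^-1%VF.

Lemma leftdivK a x : a != 0 -> p a (leftdiv a x) = x.
Proof. by move=> a0; rewrite -leftmulE lker0_lfunVK // leftmul_ker. Qed.

Lemma leftmulK a x : a != 0 -> leftdiv a (p a x) = x.
Proof. by move=> a0; rewrite -leftmulE lker0_lfunK // leftmul_ker. Qed.

Definition subalg (U : {vspace V}) :=
  forall x y, x \in U -> y \in U -> p x y \in U.

Lemma leftdiv_mem a (U : {vspace V}) x : a != 0 -> subalg U -> a \in U ->
  x \in U -> leftdiv a x \in U.
Proof.
move=> a0 sU aU xU.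
have lU : (leftmul a @: U <= U)%VS.
  by apply/subvP => y /memv_imgP[z zU ->]; rewrite leftmulE; apply: sU.
have dU : \dim (leftmul a @: U) = \dim U.
  by apply: limg_dim_eq; rewrite (eqP (leftmul_ker a0)) capv0.
have : (leftmul a @: U)%VS == U by rewrite eqEdim lU dU leqnn.
move/eqP => eU; move: xU; rewrite -{1}eU => /memv_imgP[z zU ->].
by rewrite leftmulE leftmulK.
Qed.

Context (hpc : forall a x y,
  (forall U, subalg U -> a \in U -> x \in U) ->
  (forall U, subalg U -> a \in U -> y \in U) -> p x y = p y x).

(** On the least subalgebra containing [a], which is commutative by [hpc], the product [a^-1 (x y)]
    has the unit [a] and is still commutative, so [dim_le2] bounds the dimension. *)
Lemma small_subalg a : exists U : {vspace V},
  [/\ subalg U, a \in U, forall x y, x \in U -> y \in U -> p x y = p y x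
    & (\dim U <= 2)%N].
Proof.
have [U [sU aU minU]] : exists U : {vspace V}, [/\ subalg U, a \in U &
    forall U', subalg U' -> a \in U' -> (U <= U')%VS].
  pose P k := `[< exists U : {vspace V}, [/\ subalg U, a \in U & \dim U = k] >].
  have exP : exists k, P k.
    exists (\dim {:V}); apply/asboolP; exists fullv; split=> //; last exact: memvf.
    by move=> *; exact: memvf.
  case: (ex_minnP exP) => k /asboolP[U [sU aU dU]] kmin.
  exists U; split=> // U' sU' aU'.
  have : P (\dim (U :&: U')).
    apply/asboolP; exists (U :&: U')%VS; split=> //; last by rewrite memv_cap aU.
    by move=> x y; rewrite !memv_cap => /andP[? ?] /andP[? ?]; rewrite sU ?sU'.
  move=> /kmin; rewrite -dU => dle.
  have : (U :&: U')%VS == U by rewrite eqEdim capvSl.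
  by move/eqP => <-; exact: capvSr.
have cU x y : x \in U -> y \in U -> p x y = p y x.
  by move=> xU yU; apply: (@hpc a) => U' sU' aU'; apply: (subvP (minU _ sU' aU')).
exists U; split=> //.
have [a0|a0] := eqVneq a 0.
  have : (U <= 0)%VS.
    apply: minU; last by rewrite a0 mem0v.
    by move=> x y; rewrite !memv0 => /eqP -> _; rewrite p0l.
  by rewrite subv0 => /eqP ->; rewrite dimv0.
apply: (@dim_le2 R n n4 (fun x y => leftdiv a (p x y)) U a) => //.
- by move=> x y z; rewrite pDl linearD.
- by move=> x y z; rewrite pDr linearD.
- by move=> k x y; rewrite pZl linearZ.
- by move=> k x y; rewrite pZr linearZ.
- move=> x y h; apply: pnz; rewrite -(leftdivK (p x y) a0) h p0r //.
- by move=> x y xU yU; rewrite cU.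
- by move=> x y xU yU; apply: leftdiv_mem => //; apply: sU.
- by move=> x xU; rewrite leftmulK.
Qed.

Lemma span2_of_dim (U : {vspace V}) : (\dim U <= 2)%N ->
  exists u v, [/\ u \in U, v \in U & forall x, x \in U -> in2 u v x].
Proof.
move=> d2; have bU := vbasisP U; have sX := span_basis bU.
have sz : (size (vbasis U) <= 2)%N by rewrite size_tuple.
have mX v : v \in tval (vbasis U) -> v \in U by exact: vbasis_mem.
move: sz sX mX; case: (tval (vbasis U)) => [|u [|v []]] //= _ sX mX.
- exists 0, 0; split; rewrite ?mem0v // => x.
  by rewrite -sX span_nil memv0 => /eqP ->; exists 0, 0; vec.
- exists u, 0; split; rewrite ?mem0v ?mX ?inE // => x.
  by rewrite -sX => /span_in1[c ->]; exists c, 0; vec.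
- exists u, v; split; rewrite ?mX ?inE ?eqxx ?orbT // => x.
  by rewrite -sX => /span_in2.
Qed.

Definition sym x y := 2^-1 *: (p x y + p y x).

Lemma sym_sqr x : sym x x = p x x. Proof. by rewrite /sym; vecf. Qed.

Lemma sym_plane x : exists u v, plane sym u v /\ in2 u v x.
Proof.
have [U [sU xU cU dU]] := small_subalg x.
have [u [v [uU vU h]]] := span2_of_dim dU.
exists u, v; split; last exact: h.
by split; apply: h; rewrite memvZ // memvD // sU.
Qed.

(** If every [v^2] were a multiple of [v], the factor would depend linearly on [v], and some
    non-zero vector would square to zero. *)
Lemma ex_nonidem : exists v, fr2 v (p v v).
Proof.
apply: contrapT => no.
have line v : v != 0 -> in1 v (p v v).
  by move=> v0; case: (in1_or_fr2 (p v v) v0) => // f; case: no; exists v.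
have [w hw] := @ex_notin_span R n n4 [::] isT.
have w0 : w != 0 by apply: contraNneq hw => ->; rewrite mem0v.
have [y f] := ex_fr2 n4 w0.
have nz (a b : R) : (a != 0) || (b != 0) -> a *: w + b *: y != 0.
  by apply: contraTneq => /f[-> ->]; rewrite eqxx.
have [lx hx] := line _ w0.
have [ly hy] := line _ (fr2_neq0 (fr2C f)).
have [|l hp] := line (w + y).
  by have := nz 1 1; rewrite oner_eq0 !scale1r; apply.
have [|l' hm] := line (w - y).
  by have := nz 1 (-1); rewrite oner_eq0 scale1r scaleN1r; apply.
have [l1 l2] : l + l' - 2 * lx = 0 /\ l - l' - 2 * ly = 0.
  apply: f; transitivity (l *: (w + y) + l' *: (w - y) - 2 *: (lx *: w) - 2 *: (ly *: y)).
    by vec.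
  by rewrite -hp -hm -hx -hy !pE; vec.
have hl : l = lx + ly by lra.
have hs : p w y + p y w = ly *: w + lx *: y.
  transitivity (p (w + y) (w + y) - p w w - p y y); first by rewrite !pE; vec.
  by rewrite hp hx hy hl; vec.
have h0 : p (ly *: w - lx *: y) (ly *: w - lx *: y) = 0.
  transitivity (ly ^+ 2 *: p w w + lx ^+ 2 *: p y y - (lx * ly) *: (p w y + p y w)).
    by rewrite !pE; vec.
  by rewrite hs hx hy; vec.
have [|ly0 /eqP] := f ly (- lx).
  by case: (pnz h0) => h; rewrite -h; vec.
rewrite oppr_eq0 => /eqP lx0.
have : p w w = 0 by rewrite hx lx0 scale0r.
by case/pnz => h; rewrite h eqxx in w0.
Qed.

Lemma ex_central_idem : exists e, [/\ e != 0, p e e = e,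
  forall v, p e v = p v e, forall v, in2 e v (p v v) & forall v, in2 e v (p e v)].
Proof.
have symC x y : sym x y = sym y x by rewrite /sym addrC.
have symDl x y z : sym (x + y) z = sym x z + sym y z by rewrite /sym !pE; vec.
have symZl a x y : sym (a *: x) y = a *: sym x y by rewrite /sym !pE; vec.
have symnz x : sym x x = 0 -> x = 0 by rewrite sym_sqr => /pnz[].
have [e [[e0 ee] he]] := ex_univ_idem symC symDl symZl symnz sym_plane n4.
rewrite sym_sqr in ee.
have sq v : in2 e v (p v v) by rewrite -sym_sqr.
(* As [v^2] lies in the span of [e] and [v], independence of [v] and [v^2] puts [e] into the
   commutative subalgebra of [v]. *)
have com1 v : fr2 v (p v v) -> p e v = p v e.
  move=> f; have [U [sU vU cU _]] := small_subalg v.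
  have [x [y h]] := sq v.
  have x0 : x != 0.
    by apply/eqP => x0; apply: (fr2_nin f); exists y; rewrite h x0 scale0r add0r.
  apply: cU => //.
  have -> : e = x^-1 *: (p v v - y *: v) by rewrite h; vecf.
  by rewrite memvZ // memvB ?memvZ // sU.
have [v0 f0] := ex_nonidem.
have com v : p e v = p v e.
  (* Otherwise [v0^2] would, in the limit, be a multiple of [v0]. *)
  have [t [t0 ft]] : exists t, t != 0 /\ fr2 (v0 + t *: v) (p (v0 + t *: v) (v0 + t *: v)).
    apply: contrapT => no.
    have VPv : VP (fun t => v0 + t *: v).
      by apply: VPD; [|apply: VPX]; apply: VPC.
    have := dep2_lim VPv (VPm symC symDl symZl VPv VPv).
    rewrite scale0r addr0 => h; apply: (fr2_nin f0).
    apply: dep2_in1; first exact: fr2_neq0 f0.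
    rewrite -sym_sqr; apply: h => t t0; rewrite sym_sqr.
    have [->|vt0] := eqVneq (v0 + t *: v) 0; first by move=> i j; rewrite !mxE; ring.
    case: (in1_or_fr2 (p (v0 + t *: v) (v0 + t *: v)) vt0) => h'.
      by apply: (in1_dep2 (x := v0 + t *: v)) => //; exists 1; rewrite scale1r.
    by case: no; exists t.
  have := com1 _ ft; rewrite !pE (com1 _ f0) => /addrI h.
  by have := congr1 (fun u => t^-1 *: u) h; rewrite !scalerA mulVf // !scale1r.
exists e; split=> // v.
have [x [y h]] := sq (e + v); have [x' [y' h']] := sq v.
exists ((x + y - 1 - x') / 2), ((y - y') / 2).
have -> : p e v = 2^-1 *: (p (e + v) (e + v) - p e e - p v v).
  by rewrite !pE -(com v); vecf.
by rewrite h h' ee; vecf.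
Qed.

(** Every vector is an eigenvector modulo [e], so there is one eigenvalue; were it 0, [e] would
    annihilate some [b - c e]. *)
Lemma ex_scale e : e != 0 -> p e e = e -> (forall v, in2 e v (p e v)) ->
  exists2 l : R, l != 0 & forall v, exists c, p e v = l *: v + c *: e.
Proof.
move=> e0 ee h; have [b f] := ex_fr2 n4 e0.
have [c [l hb]] := h b; exists l.
  apply/eqP => l0; have : p e (b - c *: e) = 0 by rewrite !pE ee hb l0; vec.
  case/pnz => h'; first by rewrite h' eqxx in e0.
  have [|_ /eqP] := f (- c) 1; first by rewrite -h'; vec.
  by rewrite oner_eq0.
move=> v; case: (in2_or_fr3 v f) => [[x [y ->]]|f3].
  by exists (x + y * c - l * x); rewrite !pE ee hb; vec.
have [c' [l' hv]] := h v; have [c2 [l2 h2]] := h (b + v).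
have [_ h3 h4] : [/\ c + c' - c2 = 0, l - l2 = 0 & l' - l2 = 0].
  apply: f3; transitivity (c *: e + l *: b + (c' *: e + l' *: v) - (c2 *: e + l2 *: (b + v))).
    by vec.
  by rewrite -h2 -hb -hv !pE subrr.
have ll : l' = l by lra.
by exists c'; rewrite hv ll addrC.
Qed.

End PowerCommutative.

(** * Coordinates of three-dimensional vectors *)

Section Vec3.
Context (R : realType).
Implicit Types (u v w x : vec3 R) (M A B : 'M[R]_3).

Lemma sum3 (F : 'I_3 -> R) : \sum_i F i = F 0 + F 1 + F 2.
Proof.
rewrite !big_ord_recl big_ord0 addr0 addrA.
by congr (_ + F _ + F _); apply: val_inj.
Qed.

Lemma forall3 (Q : 'I_3 -> Prop) : Q 0 -> Q 1 -> Q 2 -> forall i, Q i.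
Proof.
move=> h0 h1 h2 [[|[|[|//]]] hi].
- by rewrite (_ : Ordinal hi = 0) //; exact: val_inj.
- by rewrite (_ : Ordinal hi = 1) //; exact: val_inj.
- by rewrite (_ : Ordinal hi = 2) //; exact: val_inj.
Qed.

Lemma vec3P u v : u 0 0 = v 0 0 -> u 1 0 = v 1 0 -> u 2 0 = v 2 0 -> u = v.
Proof.
by move=> h0 h1 h2; apply/colP; apply: forall3.
Qed.

Lemma dotE u v : dot u v = u 0 0 * v 0 0 + u 1 0 * v 1 0 + u 2 0 * v 2 0.
Proof. exact: sum3. Qed.

Lemma cross0 u v : cross u v 0 0 = u 1 0 * v 2 0 - u 2 0 * v 1 0.
Proof. by rewrite mxE. Qed.
Lemma cross1 u v : cross u v 1 0 = u 2 0 * v 0 0 - u 0 0 * v 2 0.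
Proof. by rewrite mxE. Qed.
Lemma cross2 u v : cross u v 2 0 = u 0 0 * v 1 0 - u 1 0 * v 0 0.
Proof. by rewrite mxE. Qed.
Definition crossE := (cross0, cross1, cross2).

Lemma mulmx3E m n (A : 'M[R]_(m, 3)) (B : 'M[R]_(3, n)) i j :
  (A *m B) i j = A i 0 * B 0 j + A i 1 * B 1 j + A i 2 * B 2 j.
Proof. by rewrite mxE sum3. Qed.

Definition mkvec (a b c : R) : vec3 R := \col_i [:: a; b; c]`_i.
Lemma mkvec0 a b c : mkvec a b c 0 0 = a. Proof. by rewrite mxE. Qed.
Lemma mkvec1 a b c : mkvec a b c 1 0 = b. Proof. by rewrite mxE. Qed.
Lemma mkvec2 a b c : mkvec a b c 2 0 = c. Proof. by rewrite mxE. Qed.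
Definition mkvecE := (mkvec0, mkvec1, mkvec2).

Lemma mkvec_eta u : u = mkvec (u 0 0) (u 1 0) (u 2 0).
Proof. by apply: vec3P; rewrite mkvecE. Qed.

Section Mx3E.
Context (a00 a01 a02 a10 a11 a12 a20 a21 a22 : R).
Local Notation A := (mx3 a00 a01 a02 a10 a11 a12 a20 a21 a22).
Lemma mx300 : A 0 0 = a00. Proof. by rewrite mxE. Qed.
Lemma mx301 : A 0 1 = a01. Proof. by rewrite mxE. Qed.
Lemma mx302 : A 0 2 = a02. Proof. by rewrite mxE. Qed.
Lemma mx310 : A 1 0 = a10. Proof. by rewrite mxE. Qed.
Lemma mx311 : A 1 1 = a11. Proof. by rewrite mxE. Qed.
Lemma mx312 : A 1 2 = a12. Proof. by rewrite mxE. Qed.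
Lemma mx320 : A 2 0 = a20. Proof. by rewrite mxE. Qed.
Lemma mx321 : A 2 1 = a21. Proof. by rewrite mxE. Qed.
Lemma mx322 : A 2 2 = a22. Proof. by rewrite mxE. Qed.
End Mx3E.
Definition mx3E := (mx300, mx301, mx302, mx310, mx311, mx312, mx320, mx321, mx322).

Lemma mat3P A B : A 0 0 = B 0 0 -> A 0 1 = B 0 1 -> A 0 2 = B 0 2 ->
  A 1 0 = B 1 0 -> A 1 1 = B 1 1 -> A 1 2 = B 1 2 ->
  A 2 0 = B 2 0 -> A 2 1 = B 2 1 -> A 2 2 = B 2 2 -> A = B.
Proof.
by move=> *; apply/matrixP; apply: forall3; apply: forall3.
Qed.

(** The product of the family with [epsilon y + delta d] relaxed to any [M]. All forms and maps on
    the exterior square of 3-space factor through the cross product. *)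
Definition Gmul (x : vec3 R) (M : 'M[R]_3) (z : vec3 R) (l : R)
    (p q : R * vec3 R) : R * vec3 R :=
  (p.1 * q.1 + p.1 * dot z q.2 + q.1 * dot z p.2 + dot z p.2 * dot z q.2
     + l ^+ 2 * dot x (cross p.2 q.2) - l ^+ 2 * dot p.2 q.2,
   (l * (p.1 + dot z p.2)) *: q.2 + (l * (q.1 + dot z q.2)) *: p.2
     + l ^+ 2 *: (M *m cross p.2 q.2)).

End Vec3.

(** * Quadratic algebras and their imaginary bases *)

Section Quadratic.
Context (R : realType) (n : nat) (n4 : n = 4%N).
Local Notation V := 'rV[R]_n.
Implicit Types x y z w v u e : V.

Section Basis.
Context (H : V -> V -> V) (e : V).
Context (HDl : forall x y z, H (x + y) z = H x z + H y z).
Context (HDr : forall x y z, H x (y + z) = H x y + H x z).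
Context (HZl : forall a x y, H (a *: x) y = a *: H x y).
Context (HZr : forall a x y, H x (a *: y) = a *: H x y).
Context (Hnz : forall x y, H x y = 0 -> x = 0 \/ y = 0).
Context (e0 : e != 0) (eH : forall x, H e x = x) (He : forall x, H x e = x).
Context (sq : forall v, in2 e v (H v v)).

Let HNl x y : H (- x) y = - H x y.
Proof. by rewrite -scaleN1r HZl scaleN1r. Qed.
Let HNr x y : H x (- y) = - H x y.
Proof. by rewrite -scaleN1r HZr scaleN1r. Qed.
Let HE := (HDl, HDr, HZl, HZr, HNl, HNr, eH, He).

(** Otherwise [v - sqrt q e] and [v + sqrt q e] would be zero divisors. *)
Lemma sqr_neg v q : fr2 e v -> H v v = q *: e -> q < 0.
Proof.
move=> f h; rewrite ltNge; apply/negP => q0.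
case: (@Hnz (v - Num.sqrt q *: e) (v + Num.sqrt q *: e)).
- by rewrite !HE h -{1}[q](sqr_sqrtr q0); vec.
- move=> k; have [|_ /eqP] := f (- Num.sqrt q) 1; first by rewrite -k; vec.
  by rewrite oner_eq0.
- move=> k; have [|_ /eqP] := f (Num.sqrt q) 1; first by rewrite -k; vec.
  by rewrite oner_eq0.
Qed.

Lemma imag_shift v : exists c q, H (v - c *: e) (v - c *: e) = q *: e.
Proof.
have [x [y h]] := sq v; exists (y / 2), (x + y ^+ 2 / 4).
by rewrite !HE h; vecf.
Qed.

Lemma imag_unit v q : q < 0 -> H v v = q *: e ->
  exists k, k != 0 /\ H (k *: v) (k *: v) = - e.
Proof.
move=> q0 h; have s0 : 0 < Num.sqrt (- q) by rewrite sqrtr_gt0 oppr_gt0.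
have s1 := lt0r_neq0 s0.
have ss : q = - Num.sqrt (- q) ^+ 2 by rewrite sqr_sqrtr ?opprK // oppr_ge0 ltW.
exists (Num.sqrt (- q))^-1; split; first by rewrite invr_eq0.
rewrite !HE h; move: (Num.sqrt (- q)) ss s1 => s -> s1.
by vecf.
Qed.

Lemma imag_pair u v al be : fr3 e u v -> H u u = al *: e -> H v v = be *: e ->
  exists s, H u v + H v u = s *: e.
Proof.
move=> f hu hv; have [q [l hp]] := sq (u + v); have [q' [l' hm]] := sq (u - v).
have [_ l1 l2] : [/\ q + q' - 2 * al - 2 * be = 0, l + l' = 0 & l - l' = 0].
  apply: f; transitivity ((q *: e + l *: (u + v)) + (q' *: e + l' *: (u - v))
    - 2 *: (al *: e) - 2 *: (be *: e)); first by vec.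
  by rewrite -hp -hm -hu -hv !HE; vec.
have l0 : l = 0 by lra.
exists (q - al - be); transitivity (H (u + v) (u + v) - H u u - H v v).
  by rewrite !HE; vec.
by rewrite hp hu hv l0; vec.
Qed.

(** Gram-Schmidt for the form given by [u v + v u], which [sqr_neg] makes negative definite on
    imaginary elements. *)
Lemma ex_orthonormal : exists b1 b2 b3, [/\ fr4 e b1 b2 b3,
  [/\ H b1 b1 = - e, H b2 b2 = - e & H b3 b3 = - e] &
  [/\ H b2 b1 = - H b1 b2, H b3 b1 = - H b1 b3 & H b3 b2 = - H b2 b3]].
Proof.
have [w1 f1] := ex_fr2 n4 e0.
have [c1 [q1 h1]] := imag_shift w1.
have fc1 : fr2 e (w1 - c1 *: e).
  move=> x y h; have [|k ->] := f1 (x - y * c1) y; first by rewrite -h; vec.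
  by split=> //; move: k; have [|_ ->] := f1 (x - y * c1) y; [rewrite -h; vec|rewrite mul0r subr0].
have [k1 [k10 b1b1]] := imag_unit (sqr_neg fc1 h1) h1.
have [b1 b1E] : exists b1, b1 = k1 *: (w1 - c1 *: e) by eexists.
rewrite -b1E in b1b1.
have fb1 : fr2 e b1.
  move=> x y h; have [|-> /eqP] := fc1 x (y * k1); first by rewrite -h b1E; vec.
  by rewrite mulf_eq0 (negPf k10) orbF => /eqP.
have [w2 f2] := ex_fr3 n4 fb1.
have [c2 [q2 h2]] := imag_shift w2.
have fc2 : fr3 e b1 (w2 - c2 *: e).
  move=> x y z h; have [|k y0 z0] := f2 (x - z * c2) y z; first by rewrite -h; vec.
  by split=> //; move: k; rewrite z0 mul0r subr0.
have b1b1' : H b1 b1 = (- 1) *: e by rewrite b1b1 scaleN1r.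
have [s2 hs2] := imag_pair fc2 b1b1' h2.
move: (w2 - c2 *: e) h2 fc2 hs2 => {f2} v2 h2 fc2 hs2.
have [u2 u2E] : exists u2, u2 = v2 + (s2 / 2) *: b1 by eexists.
have fu2 : fr3 e b1 u2.
  move=> x y z h; have [|x0 k z0] := fc2 x (y + z * (s2 / 2)) z.
    by rewrite -h u2E; vec.
  by split=> //; move: k; rewrite z0 mul0r addr0.
have hu2 : H u2 u2 = (q2 + s2 ^+ 2 / 2 - s2 ^+ 2 / 4) *: e.
  transitivity (H v2 v2 + (s2 / 2) *: (H b1 v2 + H v2 b1) + (s2 / 2) ^+ 2 *: H b1 b1).
    by rewrite u2E !HE; vecf.
  by rewrite h2 hs2 b1b1; vecf.
have a12 : H b1 u2 + H u2 b1 = 0.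
  transitivity (H b1 v2 + H v2 b1 + s2 *: H b1 b1).
    by rewrite u2E !HE; vecf.
  by rewrite hs2 b1b1; vec.
have feu2 : fr2 e u2.
  by move=> x y h; have [] := fu2 x 0 y; [rewrite -h; vec|].
have [k2 [k20 b2b2]] := imag_unit (sqr_neg feu2 hu2) hu2.
have [b2 b2E] : exists b2, b2 = k2 *: u2 by eexists.
rewrite -b2E in b2b2.
have fb2 : fr3 e b1 b2.
  move=> x y z h; have [|-> -> /eqP] := fu2 x y (z * k2); first by rewrite -h b2E; vec.
  by rewrite mulf_eq0 (negPf k20) orbF => /eqP.
have {}a12 : H b1 b2 + H b2 b1 = 0 by rewrite b2E !HE -scalerDr a12 scaler0.
have b2b2' : H b2 b2 = (- 1) *: e by rewrite b2b2 scaleN1r.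
have [w3 f3] := ex_fr4 n4 fb2.
have [c3 [q3 h3]] := imag_shift w3.
have fc3 : fr4 e b1 b2 (w3 - c3 *: e).
  move=> x y z w h; have [|k y0 z0 w0] := f3 (x - w * c3) y z w; first by rewrite -h; vec.
  by split=> //; move: k; rewrite w0 mul0r subr0.
move: (w3 - c3 *: e) h3 fc3 => {f3} v3 h3 fc3.
have fe13 : fr3 e b1 v3.
  by move=> x y z h; have [] := fc3 x y 0 z; [rewrite -h; vec|].
have fe23 : fr3 e b2 v3.
  by move=> x y z h; have [] := fc3 x 0 y z; [rewrite -h; vec|].
have [s hs] := imag_pair fe13 b1b1' h3.
have [t ht] := imag_pair fe23 b2b2' h3.
have [u3 u3E] : exists u3, u3 = v3 + (s / 2) *: b1 + (t / 2) *: b2 by eexists.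
have fu3 : fr4 e b1 b2 u3.
  move=> x y z w h; have [|x0 k k' w0] := fc3 x (y + w * (s / 2)) (z + w * (t / 2)) w.
    by rewrite -h u3E; vec.
  by split=> //; [move: k|move: k']; rewrite w0 mul0r addr0.
have hu3 : H u3 u3 = (q3 + s ^+ 2 / 4 + t ^+ 2 / 4) *: e.
  transitivity (H v3 v3 + (s / 2) *: (H b1 v3 + H v3 b1) + (t / 2) *: (H b2 v3 + H v3 b2)
     + (s / 2) ^+ 2 *: H b1 b1 + (t / 2) ^+ 2 *: H b2 b2 + (s * t / 4) *: (H b1 b2 + H b2 b1)).
    by rewrite u3E !HE; vecf.
  by rewrite h3 hs ht a12 b1b1 b2b2; vecf.
have a13 : H b1 u3 + H u3 b1 = 0.
  transitivity (H b1 v3 + H v3 b1 + s *: H b1 b1 + (t / 2) *: (H b1 b2 + H b2 b1)).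
    by rewrite u3E !HE; vecf.
  by rewrite hs b1b1 a12; vec.
have a23 : H b2 u3 + H u3 b2 = 0.
  transitivity (H b2 v3 + H v3 b2 + t *: H b2 b2 + (s / 2) *: (H b1 b2 + H b2 b1)).
    by rewrite u3E !HE; vecf.
  by rewrite ht b2b2 a12; vec.
have feu3 : fr2 e u3.
  by move=> x y h; have [] := fu3 x 0 0 y; [rewrite -h; vec|].
have [k3 [k30 b3b3]] := imag_unit (sqr_neg feu3 hu3) hu3.
exists b1, b2, (k3 *: u3); split.
- move=> x y z w h; have [|-> -> -> /eqP] := fu3 x y z (w * k3); first by rewrite -h; vec.
  by rewrite mulf_eq0 (negPf k30) orbF => /eqP.
- by split.
- split.
  + by apply/eqP; rewrite -addr_eq0 addrC a12.
  + by apply/eqP; rewrite -addr_eq0 addrC !HE -scalerDr a13 scaler0.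
  + by apply/eqP; rewrite -addr_eq0 addrC !HE -scalerDr a23 scaler0.
Qed.

End Basis.

Definition Phi e b1 b2 b3 (p : R * vec3 R) : V :=
  p.1 *: e + p.2 0 0 *: b1 + p.2 1 0 *: b2 + p.2 2 0 *: b3.

Lemma ex_model (p : V -> V -> V)
  (pDl : forall x y z, p (x + y) z = p x z + p y z)
  (pDr : forall x y z, p x (y + z) = p x y + p x z)
  (pZl : forall a x y, p (a *: x) y = a *: p x y)
  (pZr : forall a x y, p x (a *: y) = a *: p x y)
  (pnz : forall x y, p x y = 0 -> x = 0 \/ y = 0)
  (hpc : forall a x y,
    (forall U, subalg p U -> a \in U -> x \in U) ->
    (forall U, subalg p U -> a \in U -> y \in U) -> p x y = p y x) :
  exists (e b1 b2 b3 : V) (x : vec3 R) (M : 'M[R]_3) (z : vec3 R) (l : R), [/\ fr4 e b1 b2 b3, l != 0 & forall r s,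
    p (Phi e b1 b2 b3 r) (Phi e b1 b2 b3 s) =
    Phi e b1 b2 b3 (Gmul x M z l r s)].
Proof.
have [e [e0 ee com sq pe]] := ex_central_idem n4 pDl pDr pZl pZr pnz hpc.
have [l l0 hl] := ex_scale n4 pDr pZr pnz e0 ee pe.
pose r := leftdiv p e.
have pr x : p e (r x) = x by apply: leftdivK => //.
have rp x : r (p e x) = x by apply: leftmulK => //.
have rin x : in2 e x (r x).
  have [c hc] := hl (r x); rewrite pr in hc.
  by exists (- c / l), l^-1; rewrite {2}hc; vecf.
(* The isotope with unit [e]. It stays quadratic because division by [e] maps [x] into the span of
   [e] and [x]. *)
pose H x y := p (r x) (r y).
have HDl x y z : H (x + y) z = H x z + H y z by rewrite /H linearD pDl.
have HDr x y z : H x (y + z) = H x y + H x z by rewrite /H linearD pDr.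
have HZl a x y : H (a *: x) y = a *: H x y by rewrite /H linearZ pZl.
have HZr a x y : H x (a *: y) = a *: H x y by rewrite /H linearZ pZr.
have r0 x : r x = 0 -> x = 0 by move=> h; rewrite -(pr x) h (p0r pDr).
have Hnz x y : H x y = 0 -> x = 0 \/ y = 0.
  by move=> /pnz[] /r0; [left|right].
have re : r e = e by rewrite -{2}(rp e) ee.
have eH x : H e x = x by rewrite /H re pr.
have He x : H x e = x by rewrite /H re -com pr.
have Hsq x : in2 e x (H x x).
  by apply: in2_trans (sq (r x)); [exact: in2_l|exact: rin].
have [b1 [b2 [b3 [f [h11 h22 h33] [h21 h31 h32]]]]] :=
  ex_orthonormal HDl HDr HZl HZr Hnz e0 eH He Hsq.
(* The cross product sends these three pairs to the standard basis, so the products are the columns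
   of [M] and their [e]-components the entries of the vector [x]. *)
have [x1 [m11 [m21 [m31 h23]]]] := fr4_span n4 f (H b2 b3).
have [x2 [m12 [m22 [m32 k31]]]] := fr4_span n4 f (H b3 b1).
have [x3 [m13 [m23 [m33 h12]]]] := fr4_span n4 f (H b1 b2).
have h13 : H b1 b3 = - H b3 b1 by rewrite h31 opprK.
have [z1 hz1] := hl b1; have [z2 hz2] := hl b2; have [z3 hz3] := hl b3.
exists e, b1, b2, b3, (mkvec x1 x2 x3), (mx3 m11 m12 m13 m21 m22 m23 m31 m32 m33).
exists (mkvec z1 z2 z3), l; split=> // -[a u] [b v].
have pH x y : p x y = H (p e x) (p e y) by rewrite /H !rp.
have hPhi c (w : vec3 R) : p e (Phi e b1 b2 b3 (c, w)) =
   Phi e b1 b2 b3 (c + dot (mkvec z1 z2 z3) w, l *: w).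
  by rewrite /Phi /= !pDr !pZr ee hz1 hz2 hz3 dotE !mkvecE; vec.
rewrite pH !hPhi /Phi /= !(HDl, HDr, HZl, HZr, eH, He) h11 h22 h33 h21 h32 h13 h23 k31 h12.
rewrite /Gmul /=.
have -> : dot (mkvec x1 x2 x3) (cross u v) =
  x1 * (u 1 0 * v 2 0 - u 2 0 * v 1 0) + x2 * (u 2 0 * v 0 0 - u 0 0 * v 2 0)
  + x3 * (u 0 0 * v 1 0 - u 1 0 * v 0 0) by rewrite dotE !mkvecE ?crossE.
rewrite (dotE u v); move: (dot _ u) (dot _ v) => su sv.
have E (i : 'I_3) : ((l * (a + su)) *: v + (l * (b + sv)) *: u + l ^+ 2 *:
   (mx3 m11 m12 m13 m21 m22 m23 m31 m32 m33 *m cross u v)) i 0 =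
  l * (a + su) * v i 0 + l * (b + sv) * u i 0 + l ^+ 2 *
   (mx3 m11 m12 m13 m21 m22 m23 m31 m32 m33 *m cross u v) i 0.
  by do 3!rewrite mxE; congr (_ + _ + _); rewrite mxE.
have E' (i : 'I_3) (w : vec3 R) : (l *: w) i 0 = l * w i 0 by rewrite mxE.
rewrite !E !E' !mulmx3E !mx3E !crossE.
move: (u 0 0) (u 1 0) (u 2 0) (v 0 0) (v 1 0) (v 2 0) => u0 u1 u2 v0 v1 v2.
vec.
Qed.

End Quadratic.

(** * Rotations *)

Section Geometry.
Context (R : realType).
Implicit Types (u v w x z : vec3 R) (M A B phi : 'M[R]_3).

Lemma det2E (A : 'M[R]_2) : \det A = A 0 0 * A 1 1 - A 0 1 * A 1 0.
Proof.
rewrite (expand_det_row A 0) !big_ord_recl big_ord0 addr0 /cofactor !det_mx11 !mxE /=.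
have l0 : lift (0 : 'I_2) (0 : 'I_1) = 1 by exact: val_inj.
have l1 : lift (1 : 'I_2) (0 : 'I_1) = 0 by exact: val_inj.
by rewrite l0 l1; ring.
Qed.

Lemma det3E A : \det A =
  A 0 0 * (A 1 1 * A 2 2 - A 1 2 * A 2 1)
  - A 0 1 * (A 1 0 * A 2 2 - A 1 2 * A 2 0)
  + A 0 2 * (A 1 0 * A 2 1 - A 1 1 * A 2 0).
Proof.
rewrite (expand_det_row A 0) sum3 /cofactor !det2E !mxE.
have l00 : lift (0 : 'I_3) (0 : 'I_2) = 1 by exact: val_inj.
have l01 : lift (0 : 'I_3) (1 : 'I_2) = 2 by exact: val_inj.
have l10 : lift (1 : 'I_3) (0 : 'I_2) = 0 by exact: val_inj.
have l11 : lift (1 : 'I_3) (1 : 'I_2) = 2 by exact: val_inj.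
have l20 : lift (2 : 'I_3) (0 : 'I_2) = 0 by exact: val_inj.
have l21 : lift (2 : 'I_3) (1 : 'I_2) = 1 by exact: val_inj.
by rewrite l00 l01 l10 l11 l20 l21 /=; ring.
Qed.

Lemma mul3v M u i : (M *m u) i 0 = M i 0 * u 0 0 + M i 1 * u 1 0 + M i 2 * u 2 0.
Proof. exact: mulmx3E. Qed.

Lemma trmxE M i j : M^T i j = M j i. Proof. by rewrite mxE. Qed.
Lemma scale_col (a : R) u i : (a *: u) i 0 = a * u i 0.
Proof. by rewrite mxE. Qed.
Lemma add_col u v i : (u + v) i 0 = u i 0 + v i 0.
Proof. by rewrite mxE. Qed.

Lemma dot_mulmx M u v : dot u (M *m v) = dot (M^T *m u) v.
Proof. by rewrite !dotE !mul3v !mxE; ring. Qed.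

Lemma cross_mulmx M u v : M^T *m cross (M *m u) (M *m v) = \det M *: cross u v.
Proof.
by apply: vec3P; rewrite scale_col !mul3v !crossE !mul3v !trmxE det3E; ring.
Qed.

Lemma dotZl a u v : dot (a *: u) v = a * dot u v.
Proof. by rewrite !dotE !mxE; ring. Qed.
Lemma dotZr a u v : dot u (a *: v) = a * dot u v.
Proof. by rewrite !dotE !mxE; ring. Qed.
Lemma dotDl' u v w : dot (u + v) w = dot u w + dot v w.
Proof. by rewrite !dotE !mxE; ring. Qed.
Lemma dotDr' u v w : dot w (u + v) = dot w u + dot w v.
Proof. by rewrite !dotE !mxE; ring. Qed.

Lemma dot_gt0 u : u != 0 -> 0 < dot u u.
Proof.
move=> u0; rewrite lt0r; apply/andP; split; last first.
  by rewrite dotE -!expr2 !addr_ge0 ?sqr_ge0.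
apply: contra u0 => /eqP; rewrite dotE -!expr2 => h.
have s0 := sqr_ge0 (u 0 0); have s1 := sqr_ge0 (u 1 0); have s2 := sqr_ge0 (u 2 0).
by apply/eqP; apply: vec3P; rewrite mxE; apply/eqP; rewrite -sqrf_eq0; apply/eqP; lra.
Qed.

Lemma orthogonalE phi : phi^T *m phi = 1%:M -> phi *m phi^T = 1%:M.
Proof. exact: mulmx1C. Qed.

Lemma cross_orthogonal phi u v : phi^T *m phi = 1%:M ->
  cross (phi *m u) (phi *m v) = \det phi *: (phi *m cross u v).
Proof.
move=> /orthogonalE h.
by rewrite scalemxAr -cross_mulmx mulmxA h mul1mx.
Qed.

Lemma dot_orthogonal phi u v : phi^T *m phi = 1%:M ->
  dot (phi *m u) (phi *m v) = dot u v.
Proof. by move=> h; rewrite dot_mulmx mulmxA h mul1mx. Qed.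

(** The cross product acquires the factor [\det phi], whence the sign on [x] and [M]. Determinant -1
    is allowed since [ex_normal] uses it. *)
Lemma Gmul_orthogonal x M z l phi (p q : R * vec3 R) : phi^T *m phi = 1%:M ->
  Gmul (\det phi *: (phi *m x)) (\det phi *: (phi *m M *m phi^T)) (phi *m z) l
    (p.1, phi *m p.2) (q.1, phi *m q.2) =
  ((Gmul x M z l p q).1, phi *m (Gmul x M z l p q).2).
Proof.
move=> h; set d := \det phi; have dd : d * d = 1.
  by rewrite /d -{1}det_tr -det_mulmx h det1.
rewrite /Gmul /= cross_orthogonal // -/d !dot_orthogonal //.
congr pair.
  have -> : dot (d *: (phi *m x)) (d *: (phi *m cross p.2 q.2)) = dot x (cross p.2 q.2).
    by rewrite dotZl dotZr mulrA dd mul1r dot_orthogonal.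
  by [].
rewrite !mulmxDr -!scalemxAr -scalemxAl scalerA dd scale1r.
by rewrite !mulmxA -(mulmxA _ phi^T) h mulmx1.
Qed.

Lemma SO3_mul phi psi : SO3 phi -> SO3 psi -> SO3 (phi *m psi).
Proof.
move=> [h1 d1] [h2 d2]; split; last by rewrite det_mulmx d1 d2 mulr1.
by rewrite trmx_mul mulmxA -(mulmxA _ _ phi) h1 mulmx1.
Qed.

Lemma SO3_1 : SO3 (1%:M : 'M[R]_3).
Proof. by split; rewrite ?det1 // trmx1 mul1mx. Qed.

Definition rot1 (c s : R) := mx3 1 0 0 0 c s 0 (- s) c.
Definition rot2 (c s : R) := mx3 c 0 s 0 1 0 (- s) 0 c.
Definition rot3 (c s : R) := mx3 c s 0 (- s) c 0 0 0 1.

Lemma SO3_of_entries A :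
  A 0 0 * A 0 0 + A 1 0 * A 1 0 + A 2 0 * A 2 0 = 1 ->
  A 0 1 * A 0 1 + A 1 1 * A 1 1 + A 2 1 * A 2 1 = 1 ->
  A 0 2 * A 0 2 + A 1 2 * A 1 2 + A 2 2 * A 2 2 = 1 ->
  A 0 0 * A 0 1 + A 1 0 * A 1 1 + A 2 0 * A 2 1 = 0 ->
  A 0 0 * A 0 2 + A 1 0 * A 1 2 + A 2 0 * A 2 2 = 0 ->
  A 0 1 * A 0 2 + A 1 1 * A 1 2 + A 2 1 * A 2 2 = 0 ->
  \det A = 1 -> SO3 A.
Proof.
move=> h1 h2 h3 h4 h5 h6 hd; split=> //.
by apply: mat3P; rewrite mulmx3E !trmxE [RHS]mxE /=; lra.
Qed.

Lemma SO3_rot1 c s : c ^+ 2 + s ^+ 2 = 1 -> SO3 (rot1 c s).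
Proof.
by move=> h; apply: SO3_of_entries; rewrite ?det3E !mx3E; lra.
Qed.
Lemma SO3_rot2 c s : c ^+ 2 + s ^+ 2 = 1 -> SO3 (rot2 c s).
Proof.
by move=> h; apply: SO3_of_entries; rewrite ?det3E !mx3E; lra.
Qed.
Lemma SO3_rot3 c s : c ^+ 2 + s ^+ 2 = 1 -> SO3 (rot3 c s).
Proof.
by move=> h; apply: SO3_of_entries; rewrite ?det3E !mx3E; lra.
Qed.

Lemma plane_rotation (a b : R) : exists c s : R,
  [/\ c ^+ 2 + s ^+ 2 = 1, 0 <= c * a + s * b & - s * a + c * b = 0].
Proof.
have [/eqP|h0] := eqVneq (a ^+ 2 + b ^+ 2) 0.
  rewrite paddr_eq0 ?sqr_ge0 // !sqrf_eq0 => /andP[/eqP -> /eqP ->].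
  by exists 1, 0; split; rewrite ?expr1n ?expr0n /= ?mulr0 ?addr0.
have h1 : 0 < a ^+ 2 + b ^+ 2 by rewrite lt0r h0 addr_ge0 ?sqr_ge0.
pose r := Num.sqrt (a ^+ 2 + b ^+ 2).
have r0 : 0 < r by rewrite sqrtr_gt0.
have rr : r ^+ 2 = a ^+ 2 + b ^+ 2 by rewrite sqr_sqrtr // ltW.
have r1 := lt0r_neq0 r0.
exists (a / r), (b / r); split.
- by rewrite !expr_div_n -mulrDl -rr divff // expf_neq0.
- have -> : a / r * a + b / r * b = (a ^+ 2 + b ^+ 2) / r by field.
  by rewrite divr_ge0 // ltW.
- by field.
Qed.

Lemma rotate_to_axis u : exists phi, SO3 phi /\
  exists2 r, 0 <= r & phi *m u = mkvec r 0 0.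
Proof.
have [c [s [h1 h2 h3]]] := plane_rotation (u 1 0) (u 2 0).
have [c' [s' [k1 k2 k3]]] := plane_rotation (u 0 0) (c * u 1 0 + s * u 2 0).
exists (rot3 c' s' *m rot1 c s); split.
  by apply: SO3_mul; [exact: SO3_rot3|exact: SO3_rot1].
exists (c' * u 0 0 + s' * (c * u 1 0 + s * u 2 0)) => //.
rewrite -mulmxA; apply: vec3P; rewrite !mul3v !mx3E !mkvecE.
- by ring.
- by lra.
- by lra.
Qed.

End Geometry.

(** * Diagonalisation of the symmetric part *)

Section Spectral.
Context (R : realType).
Implicit Types (u v w x z : vec3 R) (M A B S phi : 'M[R]_3).

Definition conj3 phi S := phi *m S *m phi^T.

Lemma conj3M phi psi S : conj3 phi (conj3 psi S) = conj3 (phi *m psi) S.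
Proof. by rewrite /conj3 trmx_mul !mulmxA. Qed.

Lemma conj3E phi S i j : conj3 phi S i j =
  (phi i 0 * S 0 0 + phi i 1 * S 1 0 + phi i 2 * S 2 0) * phi j 0
  + (phi i 0 * S 0 1 + phi i 1 * S 1 1 + phi i 2 * S 2 1) * phi j 1
  + (phi i 0 * S 0 2 + phi i 1 * S 1 2 + phi i 2 * S 2 2) * phi j 2.
Proof. by rewrite /conj3 mulmx3E !mulmx3E !trmxE. Qed.

Lemma conj3_tr phi S : S^T = S -> (conj3 phi S)^T = conj3 phi S.
Proof. by move=> h; rewrite /conj3 !trmx_mul trmxK h mulmxA. Qed.

Lemma real_eigenvector S : exists a u, u != 0 /\ S *m u = a *: u.
Proof.
have sp : ~~ odd (size (char_poly S^T)) by rewrite size_char_poly.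
have [a] := odd_poly_root sp.
rewrite -eigenvalue_root_char => /eigenvalueP[v h v0].
exists a, v^T; split; first by rewrite trmx_eq0.
have <- : (v *m S^T)^T = S *m v^T by rewrite trmx_mul trmxK.
by rewrite h linearZ.
Qed.

Lemma rotate2 (p q r : R) : exists c t : R,
  c ^+ 2 + t ^+ 2 = 1 /\ (r - p) * c * t + q * (c ^+ 2 - t ^+ 2) = 0.
Proof.
have [->|q0] := eqVneq q 0.
  by exists 1, 0; split; ring.
pose D := (r - p) ^+ 2 + 4 * q ^+ 2.
have D0 : 0 <= D by apply: addr_ge0; [exact: sqr_ge0|apply: mulr_ge0; [exact: ler0n|exact: sqr_ge0]].
have DD := sqr_sqrtr D0; rewrite {2}/D in DD.
(* The tangent of the angle, a root of [q k^2 - (r - p) k - q = 0]. *)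
pose k := (r - p + Num.sqrt D) / (2 * q).
have hk : (r - p) * k + q * (1 - k ^+ 2) = 0.
  transitivity ((4 * q ^+ 2 + (r - p) ^+ 2 - Num.sqrt D ^+ 2) / (4 * q)).
    by rewrite /k; field.
  by rewrite DD; field.
have k1 : 0 < 1 + k ^+ 2 by rewrite ltr_pwDl // sqr_ge0.
have s0 : Num.sqrt (1 + k ^+ 2) != 0 by rewrite gt_eqF // sqrtr_gt0.
have ss : Num.sqrt (1 + k ^+ 2) ^+ 2 = 1 + k ^+ 2 by rewrite sqr_sqrtr // ltW.
move: (Num.sqrt (1 + k ^+ 2)) s0 ss => s s0 ss.
exists s^-1, (k / s); split.
  transitivity ((1 + k ^+ 2) / s ^+ 2); first by field.
  by rewrite ss divff // gt_eqF.
transitivity (((r - p) * k + q * (1 - k ^+ 2)) / s ^+ 2); first by field.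
by rewrite hk mul0r.
Qed.

Lemma deltaE (a b c : R) : delta (mkvec a b c) = mx3 a 0 0 0 b 0 0 0 c.
Proof. by rewrite /delta !mkvecE. Qed.

Lemma spectral S : S^T = S -> exists phi (d : vec3 R),
  [/\ SO3 phi, d 0 0 <= d 1 0 <= d 2 0 & conj3 phi S = delta d].
Proof.
move=> symS.
pose P a b c := exists2 phi, SO3 phi & conj3 phi S = delta (mkvec a b c).
(* Quarter turns permute the eigenvalues without leaving [SO3], which is how they get sorted. *)
have swap12 a b c : P a b c -> P b a c.
  move=> [phi hphi h]; exists (rot3 0 1 *m phi).
    by apply: SO3_mul => //; apply: SO3_rot3; ring.
  by rewrite -conj3M h; apply: mat3P; rewrite conj3E !deltaE !mx3E; ring.
have swap23 a b c : P a b c -> P a c b.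
  move=> [phi hphi h]; exists (rot1 0 1 *m phi).
    by apply: SO3_mul => //; apply: SO3_rot1; ring.
  by rewrite -conj3M h; apply: mat3P; rewrite conj3E !deltaE !mx3E; ring.
suff [a [b [c]]] : exists a b c, P a b c.
  move=> h; suff [a' [b' [c' [[phi h1 h2] h3]]]] :
      exists a' b' c', P a' b' c' /\ a' <= b' <= c'.
    by exists phi, (mkvec a' b' c'); rewrite !mkvecE.
  case: (leP a b) => ab; case: (leP b c) => bc; case: (leP a c) => ac.
  - by exists a, b, c; rewrite ab bc.
  - by have := le_lt_trans (le_trans ab bc) ac; rewrite ltxx.
  - by exists a, c, b; split; [exact: swap23|rewrite ac ltW].
  - by exists c, a, b; split; [exact/swap12/swap23|rewrite ab ltW].
  - by exists b, a, c; split; [exact: swap12|rewrite ac ltW].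
  - by exists b, c, a; split; [exact/swap23/swap12|rewrite bc ltW].
  - by have := lt_le_trans (lt_trans bc ab) ac; rewrite ltxx.
  - by exists c, b, a; split; [exact/swap12/swap23/swap12|rewrite !ltW].
have [s [u [u0 hu]]] := real_eigenvector S.
have [phi [hphi [r r0 hr]]] := rotate_to_axis u.
have phiu : u = phi^T *m mkvec r 0 0 by rewrite -hr mulmxA hphi.1 mul1mx.
have r1 : r != 0.
  apply: contra u0 => /eqP r1; rewrite phiu r1 (_ : mkvec 0 0 0 = 0) ?mulmx0 //.
  by apply: vec3P; rewrite mkvecE mxE.
pose S' := conj3 phi S.
have symS' : S'^T = S' by exact: conj3_tr.
have colS' : S' *m mkvec r 0 0 = s *: mkvec r 0 0.
  rewrite -hr /S' /conj3 mulmxA -(mulmxA _ _ phi) hphi.1 mulmx1.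
  by rewrite -mulmxA hu -scalemxAr.
have col i : S' i 0 = s * (i == 0)%:R.
  apply: (mulIf r1); have := congr1 (fun w : vec3 R => w i 0) colS'.
  rewrite /= mul3v scale_col !mkvecE !mulr0 !addr0 => ->.
  rewrite -mulrA; congr (_ * _).
  by elim/forall3: i; rewrite !mkvecE /= ?mul1r ?mul0r.
have S10 := col 1; have S20 := col 2; rewrite /= mulr0 in S10 S20.
have S01 : S' 0 1 = 0 by rewrite -symS' trmxE.
have S02 : S' 0 2 = 0 by rewrite -symS' trmxE.
have S21 : S' 2 1 = S' 1 2 by rewrite -[in LHS]symS' trmxE.
have [c [t [ct h]]] := rotate2 (S' 1 1) (S' 1 2) (S' 2 2).
exists (S' 0 0), (conj3 (rot1 c t) S' 1 1), (conj3 (rot1 c t) S' 2 2).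
exists (rot1 c t *m phi); first by apply: SO3_mul => //; exact: SO3_rot1.
rewrite -conj3M -/S' deltaE; apply: mat3P; rewrite !mx3E // conj3E !mx3E S01 S02 S10 S20 S21.
- by ring.
- by ring.
- by ring.
- by ring.
- by rewrite -[RHS]h; ring.
- by ring.
- by rewrite -[RHS]h; ring.
Qed.

Lemma quad_vec (a b : R) u v M : dot (a *: u + b *: v) (M *m (a *: u + b *: v)) =
  a ^+ 2 * dot u (M *m u) + a * b * (dot u (M *m v) + dot v (M *m u))
  + b ^+ 2 * dot v (M *m v).
Proof.
by rewrite !dotE !mul3v !add_col !scale_col; ring.
Qed.

(** If [u] and [v] gave opposite signs, the quadratic polynomial of values at [u + t v] would have a
    real root. *)
Lemma anisotropic_sign M : (forall w, w != 0 -> dot w (M *m w) != 0) ->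
  (forall w, w != 0 -> 0 < dot w (M *m w)) \/
  (forall w, w != 0 -> dot w (M *m w) < 0).
Proof.
move=> h.
have key u v : u != 0 -> v != 0 -> 0 < dot u (M *m u) -> 0 < dot v (M *m v).
  move=> u0 v0 hu; rewrite lt0r h //= leNgt; apply/negP => hv.
  pose A := dot v (M *m v); pose B := dot u (M *m v) + dot v (M *m u).
  pose C := dot u (M *m u).
  pose D := B ^+ 2 - 4 * A * C.
  have D0 : 0 <= D.
    have : 0 <= - A * C.
      by apply: mulr_ge0; [rewrite oppr_ge0|]; apply: ltW.
    by have := sqr_ge0 B; rewrite /D; lra.
  have DD := sqr_sqrtr D0; rewrite {2}/D in DD.
  have A0 : A != 0 by rewrite lt_eqF.
  pose t := (- B + Num.sqrt D) / (2 * A).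
  have ht : dot (1 *: u + t *: v) (M *m (1 *: u + t *: v)) = 0.
    rewrite quad_vec -/A -/B -/C.
    transitivity ((Num.sqrt D ^+ 2 - (B ^+ 2 - 4 * A * C)) / (4 * A)).
      by rewrite /t; field.
    by rewrite DD subrr mul0r.
  have [e|e] := eqVneq (1 *: u + t *: v) 0; last by have := h _ e; rewrite ht eqxx.
  have uE : u = 0 *: u + (- t) *: v.
    by rewrite -[LHS]scale1r -[LHS](addrK (t *: v)) e sub0r scale0r add0r scaleNr.
  move: hu; rewrite uE quad_vec.
  have : (- t) ^+ 2 * dot v (M *m v) <= 0 by rewrite mulr_ge0_le0 ?sqr_ge0 // ltW.
  by rewrite expr0n /= !mul0r !add0r => h1 /lt_le_trans /(_ h1); rewrite ltxx.
pose e1 : vec3 R := mkvec 1 0 0.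
have e10 : e1 != 0.
  by apply/eqP => /(congr1 (fun w : vec3 R => w 0 0)); rewrite /= mkvecE mxE => /eqP; rewrite oner_eq0.
case: (ltrP 0 (dot e1 (M *m e1))) => he; [left|right] => w w0.
  exact: key e10 w0 he.
rewrite lt_neqAle h //= leNgt; apply/negP => hw.
by have := key _ _ w0 e10 hw; rewrite ltNge he.
Qed.

Lemma ex_normal M : (forall w, w != 0 -> dot w (M *m w) != 0) ->
  exists phi (y d : vec3 R), [/\ phi^T *m phi = 1%:M, calT d &
    \det phi *: conj3 phi M = epsilon y + delta d].
Proof.
move=> /anisotropic_sign hM.
suff pos N : (forall w, w != 0 -> 0 < dot w (N *m w)) -> exists phi (y d : vec3 R),
   [/\ SO3 phi, calT d & conj3 phi N = epsilon y + delta d].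
  case: hM => hM.
    have [phi [y [d [[h1 h2] h3 h4]]]] := pos M hM.
    by exists phi, y, d; split=> //; rewrite h2 scale1r.
  have trN A : (- A)^T = - A^T by apply/matrixP => i j; rewrite !mxE.
  have [|phi [y [d [[h1 h2] h3 h4]]]] := pos (- M).
    by move=> w w0; rewrite mulNmx -scaleN1r dotZr mulN1r oppr_gt0 hM.
  (* Conjugation by [- phi] and by [phi] agree; only the determinant in front changes, and it turns
     a negative form into a positive one. *)
  exists (- phi), y, d; split=> //.
    by rewrite trN mulNmx mulmxN opprK.
  have -> : \det (- phi) = -1 by rewrite -scaleN1r detZ h2; ring.
  by rewrite -h4 /conj3 trN !(mulNmx, mulmxN) opprK scaleN1r.
move=> {M hM} posN.
(* This is twice the symmetric part, hence the factor [2^-1] on [d] below. *)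
have symN : (N + N^T)^T = N + N^T by rewrite linearD /= trmxK addrC.
have [phi [d [hphi dd hd]]] := spectral symN.
pose N' := conj3 phi N.
have hN' i j : N' i j + N' j i = delta d i j.
  rewrite -hd /conj3 mulmxDr mulmxDl [RHS]mxE; congr (_ + _).
  have <- : (conj3 phi N)^T = phi *m N^T *m phi^T.
    by rewrite /conj3 !trmx_mul trmxK mulmxA.
  by rewrite trmxE.
have pos' w : w != 0 -> 0 < dot w (N' *m w).
  move=> w0; rewrite /N' /conj3 -!mulmxA dot_mulmx; apply: posN.
  apply: contra w0 => /eqP h.
  by rewrite -[w]mul1mx -(orthogonalE hphi.1) -mulmxA h mulmx0.
exists phi, (mkvec (N' 2 1) (N' 0 2) (N' 1 0)), (2^-1 *: d); split=> //.
  have d0 : 0 < d 0 0.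
    have := pos' (mkvec 1 0 0).
    rewrite dotE !mul3v !mkvecE => h.
    have := hN' 0 0; rewrite /delta mx3E => <-.
    have {}h : 0 < 1 * (N' 0 0 * 1 + N' 0 1 * 0 + N' 0 2 * 0) + 0 * (N' 1 0 * 1 + N' 1 1 * 0 + N' 1 2 * 0) + 0 * (N' 2 0 * 1 + N' 2 1 * 0 + N' 2 2 * 0).
      apply: h; apply/eqP => /(congr1 (fun w : vec3 R => w 0 0)).
      by rewrite /= mkvecE mxE => /eqP; rewrite oner_eq0.
    lra.
  case/andP: dd => d1 d2; split; rewrite !scale_col; first by lra.
  by apply/andP; split; lra.
have h00 := hN' 0 0; have h01 := hN' 0 1; have h02 := hN' 0 2.
have h11 := hN' 1 1; have h12 := hN' 1 2; have h22 := hN' 2 2.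
rewrite /delta !mx3E in h00 h01 h02 h11 h12 h22.
have addE (A B : 'M[R]_3) i j : (A + B) i j = A i j + B i j by rewrite mxE.
rewrite -/N'; apply: mat3P; rewrite addE /epsilon /delta !mx3E ?scale_col ?mkvecE; lra.
Qed.

End Spectral.

(** * From an abstract algebra to a member of the family *)

Section Model.
Context (R : realType).
Implicit Types (A B : algebra R) (x y z d u v w : vec3 R) (M : 'M[R]_3).

Definition mklin (U V : lmodType R) (f : U -> V) (h : linear f) :
  {linear U -> V} := HB.pack f (GRing.isLinear.Build R U V *:%R f h).

Lemma isomorphic_sym A B : isomorphic A B -> isomorphic B A.
Proof.
move=> [f [[g fg gf] fM]].
have lg : linear g.
  by move=> a u v; apply: (can_inj fg); rewrite linearP !gf.
exists (mklin lg); split; first by exists f.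
by move=> u v /=; apply: (can_inj fg); rewrite fM !gf.
Qed.

Lemma isomorphic_trans A B C : isomorphic A B -> isomorphic B C -> isomorphic A C.
Proof.
move=> [f [bf fM]] [g [bg gM]].
have lgf : linear (g \o f) by move=> a u v /=; rewrite !linearP.
exists (mklin lgf); split; first exact: bij_comp.
by move=> u v /=; rewrite fM gM.
Qed.

Lemma xi_cross x u v : xi x u v = dot x (cross u v).
Proof.
by rewrite /xi !dotE !crossE !mul3v /epsilon !mx3E; ring.
Qed.

Lemma Falg_mul x y z d l (p q : Falg (x, y, z, d, l)) :
  amul p q = Gmul x (epsilon y + delta d) z l p q.
Proof.
case: p q => [a u] [b v]; rewrite /Gmul /= xi_cross /eta /sigma.
by [].
Qed.

Lemma dot0l u : dot 0 u = 0.
Proof. by rewrite dotE !mxE; ring. Qed.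
Lemma dot0r u : dot u 0 = 0.
Proof. by rewrite dotE !mxE; ring. Qed.

Section Anisotropy.
Context (x z : vec3 R) (M : 'M[R]_3) (l : R).

(* The product of the quadratic algebra of which [Gmul x M z l] is an isotope;
   see [GmulE]. *)
Definition Kmul (p q : R * vec3 R) : R * vec3 R :=
  (p.1 * q.1 + dot x (cross p.2 q.2) - dot p.2 q.2,
   p.1 *: q.2 + q.1 *: p.2 + M *m cross p.2 q.2).

(** Multiplication by the idempotent [(1, 0)] on either side, by [Falg_unit] and [Falg_unitr]. *)
Definition hmap (p : R * vec3 R) : R * vec3 R := (p.1 + dot z p.2, l *: p.2).

Lemma crossZ (a b : R) u v : cross (a *: u) (b *: v) = (a * b) *: cross u v.
Proof. by apply: vec3P; rewrite scale_col !crossE !scale_col; ring. Qed.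

Lemma GmulE p q : Gmul x M z l p q = Kmul (hmap p) (hmap q).
Proof.
rewrite /Gmul /Kmul /hmap /= crossZ !dotZr dotZl -scalemxAr -expr2 !scalerA.
congr pair; first by ring.
by rewrite (mulrC (_ + _) l) (mulrC (_ + _) l).
Qed.

Lemma hmap_inj p q : l != 0 -> hmap p = hmap q -> p = q.
Proof.
case: p q => [a u] [b v] l0 [h1 /(scalerI l0) uv].
by rewrite uv in h1 *; move/addIr: h1 => ->.
Qed.

Lemma hmap_surj p : l != 0 -> exists q, hmap q = p.
Proof.
case: p => a u l0; exists (a - dot z (l^-1 *: u), l^-1 *: u).
by rewrite /hmap /= subrK scalerA divff // scale1r.
Qed.

Lemma ex_orthogonal w : w != 0 -> exists2 u, u != 0 & dot u w = 0.
Proof.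
move=> w0; have [h|h] := eqVneq (mkvec (- w 1 0) (w 0 0) 0) 0.
  have h0 := congr1 (fun u : vec3 R => u 0 0) h.
  have h1 := congr1 (fun u : vec3 R => u 1 0) h.
  rewrite /= mkvecE mxE in h0; rewrite /= mkvecE mxE in h1.
  exists (mkvec 1 0 0); last by rewrite dotE !mkvecE h1; ring.
  apply/eqP => /(congr1 (fun w : vec3 R => w 0 0)).
  by rewrite /= mkvecE mxE => /eqP; rewrite oner_eq0.
by exists (mkvec (- w 1 0) (w 0 0) 0) => //; rewrite dotE !mkvecE; ring.
Qed.

Lemma triple_cross u w : cross u (cross w u) = dot u u *: w - dot u w *: u.
Proof.
by apply: vec3P; rewrite add_col !crossE -scaleNr !scale_col !dotE; ring.
Qed.

Lemma cross_cross u v w : cross (cross u v) w = dot u w *: v - dot v w *: u.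
Proof.
by apply: vec3P; rewrite add_col !crossE -scaleNr !scale_col !dotE; ring.
Qed.

Lemma orthogonal_decomp u v w : w != 0 -> dot u w = 0 -> dot v w = 0 ->
  dot u u *: v = dot u v *: u + (dot (cross w u) v / dot w w) *: cross w u.
Proof.
move=> w0 uw vw; have ww := lt0r_neq0 (dot_gt0 w0).
have h1 : dot w w *: cross v u = dot w (cross v u) *: w.
  apply/eqP; rewrite -subr_eq0 -triple_cross cross_cross vw uw !scale0r subrr.
  by apply/eqP; apply: vec3P; rewrite crossE !mxE; ring.
have h2 := triple_cross u v.
have h3 : cross v u = (dot w (cross v u) / dot w w) *: w.
  by rewrite mulrC -scalerA -h1 scalerA mulVf // scale1r.
have h4 (c : R) : cross u (c *: w) = (- c) *: cross w u.
  by apply: vec3P; rewrite scale_col !crossE !scale_col; ring.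
have h5 : dot (cross w u) v = - dot w (cross v u).
  by rewrite !dotE !crossE; ring.
by rewrite h5 mulNr -h4 -h3 h2 addrC subrK.
Qed.

(** For an isotropic [w] choose [u], [v] with [cross u v] proportional to [w]. Then [M *m cross u v]
    is orthogonal to [w], hence a combination of [u] and [v], and suitable scalar parts cancel
    it. *)
Lemma anisotropic_of_division :
  (forall p q, Kmul p q = 0 -> p = 0 \/ q = 0) ->
  forall w, w != 0 -> dot w (M *m w) != 0.
Proof.
move=> nzd w w0; apply/eqP => Mw.
have [u u0 uw] := ex_orthogonal w0.
have uu := dot_gt0 u0; have ww := dot_gt0 w0.
pose v := cross w u.
have uv : cross u v = dot u u *: w by rewrite /v triple_cross uw scale0r subr0.
have duv : dot u v = 0 by rewrite /v dotE !crossE; ring.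
have [al [be hM]] : exists al be : R, M *m cross u v = al *: u + be *: v.
  exists (dot u (M *m w)), (dot v (M *m w) / dot w w).
  by rewrite uv -scalemxAr (orthogonal_decomp w0 uw) // dotC.
have n0 : be ^+ 2 + dot u u != 0 by rewrite gt_eqF // ltr_wpDl // sqr_ge0.
(* The vector part of the product below vanishes for every [k]; this value kills the scalar part as
   well. *)
pose k := (al * be + dot x (cross u v)) / (be ^+ 2 + dot u u).
have cuvk : cross u (v + k *: u) = cross u v.
  by apply: vec3P; rewrite !(crossE, add_col, scale_col); ring.
case: (@nzd (- be, u) (- al + k * be, v + k *: u)).
- rewrite /Kmul /= cuvk hM dotDr' dotZr duv; congr pair.
    transitivity (al * be + dot x (cross u v) - k * (be ^+ 2 + dot u u)); first by ring.
    by rewrite /k mulfVK // subrr.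
  by apply: vec3P; rewrite !(add_col, scale_col) [RHS]mxE; ring.
- by case=> _ uz; rewrite uz eqxx in u0.
case=> _ vz; move: uv; rewrite -cuvk vz => h.
have : dot u u *: w = 0.
  by rewrite -h; apply: vec3P; rewrite crossE !mxE; ring.
by move/eqP; rewrite scaler_eq0 (negPf w0) orbF gt_eqF.
Qed.

End Anisotropy.

(** * Transport of an abstract algebra to row vectors *)

Section Existence.
Import VectorInternalTheory.
Context (A : algebra R).
Context (divA : division_algebra A) (pcA : power_commutative A).
Context (dimA : algdim A = 4%N).

Local Notation toA := (@r2v R A).
Local Notation ofA := (@v2r R A).
Let n := dim A.
Let n4 : n = 4%N. Proof. by rewrite -dimA /algdim dimvf. Qed.
Let p (u v : 'rV[R]_n) : 'rV[R]_n := ofA (amul (toA u : A) (toA v : A)).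

Let pDl (u v w : 'rV[R]_n) : p (u + v) w = p u w + p v w.
Proof. by rewrite /p linearD linearDl linearD. Qed.
Let pDr (u v w : 'rV[R]_n) : p u (v + w) = p u v + p u w.
Proof. by rewrite /p linearD linearDr linearD. Qed.
Let pZl a (u v : 'rV[R]_n) : p (a *: u) v = a *: p u v.
Proof. by rewrite /p linearZ linearZl_LR linearZ. Qed.
Let pZr a (u v : 'rV[R]_n) : p u (a *: v) = a *: p u v.
Proof. by rewrite /p !linearZ. Qed.
Let pnz (u v : 'rV[R]_n) : p u v = 0 -> u = 0 \/ v = 0.
Proof.
rewrite /p => h; have {}h : amul (toA u : A) (toA v) = 0.
  by apply: v2r_inj; rewrite h linear0.
have [u0|u0] := eqVneq (toA u : A) 0.
  by left; apply: r2v_inj; rewrite u0 linear0.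
right; apply: r2v_inj; rewrite linear0.
by apply: (bij_inj (divA u0).1); rewrite h linear0r.
Qed.

Let hpc (a u v : 'rV[R]_n) :
  (forall U, subalg p U -> a \in U -> u \in U) ->
  (forall U, subalg p U -> a \in U -> v \in U) -> p u v = p v u.
Proof.
move=> hu hv; congr ofA.
have gen0 (w : 'rV[R]_n) : (forall U, subalg p U -> a \in U -> w \in U) ->
    generated (toA a : A) (toA w).
  move=> hw U sU aU.
  pose U' : {vspace 'rV[R]_n} := (linfun ofA @: U)%VS.
  have inU' t : (t \in U') = (toA t \in U).
    apply/memv_imgP/idP => [[s sU' ->]|tU]; first by rewrite lfunE /= v2rK.
    by exists (toA t); rewrite // lfunE /= r2vK.
  rewrite -inU'; apply: hw; last by rewrite inU'.
  by move=> s t; rewrite !inU' /p v2rK => ? ?; apply: sU.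
by apply: (@pcA (toA a)); apply: gen0.
Qed.

Lemma iso_Falg : exists (x y z d : vec3 R) (l : R),
  [/\ calT d, l != 0 & isomorphic A (Falg (x, y, z, d, l))].
Proof.
have [e [b1 [b2 [b3 [x [M [z [l [f l0 hPhi]]]]]]]]] :=
  ex_model n4 pDl pDr pZl pZr pnz hpc.
pose P q := Phi e b1 b2 b3 q.
have PD (c : R) (q r : (R^o * vec3 R)%type) : P (c *: q + r) = c *: P q + P r.
  case: q r => [q1 q2] [r1 r2]; rewrite /P /Phi /= !add_col !scale_col.
  by rewrite (_ : c *: q1 = c * q1) //; vec.
have P0 q : P q = 0 -> q = 0.
  case: q => [q1 q2] /f[/= -> h0 h1 h2]; congr pair.
  by apply: vec3P; rewrite mxE.
have nzd q r : Gmul x M z l q r = 0 -> q = 0 \/ r = 0.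
  move=> h; have := hPhi q r; rewrite h -/(P q) -/(P r).
  have -> : Phi e b1 b2 b3 0 = 0 by rewrite /Phi /= !mxE; vec.
  by case/pnz => /P0; [left|right].
have /ex_normal[phi [y [d [h1 h2 h3]]]] : forall w, w != 0 -> dot w (M *m w) != 0.
  apply: (anisotropic_of_division (x := x)) => q r.
  have [q' <-] := hmap_surj z q l0; have [r' <-] := hmap_surj z r l0.
  have hm0 : hmap z l 0 = 0 by rewrite /hmap /= scaler0 dot0r addr0.
  by rewrite -GmulE => /nzd[->|->]; rewrite hm0; [left|right].
exists (\det phi *: (phi *m x)), y, (phi *m z), d, l; split=> //.
apply: isomorphic_sym.
(* [phi^T] undoes the orthogonal change of coordinates that brought [M] to its normal form. *)
pose F (q : Falg (\det phi *: (phi *m x), y, phi *m z, d, l)) : A :=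
  toA (P (q.1, phi^T *m q.2)).
have linF : linear F.
  move=> c q r; rewrite /F -linearP -PD; congr (toA (P _)).
  by rewrite /= mulmxDr -scalemxAr.
have F0 q : F q = 0 -> q = 0.
  move=> h; have : P (q.1, phi^T *m q.2) = 0.
    by apply: r2v_inj; rewrite linear0.
  move/P0 => [q1 q2]; rewrite [q]surjective_pairing q1; congr pair.
  by rewrite -[q.2]mul1mx -(orthogonalE h1) -mulmxA q2 mulmx0.
exists (mklin linF); split.
  have surjF (a : A) : exists q, F q = a.
    have [c [c1 [c2 [c3 h]]]] := fr4_span n4 f (ofA a).
    exists (c, phi *m mkvec c1 c2 c3); rewrite /F /= mulmxA h1 mul1mx.
    by rewrite /P /Phi /= !mkvecE -h v2rK.
  have [g hg] := choice surjF.
  exists g => // q /=.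
  have FB : F ((-1) *: q + g (F q)) = 0 by rewrite linF hg scaleN1r addNr.
  by apply/eqP; rewrite -subr_eq0 addrC -scaleN1r (F0 _ FB).
move=> q r /=; rewrite Falg_mul -h3 /F /conj3.
apply: v2r_inj; rewrite r2vK.
have -> : ofA (amul (toA (P (q.1, phi^T *m q.2)) : A)
     (toA (P (r.1, phi^T *m r.2)))) = p (P (q.1, phi^T *m q.2)) (P (r.1, phi^T *m r.2)).
  by [].
rewrite hPhi; congr Phi.
have hq (t : R * vec3 R) : (t.1, phi *m (phi^T *m t.2)) = t.
  by rewrite mulmxA (orthogonalE h1) mul1mx -surjective_pairing.
have -> : Gmul (\det phi *: (phi *m x)) (\det phi *: (phi *m M *m phi^T)) (phi *m z) l q r =
    ((Gmul x M z l (q.1, phi^T *m q.2) (r.1, phi^T *m r.2)).1,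
     phi *m (Gmul x M z l (q.1, phi^T *m q.2) (r.1, phi^T *m r.2)).2).
  rewrite -{1}(hq q) -{1}(hq r).
  exact: (Gmul_orthogonal x M z l (q.1, phi^T *m q.2) (r.1, phi^T *m r.2) h1).
move: (Gmul _ _ _ _ _ _) => t.
by rewrite /= mulmxA h1 mul1mx; case: t.
Qed.

End Existence.
End Model.

(** * Isomorphisms between members of the family *)

Section Isomorphisms.
Context (R : realType).
Implicit Types (A B : algebra R) (x y z d u v w : vec3 R) (M N phi : 'M[R]_3).

Lemma mulmx_ext M N : (forall u, M *m u = N *m u) -> M = N.
Proof.
move=> h; apply/trmx_inj/row_matrixP => i.
by rewrite -!tr_col !colE h.
Qed.

Lemma epsilon_mul y u : epsilon y *m u = cross y u.
Proof. by apply: vec3P; rewrite mul3v crossE /epsilon !mx3E; ring. Qed.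

Lemma conj3_epsilon phi y : SO3 phi ->
  conj3 phi (epsilon y) = epsilon (phi *m y).
Proof.
move=> [h hd]; apply: mulmx_ext => u.
rewrite /conj3 -!mulmxA !epsilon_mul.
have {2}-> : u = phi *m (phi^T *m u) by rewrite mulmxA (orthogonalE h) mul1mx.
by rewrite cross_orthogonal // hd scale1r.
Qed.

Lemma conj3D phi M N : conj3 phi (M + N) = conj3 phi M + conj3 phi N.
Proof. by rewrite /conj3 mulmxDr mulmxDl. Qed.

Lemma Falg_iso_of_SO3 phi x y z d l : SO3 phi -> conj3 phi (delta d) = delta d ->
  isomorphic (Falg (x, y, z, d, l)) (Falg (phi *m x, phi *m y, phi *m z, d, l)).
Proof.
move=> hphi hd; have [h dt] := hphi.
pose f (q : Falg (x, y, z, d, l)) : Falg (phi *m x, phi *m y, phi *m z, d, l) :=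
  (q.1, phi *m q.2).
have linf : linear f.
  by move=> c [a u] [b v]; rewrite /f /= mulmxDr -scalemxAr.
have fM p q : f (amul p q) = amul (f p) (f q).
  have e1 := Falg_mul p q; have e2 := Falg_mul (f p) (f q).
  have := Gmul_orthogonal x (epsilon y + delta d) z l p q h.
  rewrite dt !scale1r -/(conj3 _ _) conj3D conj3_epsilon // hd => e.
  exact: etrans (congr1 f e1) (etrans (esym e) (esym e2)).
exists (mklin linf); split; last exact: fM.
exists (fun q => (q.1, phi^T *m q.2)) => -[a u]; rewrite /= /f /= mulmxA.
  by rewrite h mul1mx.
by rewrite (orthogonalE h) mul1mx.
Qed.

Lemma ex_cross w : exists u v, w = cross u v.
Proof.
have [->|w0] := eqVneq w 0.
  by exists 0, 0; apply: vec3P; rewrite crossE !mxE; ring.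
have [u u0 uw] := ex_orthogonal w0; have uu := lt0r_neq0 (dot_gt0 u0).
exists ((dot u u)^-1 *: u), (1 *: cross w u).
by rewrite crossZ triple_cross uw scale0r subr0 mulr1 scalerA mulVf // scale1r.
Qed.

Lemma dot_ext u v : (forall w, dot u w = dot v w) -> u = v.
Proof.
move=> h; apply: vec3P.
- by have := h (mkvec 1 0 0); rewrite !dotE !mkvecE !mulr0 !addr0 !mulr1.
- by have := h (mkvec 0 1 0); rewrite !dotE !mkvecE !mulr0 !addr0 !add0r !mulr1.
- by have := h (mkvec 0 0 1); rewrite !dotE !mkvecE !mulr0 !add0r !mulr1.
Qed.

Lemma isometry_orthogonal phi :
  (forall u, dot (phi *m u) (phi *m u) = dot u u) -> phi^T *m phi = 1%:M.
Proof.
move=> h; apply: mulmx_ext => u; rewrite mul1mx; apply: dot_ext => w.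
rewrite -mulmxA dotC dot_mulmx trmxK.
have := h (u + w); rewrite mulmxDr !(dotDl', dotDr') !h.
rewrite (dotC (phi *m w)) (dotC w); lra.
Qed.

Lemma linear_mx (f : vec3 R -> vec3 R) : linear f ->
  exists phi, forall u, f u = phi *m u.
Proof.
move=> lf; pose e i : vec3 R := delta_mx i 0.
exists (\matrix_(i, j) f (e j) i 0) => u.
have fD v w : f (v + w) = f v + f w by rewrite -[v]scale1r lf !scale1r.
have f0 : f 0 = 0 by apply: (addrI (f 0)); rewrite -fD !addr0.
have fZ c v : f (c *: v) = c *: f v by rewrite -[c *: v]addr0 lf f0 addr0.
have uE : u = u 0 0 *: e 0 + u 1 0 *: e 1 + u 2 0 *: e 2.
  by apply: vec3P; rewrite !(add_col, scale_col) !mxE /=; ring.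
rewrite {1}uE !fD !fZ.
by apply: vec3P; rewrite !(add_col, scale_col) mul3v !mxE; ring.
Qed.

Lemma Kmul_unitl x M p : Kmul x M (1, 0) p = p.
Proof.
case: p => a u; rewrite /Kmul /=.
have -> : cross 0 u = 0 by apply: vec3P; rewrite crossE !mxE; ring.
by rewrite dot0r dot0l mul1r addr0 subr0 scale1r scaler0 mulmx0 !addr0.
Qed.

(** If [e] had a vector part [v], take [u] orthogonal to [z] and independent of [v]. The square of
    [(0, u)] is a non-zero multiple of [(1, 0)], which is not in the span of [e] and [(0, u)]. *)
Lemma Falg_idem_unique x y z d l (e : Falg (x, y, z, d, l)) : l != 0 ->
  e != 0 -> amul e e = e ->
  (forall p : Falg (x, y, z, d, l), exists a b : R, amul p p = a *: e + b *: p) ->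
  e = (1, 0).
Proof.
case: e => a v l0 e0 ee h.
have v0 : v = 0.
  apply: contrapT => /eqP v0.
  have [u [u0 uz nuv]] : exists u, [/\ u != 0, dot z u = 0 & forall c, u != c *: v].
    have [z0|z0] := eqVneq z 0.
      have [u u0 uv] := ex_orthogonal v0; exists u; split=> //.
        by rewrite z0 dot0l.
      move=> c; apply/eqP => uc; have := dot_gt0 u0.
      by rewrite {2}uc dotZr uv mulr0 ltxx.
    have [u u0 uz] := ex_orthogonal z0.
    case: (pselect (exists c, u = c *: v)) => [[c uc]|no]; last first.
      exists u; split; rewrite 1?dotC // => c; apply/eqP => uc.
      by apply: no; exists c.
    have c0 : c != 0 by apply: contraNneq u0 => c0; rewrite uc c0 scale0r.
    (* Here [u] itself is proportional to [v], so the other direction orthogonal to [z] is taken. *)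
    exists (cross z u); split.
    - apply/eqP => zu; have := triple_cross u z.
      rewrite zu uz scale0r subr0 (_ : cross u 0 = 0); last first.
        by apply: vec3P; rewrite crossE !mxE; ring.
      move/esym/eqP; rewrite scaler_eq0 (negPf z0) orbF.
      by rewrite gt_eqF // dot_gt0.
    - by rewrite dotE !crossE; ring.
    - move=> k; apply/eqP => hk; have : dot (cross z u) u = 0.
        by rewrite dotE !crossE; ring.
      rewrite {1}hk uc dotZl dotZr => /eqP; rewrite !mulf_eq0 (negPf c0).
      rewrite (gt_eqF (dot_gt0 v0)) /= orbF => /eqP k0.
      have := triple_cross u z; rewrite hk k0 scale0r uz scale0r subr0.
      rewrite (_ : cross u 0 = 0); last first.
        by apply: vec3P; rewrite crossE !mxE; ring.
      move/esym/eqP; rewrite scaler_eq0 (negPf z0) orbF.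
      by rewrite gt_eqF // dot_gt0.
  have [k [r]] := h (0, u); rewrite Falg_mul /Gmul /= uz.
  have -> : cross u u = 0 by apply: vec3P; rewrite crossE !mxE; ring.
  rewrite mulmx0 dot0r !(mulr0, mul0r, addr0, add0r, scale0r, scaler0, subr0, sub0r).
  move=> [h1 h2]; have k0 : k = 0.
    apply: contrapT => /eqP k0; have := nuv (- r / k); have [r0|r0] := eqVneq r 0.
      by move: h2 => /esym/eqP; rewrite r0 scale0r addr0 scaler_eq0 (negPf k0) (negPf v0).
    move=> _; have := nuv (- k / r); case/eqP; apply: (scalerI r0).
    rewrite scalerA mulrC mulfVK // scaleNr; apply/eqP.
    by rewrite -addr_eq0 addrC -h2.
  move: h1; rewrite k0 (_ : 0 *: a = 0) ?scale0r //.
  rewrite (_ : r *: 0 = 0) ?scaler0 // addr0 => /eqP; rewrite oppr_eq0 mulf_eq0.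
  by rewrite expf_eq0 (negPf l0) andbF gt_eqF // dot_gt0.
move: ee e0; rewrite v0 Falg_mul /Gmul /= => -[].
have -> : cross (0 : vec3 R) 0 = 0 by apply: vec3P; rewrite crossE !mxE; ring.
rewrite !dot0r !(mulr0, addr0, subr0) => aa _ a0.
have a1 : a != 0 by apply: contraNneq a0 => ->.
by congr pair; apply: (mulfI a1); rewrite aa mulr1.
Qed.

Lemma Falg_sqr x y z d l (p : Falg (x, y, z, d, l)) :
  exists a b : R, amul p p = a *: (1, 0) + b *: p.
Proof.
case: p => a u; rewrite Falg_mul /Gmul /=.
have -> : cross u u = 0 by apply: vec3P; rewrite crossE !mxE; ring.
rewrite mulmx0 dot0r scaler0 mulr0 !addr0.
pose b := 2 * (l * (a + dot z u)).
exists (a * a + a * dot z u + a * dot z u + dot z u * dot z u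
  - l ^+ 2 * dot u u - b * a), b.
congr pair; last by rewrite /= scaler0 add0r -scalerDl /b mulrDl !mul1r.
by rewrite /= /GRing.scale /=; ring.
Qed.

Lemma Falg_unit x y z d l (p : Falg (x, y, z, d, l)) :
  amul ((1, 0) : Falg (x, y, z, d, l)) p = hmap z l p.
Proof.
rewrite Falg_mul GmulE (_ : hmap z l (1, 0) = (1, 0)) ?Kmul_unitl //.
by rewrite /hmap /= dot0r addr0 scaler0.
Qed.

(** [f] preserves the universal idempotent, so it commutes with [hmap] and is an isomorphism for
    [Kmul]. There [(0, u)] has the real square [- dot u u], which makes [f] an isometry [phi] on
    vectors; comparing [hmap] and [Kmul] then identifies the parameters. *)
Lemma Falg_iso_inv x y z d l x' y' z' d' l' : l != 0 -> l' != 0 ->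
  calT d -> calT d' ->
  isomorphic (Falg (x, y, z, d, l)) (Falg (x', y', z', d', l')) ->
  l = l' /\ exists phi, [/\ SO3 phi, conj3 phi (delta d) = delta d' &
    [/\ x' = phi *m x, y' = phi *m y & z' = phi *m z]].
Proof.
move=> l0 l0' dT dT' [f [bf fM]].
have f_inj := bij_inj bf.
pose e : Falg (x, y, z, d, l) := (1, 0).
have e0 : e != 0.
  by apply/eqP => /(congr1 fst) /= /eqP; rewrite oner_eq0.
have he (q : Falg (x, y, z, d, l)) : amul e q = hmap z l q by exact: Falg_unit.
have ee : amul e e = e by rewrite he /hmap /e /= dot0r addr0 scaler0.
have fe : f e = (1, 0).
  apply: Falg_idem_unique; first exact: l0'.
  - by apply: contra e0 => /eqP h; apply/eqP/f_inj; rewrite h linear0.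
  - by rewrite -fM ee.
  - case: bf => g fg gf p; have [a [b hab]] := Falg_sqr (g p).
    by exists a, b; rewrite -{1 2}(gf p) -fM hab linearD !linearZ /= gf.
have fh q : f (hmap z l q) = hmap z' l' (f q) by rewrite -he fM fe Falg_unit.
have fK p q : f (Kmul x (epsilon y + delta d) p q) =
    Kmul x' (epsilon y' + delta d') (f p) (f q).
  have [p1 <-] := hmap_surj z p l0; have [q1 <-] := hmap_surj z q l0.
  have hF := Falg_mul (p1 : Falg (x, y, z, d, l)) q1.
  rewrite -GmulE -hF fM !fh -GmulE; exact: Falg_mul.
pose g u := (f ((0, u) : Falg (x, y, z, d, l))).2.
have lg : linear g.
  move=> c u v; rewrite /g.
  have -> : ((0, c *: u + v) : Falg (x, y, z, d, l)) = c *: ((0, u) : Falg (x, y, z, d, l)) + ((0, v) : Falg (x, y, z, d, l)).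
    by congr pair; rewrite /= (_ : c *: (0 : R^o) = 0) ?scaler0 // addr0.
  by rewrite linearP.
have [phi hphi] := linear_mx lg.
have fE (u : vec3 R) : f (0, u) = (0, phi *m u) /\ dot (phi *m u) (phi *m u) = dot u u.
  rewrite -hphi; have : Kmul x (epsilon y + delta d) (0, u) (0, u) = (- dot u u, 0).
    rewrite /Kmul /=; have -> : cross u u = 0 by apply: vec3P; rewrite crossE !mxE; ring.
    by rewrite mulmx0 dot0r !(mulr0, scale0r, addr0, add0r).
  move/(congr1 f); rewrite fK.
  have -> : f (- dot u u, 0) = (- dot u u, 0).
    have -> : ((- dot u u, 0) : Falg (x, y, z, d, l)) = (- dot u u) *: e.
      by congr pair; rewrite /= ?scaler0 // /GRing.scale /= mulr1.
    by rewrite linearZ /= fe; congr pair; rewrite /= ?scaler0 // /GRing.scale /= mulr1.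
  rewrite /g; case hfu: (f (0, u)) => [t v]; rewrite /Kmul /=.
  have -> : cross v v = 0 by apply: vec3P; rewrite crossE !mxE; ring.
  rewrite mulmx0 dot0r !addr0 => -[h1 h2].
  have [v0|v0] := eqVneq v 0.
    have : ((0, u) : Falg (x, y, z, d, l)) = t *: e.
      apply: f_inj; rewrite linearZ /= fe hfu v0.
      by congr pair; rewrite /= ?scaler0 // /GRing.scale /= mulr1.
    move=> [/esym h3 h4]; have t0 : t = 0 by move: h3; rewrite /GRing.scale /= mulr1.
    by rewrite h4 t0 scaler0 v0 dot0r.
  move: h2 => /eqP; rewrite -scalerDl scaler_eq0 (negPf v0) orbF -mulr2n mulrn_eq0 /=.
  move=> /eqP t0; rewrite t0 in h1 *; split=> //.
  by move: h1; rewrite mulr0 sub0r => /oppr_inj.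
have orth : phi^T *m phi = 1%:M by apply: isometry_orthogonal => u; case: (fE u).
have fE2 a u : f (a, u) = (a, phi *m u).
  have -> : ((a, u) : Falg (x, y, z, d, l)) = a *: e + ((0, u) : Falg (x, y, z, d, l)).
    by congr pair; rewrite /= ?scaler0 ?add0r // /GRing.scale /= mulr1 addr0.
  rewrite linearD linearZ /= fe (fE u).1.
  by congr pair; rewrite /= ?scaler0 ?add0r // /GRing.scale /= mulr1 addr0.
have hz u : l = l' /\ dot z u = dot z' (phi *m u).
  have e1 : mkvec 1 0 0 != 0 :> vec3 R.
    apply/eqP => /(congr1 (fun w : vec3 R => w 0 0)).
    by rewrite /= mkvecE mxE => /eqP; rewrite oner_eq0.
  split.
    have := fh (0, mkvec 1 0 0); rewrite /hmap /= !fE2 /= => -[_].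
    rewrite -scalemxAr => /eqP; rewrite -subr_eq0 -scalerBl scaler_eq0 subr_eq0.
    case/orP => [/eqP //|/eqP h]; case/eqP: e1.
    by rewrite -[LHS]mul1mx -orth -mulmxA h mulmx0.
  by have := fh (0, u); rewrite /hmap /= !fE2 /= !add0r => -[].
have ll := (hz 0).1; split=> //.
set D := \det phi.
have DD : D * D = 1 by rewrite /D -{1}det_tr -det_mulmx orth det1.
have hK u v : dot x (cross u v) = D * dot x' (phi *m cross u v) /\
   phi *m ((epsilon y + delta d) *m cross u v) =
   D *: ((epsilon y' + delta d') *m (phi *m cross u v)).
  have := fK (0, u) (0, v); rewrite /Kmul /= !fE2 /= cross_orthogonal //.
  rewrite dot_orthogonal // !scale0r !add0r -scalemxAr dotZr !mul0r !add0r.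
  by move=> [/addIr h1 h2].
have hM : conj3 phi (epsilon y + delta d) = D *: (epsilon y' + delta d').
  apply: mulmx_ext => w; have [u [v huv]] := ex_cross (phi^T *m w).
  rewrite /conj3 -!mulmxA huv (hK u v).2 -huv (mulmxA phi).
  by rewrite (orthogonalE orth) mul1mx scalemxAl.
(* Transposing [hM] reverses the skew part, so the two equations together isolate the symmetric
   one. *)
have hN : conj3 phi (- epsilon y + delta d) = D *: (- epsilon y' + delta d').
  transitivity (conj3 phi (epsilon y + delta d))^T.
    rewrite /conj3 !trmx_mul trmxK mulmxA; congr (_ *m _ *m _).
    by apply: mat3P; rewrite trmxE !mxE /=; ring.
  by rewrite hM; apply: mat3P; rewrite trmxE !mxE /=; ring.
have hd : conj3 phi (delta d) = D *: delta d'.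
  have -> : delta d = 2^-1 *: ((epsilon y + delta d) + (- epsilon y + delta d)).
    by apply: mat3P; rewrite !mxE /=; field.
  have cZ (k : R) N : conj3 phi (k *: N) = k *: conj3 phi N.
    by rewrite /conj3 -scalemxAr -scalemxAl.
  rewrite cZ conj3D hM hN -scalerDr scalerA mulrC -scalerA; congr (D *: _).
  by apply: mat3P; rewrite !mxE /=; field.
(* Both diagonal matrices are positive, which excludes [D = -1]. *)
have D1 : D = 1.
  have Dp : 0 < D.
    have h := congr1 (fun N : 'M[R]_3 => N 0 0) hd.
    rewrite /= conj3E /delta !mx3E [X in _ = X]mxE mx3E in h.
    case: dT => d0 /andP[d1 d2]; case: dT' => d0' _.
    have h0 : 0 < D * d' 0 0.
      have k0 : (phi *m phi^T) 0 0 = 1 by rewrite (orthogonalE orth) mxE.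
      rewrite mulmx3E !trmxE in k0.
      have s0 := sqr_ge0 (phi 0 0); have s1 := sqr_ge0 (phi 0 1); have s2 := sqr_ge0 (phi 0 2).
      have t1 : 0 <= (d 1 0 - d 0 0) * (phi 0 1) ^+ 2 by rewrite mulr_ge0 // subr_ge0.
      have t2 : 0 <= (d 2 0 - d 0 0) * (phi 0 2) ^+ 2.
        by rewrite mulr_ge0 // subr_ge0 (le_trans d1).
      have kd : d 0 0 * (phi 0 0 * phi 0 0 + phi 0 1 * phi 0 1 + phi 0 2 * phi 0 2) = d 0 0.
        by rewrite k0 mulr1.
      lra.
    by move: h0; rewrite pmulr_lgt0.
  apply/eqP; rewrite -subr_eq0; have /eqP := DD.
  rewrite -subr_eq0 (_ : D * D - 1 = (D - 1) * (D + 1)); last by ring.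
  by rewrite mulf_eq0 => /orP[//|]; rewrite gt_eqF // addr_gt0.
have hSO : SO3 phi by split.
exists phi; split=> //; first by rewrite hd D1 scale1r.
have hy : epsilon (phi *m y) = epsilon y'.
  rewrite -conj3_epsilon //; move: hM; rewrite conj3D hd D1 !scale1r.
  by move/addIr.
split.
- apply: dot_ext => w; have [u [v huv]] := ex_cross (phi^T *m w).
  have := (hK u v).1; rewrite -huv D1 mul1r mulmxA (orthogonalE orth) mul1mx => <-.
  by rewrite dot_mulmx trmxK.
- by apply: vec3P; [have := congr1 (fun N : 'M[R]_3 => N 2 1) hy
  |have := congr1 (fun N : 'M[R]_3 => N 0 2) hy
  |have := congr1 (fun N : 'M[R]_3 => N 1 0) hy]; rewrite /= /epsilon !mx3E.
apply: dot_ext => w.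
have := (hz (phi^T *m w)).2; rewrite mulmxA (orthogonalE orth) mul1mx => <-.
by rewrite dot_mulmx trmxK.
Qed.

Lemma conj3_deltaP phi d d' : phi^T *m phi = 1%:M ->
  conj3 phi (delta d) = delta d' <-> forall i j, phi i j * (d j 0 - d' i 0) = 0.
Proof.
move=> h; have dl (v : vec3 R) i j : delta v i j = v i 0 * (i == j)%:R.
  by elim/forall3: i; elim/forall3: j; rewrite /delta mxE /= ?mulr1 ?mulr0.
have e1 i j : (phi *m delta d) i j = phi i j * d j 0.
  by rewrite mulmx3E !dl; elim/forall3: j => /=; ring.
have e2 i j : (delta d' *m phi) i j = d' i 0 * phi i j.
  by rewrite mulmx3E !dl; elim/forall3: i => /=; ring.
split=> [hd i j|hd].
  have : phi *m delta d = delta d' *m phi.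
    by rewrite -hd /conj3 -!mulmxA h mulmx1.
  move/matrixP/(_ i j); rewrite e1 e2 => k.
  by rewrite mulrBr k mulrC subrr.
have -> : delta d' = delta d' *m phi *m phi^T by rewrite -mulmxA (orthogonalE h) mulmx1.
congr (_ *m _); apply/matrixP => i j; rewrite e1 e2.
by apply/eqP; rewrite -subr_eq0 (mulrC (d' i 0)) -mulrBr hd.
Qed.

Lemma orthogonal_col phi j : phi^T *m phi = 1%:M -> exists i, phi i j != 0.
Proof.
move=> h; apply: contrapT => no.
have h0 i : phi i j = 0 by apply: contrapT => /eqP k; apply: no; exists i.
have := congr1 (fun N : 'M[R]_3 => N j j) h.
rewrite /= mulmx3E !trmxE !h0 !mulr0 !addr0 mxE eqxx => /eqP.
by rewrite eq_sym oner_eq0.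
Qed.

(** Both vectors have the same set of entries, so the smallest and the largest agree, and the trace
    settles the middle one. *)
Lemma delta_unique phi d d' : phi^T *m phi = 1%:M -> calT d -> calT d' ->
  conj3 phi (delta d) = delta d' -> d = d'.
Proof.
move=> h [_ /andP[d1 d2]] [_ /andP[d1' d2']] hd.
have := (conj3_deltaP d d' h).1 hd => hij.
have col j : exists i, d j 0 = d' i 0.
  have [i k] := orthogonal_col j h; exists i; apply/eqP; rewrite -subr_eq0.
  by have /eqP := hij i j; rewrite mulf_eq0 (negPf k).
have row i : exists j, d' i 0 = d j 0.
  have h' : (phi^T)^T *m phi^T = 1%:M by rewrite trmxK orthogonalE.
  have [j k] := orthogonal_col i h'; exists j; rewrite trmxE in k.
  apply/eqP; rewrite eq_sym -subr_eq0.
  by have /eqP := hij i j; rewrite mulf_eq0 (negPf k).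
have le0 i : d' 0 0 <= d' i 0 by elim/forall3: i; rewrite // (le_trans d1').
have le0' i : d 0 0 <= d i 0 by elim/forall3: i; rewrite // (le_trans d1).
have le2 i : d' i 0 <= d' 2 0 by elim/forall3: i; rewrite // (le_trans d1').
have le2' i : d i 0 <= d 2 0 by elim/forall3: i; rewrite // (le_trans d1).
have h0 : d 0 0 = d' 0 0.
  apply/eqP; rewrite eq_le; apply/andP; split.
    by have [j ->] := row 0.
  by have [j ->] := col 0.
have h2 : d 2 0 = d' 2 0.
  apply/eqP; rewrite eq_le; apply/andP; split.
    by have [j ->] := col 2.
  by have [j ->] := row 2.
have trE (v : vec3 R) : \tr (delta v) = v 0 0 + v 1 0 + v 2 0.
  by rewrite /mxtrace sum3 /delta !mx3E.
have := congr1 mxtrace hd.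
rewrite /conj3 mxtrace_mulC mulmxA h mul1mx !trE => ht.
by apply: vec3P => //; lra.
Qed.

End Isomorphisms.

Local Open Scope classical_set_scope.

(** * Normal forms *)

Section Stabilisers.
Context (R : realType).
Implicit Types (x y z d u v w : vec3 R) (phi psi : 'M[R]_3) (D : set (vec3 R)).

Lemma SO3_invmx phi : SO3 phi -> invmx phi = phi^T.
Proof.
move=> [h hd]; have u : phi \in unitmx by rewrite unitmxE hd unitr1.
by rewrite -[LHS]mul1mx -h -mulmxA mulmxV // mulmx1.
Qed.

Lemma stabE D phi : stab D phi <->
  SO3 phi /\ forall d, D d -> conj3 phi (delta d) = delta d.
Proof.
by split=> -[h k]; split=> // d /k; rewrite (SO3_invmx h).
Qed.

Lemma stab_mul D phi psi : stab D phi -> stab D psi -> stab D (phi *m psi).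
Proof.
move=> /stabE[h1 k1] /stabE[h2 k2]; apply/stabE; split; first exact: SO3_mul.
by move=> d dD; rewrite -conj3M k2 // k1.
Qed.

Lemma stab_1 D : stab D 1%:M.
Proof.
apply/stabE; split; first exact: SO3_1.
by move=> d _; rewrite /conj3 trmx1 mulmx1 mul1mx.
Qed.

Lemma stab_of_SO3 D phi : SO3 phi ->
  (forall d, D d -> forall i j, phi i j * (d j 0 - d i 0) = 0) -> stab D phi.
Proof.
move=> h k; apply/stabE; split=> // d /k hd.
by apply/(conj3_deltaP _ _ h.1).
Qed.

(** The property of [T1], ..., [T4] by which a rotation fixing one [delta d] fixes them all. *)
Definition eqpat D := forall d d', D d -> D d' -> forall i j,
  d j 0 = d i 0 -> d' j 0 = d' i 0.

Lemma stab_of_one D phi d : eqpat D -> D d -> SO3 phi ->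
  conj3 phi (delta d) = delta d -> stab D phi.
Proof.
move=> ep dD h hd; apply: stab_of_SO3 => // d' dD' i j.
apply/eqP; rewrite mulf_eq0 subr_eq0.
have := (conj3_deltaP d d h.1).1 hd i j => /eqP.
rewrite mulf_eq0 subr_eq0 => /orP[-> //|/eqP e].
by rewrite (ep d d' dD dD' i j e) eqxx orbT.
Qed.

Lemma eqpat1 : eqpat (@T1 R).
Proof.
move=> d d' [_ [h1 h2]] [_ [h1' h2']].
by apply: forall3; apply: forall3 => e; lra.
Qed.
Lemma eqpat2 : eqpat (@T2 R).
Proof.
move=> d d' [_ [h1 h2]] [_ [h1' h2']].
by apply: forall3; apply: forall3 => e; lra.
Qed.
Lemma eqpat3 : eqpat (@T3 R).
Proof.
move=> d d' [_ [h1 h2]] [_ [h1' h2']].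
by apply: forall3; apply: forall3 => e; lra.
Qed.
Lemma eqpat4 : eqpat (@T4 R).
Proof.
move=> d d' [_ [h1 h2]] [_ [h1' h2']].
by apply: forall3; apply: forall3 => e; lra.
Qed.

Lemma stab_T1 phi : SO3 phi -> stab (@T1 R) phi.
Proof.
move=> h; apply: stab_of_SO3 => // d [_ [h1 h2]].
have e i j : d j 0 = d i 0.
  by elim/forall3: i; elim/forall3: j; lra.
by move=> i j; rewrite (e i j) subrr mulr0.
Qed.

Lemma stab_T2 c s : c ^+ 2 + s ^+ 2 = 1 -> stab (@T2 R) (rot3 c s).
Proof.
move=> h; apply: stab_of_SO3; first exact: SO3_rot3.
by move=> d [_ [h1 h2]]; apply: forall3; apply: forall3; rewrite !mx3E ?h1; ring.
Qed.

Lemma stab_T3 c s : c ^+ 2 + s ^+ 2 = 1 -> stab (@T3 R) (rot1 c s).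
Proof.
move=> h; apply: stab_of_SO3; first exact: SO3_rot1.
by move=> d [_ [h1 h2]]; apply: forall3; apply: forall3; rewrite !mx3E ?h2; ring.
Qed.

Lemma stab_flip1 D : stab D (rot1 (-1) 0).
Proof.
apply: stab_of_SO3; first by apply: SO3_rot1; ring.
by move=> d _; apply: forall3; apply: forall3; rewrite !mx3E; ring.
Qed.
Lemma stab_flip2 D : stab D (rot2 (-1) 0).
Proof.
apply: stab_of_SO3; first by apply: SO3_rot2; ring.
by move=> d _; apply: forall3; apply: forall3; rewrite !mx3E; ring.
Qed.
Lemma stab_flip3 D : stab D (rot3 (-1) 0).
Proof.
apply: stab_of_SO3; first by apply: SO3_rot3; ring.
by move=> d _; apply: forall3; apply: forall3; rewrite !mx3E; ring.
Qed.

Lemma rot1_mkvec c s (a b e : R) :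
  rot1 c s *m mkvec a b e = mkvec a (c * b + s * e) (- s * b + c * e).
Proof. by apply: vec3P; rewrite mul3v !mx3E !mkvecE; ring. Qed.
Lemma rot2_mkvec c s (a b e : R) :
  rot2 c s *m mkvec a b e = mkvec (c * a + s * e) b (- s * a + c * e).
Proof. by apply: vec3P; rewrite mul3v !mx3E !mkvecE; ring. Qed.
Lemma rot3_mkvec c s (a b e : R) :
  rot3 c s *m mkvec a b e = mkvec (c * a + s * b) (- s * a + c * b) e.
Proof. by apply: vec3P; rewrite mul3v !mx3E !mkvecE; ring. Qed.

Lemma plane_rotation_swap (a b : R) : exists c s : R,
  [/\ c ^+ 2 + s ^+ 2 = 1, c * a + s * b = 0 & 0 <= - s * a + c * b].
Proof.
have [c [s [h1 h2 h3]]] := plane_rotation b a.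
exists c, (- s); split; [by rewrite sqrrN|by rewrite -h3; ring|].
by rewrite opprK addrC.
Qed.

Definition act phi (w : triple R) : triple R :=
  (phi *m w.1.1, phi *m w.1.2, phi *m w.2).

Section NormalForm.
Context (D : set (vec3 R)) (C : set (triple R)).

Definition normalisable (w : triple R) := exists phi, stab D phi /\ C (act phi w).

Lemma normal_base (w : triple R) : C w -> normalisable w.
Proof.
case: w => [[x y] z] h; exists 1%:M; split; first exact: stab_1.
by rewrite /act /= !mul1mx.
Qed.

Lemma normal_step psi (w : triple R) : stab D psi -> normalisable (act psi w) -> normalisable w.
Proof.
move=> h [phi [k c]]; exists (phi *m psi); split; first exact: stab_mul.
by move: c; rewrite /act /= !mulmxA.
Qed.

(** With nine separate scalars, rotations act by rewriting and signs can be examined one by one. *)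
Definition nf (x0 x1 x2 y0 y1 y2 z0 z1 z2 : R) :=
  normalisable (mkvec x0 x1 x2, mkvec y0 y1 y2, mkvec z0 z1 z2).

Lemma nf_eta x y z : nf (x 0 0) (x 1 0) (x 2 0) (y 0 0) (y 1 0) (y 2 0)
  (z 0 0) (z 1 0) (z 2 0) -> normalisable (x, y, z).
Proof. by rewrite /nf -!mkvec_eta. Qed.

Section Steps.
Context (x0 x1 x2 y0 y1 y2 z0 z1 z2 : R).

Lemma nf_rot1 c s : stab D (rot1 c s) ->
  nf x0 (c * x1 + s * x2) (- s * x1 + c * x2)
     y0 (c * y1 + s * y2) (- s * y1 + c * y2)
     z0 (c * z1 + s * z2) (- s * z1 + c * z2) -> nf x0 x1 x2 y0 y1 y2 z0 z1 z2.
Proof. by move=> h k; apply: (normal_step h); rewrite /act /= !rot1_mkvec. Qed.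

Lemma nf_rot3 c s : stab D (rot3 c s) ->
  nf (c * x0 + s * x1) (- s * x0 + c * x1) x2
     (c * y0 + s * y1) (- s * y0 + c * y1) y2
     (c * z0 + s * z1) (- s * z0 + c * z1) z2 -> nf x0 x1 x2 y0 y1 y2 z0 z1 z2.
Proof. by move=> h k; apply: (normal_step h); rewrite /act /= !rot3_mkvec. Qed.

Lemma nf_flip1 : nf x0 (- x1) (- x2) y0 (- y1) (- y2) z0 (- z1) (- z2) ->
  nf x0 x1 x2 y0 y1 y2 z0 z1 z2.
Proof.
move=> h; apply: (nf_rot1 (stab_flip1 D)).
by rewrite !(mul0r, addr0, oppr0, add0r, mulN1r).
Qed.

Lemma nf_flip2 : nf (- x0) x1 (- x2) (- y0) y1 (- y2) (- z0) z1 (- z2) ->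
  nf x0 x1 x2 y0 y1 y2 z0 z1 z2.
Proof.
move=> h; apply: (normal_step (stab_flip2 D)); rewrite /act /= !rot2_mkvec.
by rewrite !(mul0r, addr0, oppr0, add0r, mulN1r).
Qed.

Lemma nf_flip3 : nf (- x0) (- x1) x2 (- y0) (- y1) y2 (- z0) (- z1) z2 ->
  nf x0 x1 x2 y0 y1 y2 z0 z1 z2.
Proof.
move=> h; apply: (nf_rot3 (stab_flip3 D)).
by rewrite !(mul0r, addr0, oppr0, add0r, mulN1r).
Qed.

End Steps.
End NormalForm.

(* Patterns are counted from the right: 0 is the last matrix of the union. *)
Tactic Notation "in_pattern" integer(k) :=
  apply: normal_base; do k left; right;
  repeat split; rewrite /= ?mkvecE /= ?oppr0 //; try lra.

(** Turn [x] onto the first axis; rotations about this axis then normalise [y] or, if [y] lies on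
    the axis too, [z]. *)
Lemma nf1 Q x y z : x != 0 -> normalisable (@T1 R) (C1 Q) (x, y, z).
Proof.
move=> x0; have [phi [hphi [r r0 hr]]] := rotate_to_axis x.
apply: (normal_step (stab_T1 hphi)); rewrite /act /= hr.
have {x0 hr} rp : 0 < r.
  rewrite lt_neqAle r0 andbT eq_sym; apply: contra x0 => /eqP r00.
  rewrite -[x]mul1mx -hphi.1 -mulmxA hr r00 (_ : mkvec 0 0 0 = 0) ?mulmx0 //.
  by apply: vec3P; rewrite mkvecE mxE.
move: (phi *m y) (phi *m z) => {}y {}z; rewrite (mkvec_eta y) (mkvec_eta z) -/(nf _ _ _ _ _ _ _ _ _ _ _).
have [c [s [h1 h2 h3]]] := plane_rotation (y 1 0) (y 2 0).
apply: (nf_rot1 (stab_T1 (SO3_rot1 h1))); rewrite h3 !mulr0 !addr0.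
move: (c * y 1 0 + _) h2 => y1 y1p.
move: (y 0 0) (z 0 0) (c * z 1 0 + _) (- s * z 1 0 + _) => y0 z0 z1 z2.
have [y1z|y1z] := eqVneq y1 0; last first.
  have y1pp : 0 < y1 by rewrite lt_neqAle eq_sym y1z.
  by in_pattern 0.
rewrite y1z; have [c' [s' [k1 k2 k3]]] := plane_rotation z1 z2.
apply: (nf_rot1 (stab_T1 (SO3_rot1 k1))); rewrite k3 !mulr0 !addr0.
by in_pattern 1.
Qed.

Lemma mkvec_eq0 (a b c : R) : a = 0 -> b = 0 -> c = 0 -> mkvec a b c = 0.
Proof. by move=> -> -> ->; apply: vec3P; rewrite mkvecE mxE. Qed.

Lemma rotation_eq0 (a b c s : R) : c ^+ 2 + s ^+ 2 = 1 ->
  c * a + s * b = 0 -> - s * a + c * b = 0 -> a = 0 /\ b = 0.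
Proof.
move=> h h1 h2; split.
  transitivity ((c ^+ 2 + s ^+ 2) * a); first by rewrite h mul1r.
  by transitivity (c * (c * a + s * b) - s * (- s * a + c * b)); [ring|rewrite h1 h2; ring].
transitivity ((c ^+ 2 + s ^+ 2) * b); first by rewrite h mul1r.
by transitivity (s * (c * a + s * b) + c * (- s * a + c * b)); [ring|rewrite h1 h2; ring].
Qed.

(** A turn about the third axis clears the first entry of [x] and makes the second non-negative. If
    the latter is positive, the half-turn about the second axis makes positive the first non-zero
    entry among those it negates; if it is zero, [x] lies on the third axis and all turns about it
    remain for [y] and [z]. *)
Lemma nf2 Q x y z : x != 0 -> normalisable (@T2 R) (C2 Q) (x, y, z).
Proof.
move=> x0; apply: nf_eta; have [c [s [h1 h2 h3]]] := plane_rotation_swap (x 0 0) (x 1 0).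
apply: (nf_rot3 (stab_T2 h1)); rewrite h2.
have {x0} nz : - s * x 0 0 + c * x 1 0 = 0 -> x 2 0 != 0.
  move=> h4; apply: contra x0 => /eqP h5.
  have [h6 h7] := rotation_eq0 h1 h2 h4.
  by rewrite (mkvec_eta x) mkvec_eq0.
move: (- s * x 0 0 + _) (x 2 0) h3 nz => {h2} x1 x2 x1p nz.
move: (c * y 0 0 + _) (- s * y 0 0 + _) (y 2 0) => y0 y1 y2.
move: (c * z 0 0 + _) (- s * z 0 0 + _) (z 2 0) => z0 z1 z2.
have [x1z|x1z] := eqVneq x1 0.
  have {nz}x2z := nz x1z; rewrite {x1p x1}x1z.
  suff pos a b0 b1 b2 c0 c1 c2 : 0 < a -> nf (@T2 R) (C2 Q) 0 0 a b0 b1 b2 c0 c1 c2.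
    case: (ltrgtP x2 0) x2z => // x2s _; last exact: pos.
    by apply: nf_flip1; rewrite oppr0; apply: pos; rewrite oppr_gt0.
  move=> ap {h1 c s}; have [c [s [h1 h2 h3]]] := plane_rotation_swap b0 b1.
  apply: (nf_rot3 (stab_T2 h1)); rewrite !mulr0 !addr0 h2.
  move: (- s * b0 + _) h3 (c * c0 + _) (- s * c0 + _) => {h2} {}b1 b1p {}c0 {}c1.
  have [b1z|b1z] := eqVneq b1 0; last first.
    have b1pp : 0 < b1 by rewrite lt_neqAle eq_sym b1z.
    by in_pattern 5.
  rewrite b1z {h1 c s}; have [c [s [h1 h2 h3]]] := plane_rotation_swap c0 c1.
  apply: (nf_rot3 (stab_T2 h1)); rewrite !mulr0 !addr0 h2.
  by in_pattern 6.
have {nz x1z x1p}x1p : 0 < x1 by rewrite lt_neqAle eq_sym x1z.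
case: (ltrgtP x2 0) => [x2s|x2s|->].
- by apply: nf_flip2; in_pattern 0.
- by in_pattern 0.
case: (ltrgtP y0 0) => [y0s|y0s|->].
- by apply: nf_flip2; in_pattern 1.
- by in_pattern 1.
case: (ltrgtP y2 0) => [y2s|y2s|->].
- by apply: nf_flip2; in_pattern 2.
- by in_pattern 2.
case: (ltrgtP z0 0) => [z0s|z0s|->].
- by apply: nf_flip2; in_pattern 3.
- by in_pattern 3.
case: (ltrgtP z2 0) => [z2s|z2s|->].
- by apply: nf_flip2; in_pattern 4.
- by in_pattern 4.
by in_pattern 4.
Qed.

Lemma nf3 Q x y z : x != 0 -> normalisable (@T3 R) (C3 Q) (x, y, z).
Proof.
move=> x0; apply: nf_eta; have [c [s [h1 h2 h3]]] := plane_rotation_swap (x 1 0) (x 2 0).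
apply: (nf_rot1 (stab_T3 h1)); rewrite h2.
have {x0} nz : - s * x 1 0 + c * x 2 0 = 0 -> x 0 0 != 0.
  move=> h4; apply: contra x0 => /eqP h5.
  have [h6 h7] := rotation_eq0 h1 h2 h4.
  by rewrite (mkvec_eta x) mkvec_eq0.
move: (- s * x 1 0 + _) (x 0 0) h3 nz => {h2} x2 x0 x2p nz.
move: (c * y 1 0 + _) (- s * y 1 0 + _) (y 0 0) => y1 y2 y0.
move: (c * z 1 0 + _) (- s * z 1 0 + _) (z 0 0) => z1 z2 z0.
have [x2z|x2z] := eqVneq x2 0.
  have {nz}x0z := nz x2z; rewrite {x2p x2}x2z.
  suff pos a b0 b1 b2 c0 c1 c2 : 0 < a -> nf (@T3 R) (C3 Q) a 0 0 b0 b1 b2 c0 c1 c2.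
    case: (ltrgtP x0 0) x0z => // x0s _; last exact: pos.
    by apply: nf_flip2; rewrite oppr0; apply: pos; rewrite oppr_gt0.
  move=> ap {h1 c s}; have [c [s [h1 h2 h3]]] := plane_rotation b1 b2.
  apply: (nf_rot1 (stab_T3 h1)); rewrite !mulr0 !addr0 h3.
  move: (c * b1 + _) h2 (c * c1 + _) (- s * c1 + _) => {h3} {}b1 b1p {}c1 {}c2.
  have [b1z|b1z] := eqVneq b1 0; last first.
    have b1pp : 0 < b1 by rewrite lt_neqAle eq_sym b1z.
    by in_pattern 5.
  rewrite b1z {h1 c s}; have [c [s [h1 h2 h3]]] := plane_rotation c1 c2.
  apply: (nf_rot1 (stab_T3 h1)); rewrite !mulr0 !addr0 h3.
  by in_pattern 6.
have {nz x2z x2p}x2p : 0 < x2 by rewrite lt_neqAle eq_sym x2z.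
case: (ltrgtP x0 0) => [x0s|x0s|->].
- by apply: nf_flip3; in_pattern 0.
- by in_pattern 0.
case: (ltrgtP y1 0) => [y1s|y1s|->].
- by apply: nf_flip3; in_pattern 1.
- by in_pattern 1.
case: (ltrgtP y0 0) => [y0s|y0s|->].
- by apply: nf_flip3; in_pattern 2.
- by in_pattern 2.
case: (ltrgtP z1 0) => [z1s|z1s|->].
- by apply: nf_flip3; in_pattern 4.
- by in_pattern 4.
case: (ltrgtP z0 0) => [z0s|z0s|->].
- by apply: nf_flip3; in_pattern 3.
- by in_pattern 3.
by in_pattern 3.
Qed.

(** Half-turns about the axes normalise signs. Two non-zero entries of [x] use up all of them; if
    [x] is on an axis, the half-turn about it remains for [y] and [z]. *)
Lemma nf4 Q x y z : x != 0 -> normalisable (@T4 R) (C4 Q) (x, y, z).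
Proof.
move=> xn; apply: nf_eta.
have {xn} nz : ~ [/\ x 0 0 = 0, x 1 0 = 0 & x 2 0 = 0].
  by move=> [h1 h2 h3]; move: xn; rewrite (mkvec_eta x) mkvec_eq0 ?eqxx.
move: (x 0 0) (x 1 0) (x 2 0) nz => x0 x1 x2 nz.
move: (y 0 0) (y 1 0) (y 2 0) (z 0 0) (z 1 0) (z 2 0) => y0 y1 y2 z0 z1 z2.
case: (ltrgtP x0 0) nz => [x0s|x0s|->] nz.
- case: (ltrgtP x1 0) nz => [x1s|x1s|->] nz.
  + by apply: nf_flip3; in_pattern 0.
  + by apply: nf_flip2; in_pattern 0.
  case: (ltrgtP x2 0) nz => [x2s|x2s|->] nz.
  + by apply: nf_flip2; in_pattern 1.
  + by apply: nf_flip3; in_pattern 1.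
  case: (ltrgtP y1 0) => [y1s|y1s|->].
  + by apply: nf_flip3; in_pattern 12.
  + by apply: nf_flip2; in_pattern 12.
  case: (ltrgtP y2 0) => [y2s|y2s|->].
  + by apply: nf_flip2; in_pattern 11.
  + by apply: nf_flip3; in_pattern 11.
  case: (ltrgtP z1 0) => [z1s|z1s|->].
  + by apply: nf_flip3; in_pattern 14.
  + by apply: nf_flip2; in_pattern 14.
  case: (ltrgtP z2 0) => [z2s|z2s|->].
  + by apply: nf_flip2; in_pattern 13.
  + by apply: nf_flip3; in_pattern 13.
  + by apply: nf_flip3; in_pattern 13.
- case: (ltrgtP x1 0) nz => [x1s|x1s|->] nz.
  + by apply: nf_flip1; in_pattern 0.
  + by in_pattern 0.
  case: (ltrgtP x2 0) nz => [x2s|x2s|->] nz.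
  + by apply: nf_flip1; in_pattern 1.
  + by in_pattern 1.
  case: (ltrgtP y1 0) => [y1s|y1s|->].
  + by apply: nf_flip1; in_pattern 12.
  + by in_pattern 12.
  case: (ltrgtP y2 0) => [y2s|y2s|->].
  + by apply: nf_flip1; in_pattern 11.
  + by in_pattern 11.
  case: (ltrgtP z1 0) => [z1s|z1s|->].
  + by apply: nf_flip1; in_pattern 14.
  + by in_pattern 14.
  case: (ltrgtP z2 0) => [z2s|z2s|->].
  + by apply: nf_flip1; in_pattern 13.
  + by in_pattern 13.
  + by in_pattern 13.
case: (ltrgtP x1 0) nz => [x1s|x1s|->] nz.
- case: (ltrgtP x2 0) nz => [x2s|x2s|->] nz.
  + by apply: nf_flip1; in_pattern 2.
  + by apply: nf_flip3; in_pattern 2.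
  case: (ltrgtP y0 0) => [y0s|y0s|->].
  + by apply: nf_flip3; in_pattern 8.
  + by apply: nf_flip1; in_pattern 8.
  case: (ltrgtP y2 0) => [y2s|y2s|->].
  + by apply: nf_flip1; in_pattern 7.
  + by apply: nf_flip3; in_pattern 7.
  case: (ltrgtP z0 0) => [z0s|z0s|->].
  + by apply: nf_flip3; in_pattern 10.
  + by apply: nf_flip1; in_pattern 10.
  case: (ltrgtP z2 0) => [z2s|z2s|->].
  + by apply: nf_flip1; in_pattern 9.
  + by apply: nf_flip3; in_pattern 9.
  + by apply: nf_flip3; in_pattern 9.
- case: (ltrgtP x2 0) nz => [x2s|x2s|->] nz.
  + by apply: nf_flip2; in_pattern 2.
  + by in_pattern 2.
  case: (ltrgtP y0 0) => [y0s|y0s|->].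
  + by apply: nf_flip2; in_pattern 8.
  + by in_pattern 8.
  case: (ltrgtP y2 0) => [y2s|y2s|->].
  + by apply: nf_flip2; in_pattern 7.
  + by in_pattern 7.
  case: (ltrgtP z0 0) => [z0s|z0s|->].
  + by apply: nf_flip2; in_pattern 10.
  + by in_pattern 10.
  case: (ltrgtP z2 0) => [z2s|z2s|->].
  + by apply: nf_flip2; in_pattern 9.
  + by in_pattern 9.
  + by in_pattern 9.
suff pos a b0 b1 b2 c0 c1 c2 : 0 < a -> nf (@T4 R) (C4 Q) 0 0 a b0 b1 b2 c0 c1 c2.
  case: (ltrgtP x2 0) nz => [x2s|x2s|->] nz; last by case: nz.
    by apply: nf_flip1; rewrite oppr0; apply: pos; rewrite oppr_gt0.
  exact: pos.
move=> ap; case: (ltrgtP b0 0) => [s0|s0|->].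
- by apply: nf_flip3; in_pattern 4.
- by in_pattern 4.
case: (ltrgtP b1 0) => [s1|s1|->].
- by apply: nf_flip3; in_pattern 3.
- by in_pattern 3.
case: (ltrgtP c0 0) => [t0|t0|->].
- by apply: nf_flip3; in_pattern 6.
- by in_pattern 6.
case: (ltrgtP c1 0) => [t1|t1|->].
- by apply: nf_flip3; in_pattern 5.
- by in_pattern 5.
by in_pattern 5.
Qed.

End Stabilisers.

(** * Conditions shared by all patterns of a normal form *)

Section Uniqueness.
Context (R : realType).
Implicit Types (x y z d u v w : vec3 R) (phi psi : 'M[R]_3) (D : set (vec3 R)).

Lemma stab_zero D d phi : D d -> stab D phi ->
  forall i j, d j 0 != d i 0 -> phi i j = 0.
Proof.
move=> dD /stabE[h k] i j hij.
have /eqP := (conj3_deltaP d d h.1).1 (k d dD) i j.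
by rewrite mulf_eq0 subr_eq0 (negPf hij) orbF => /eqP.
Qed.

Lemma SO3_entries phi : SO3 phi ->
  [/\ phi 0 0 ^+ 2 + phi 1 0 ^+ 2 + phi 2 0 ^+ 2 = 1,
      phi 0 1 ^+ 2 + phi 1 1 ^+ 2 + phi 2 1 ^+ 2 = 1,
      phi 0 2 ^+ 2 + phi 1 2 ^+ 2 + phi 2 2 ^+ 2 = 1 &
      [/\ phi 0 0 * phi 0 1 + phi 1 0 * phi 1 1 + phi 2 0 * phi 2 1 = 0,
      phi 0 0 * phi 0 2 + phi 1 0 * phi 1 2 + phi 2 0 * phi 2 2 = 0 &
      phi 0 1 * phi 0 2 + phi 1 1 * phi 1 2 + phi 2 1 * phi 2 2 = 0]].
Proof.
move=> [h _].
have e i j : phi 0 i * phi 0 j + phi 1 i * phi 1 j + phi 2 i * phi 2 j = (i == j)%:R.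
  by have := congr1 (fun N : 'M[R]_3 => N i j) h; rewrite /= mulmx3E !trmxE mxE.
by rewrite !expr2; split; [exact: (e 0 0)|exact: (e 1 1)|exact: (e 2 2)|
  split; [exact: (e 0 1)|exact: (e 0 2)|exact: (e 1 2)]].
Qed.

Lemma sqr1 (a : R) : a ^+ 2 = 1 -> a = 1 \/ a = - 1.
Proof. by move/eqP; rewrite sqrf_eq1 => /orP[/eqP|/eqP]; [left|right]. Qed.

Definition fixes phi (w : triple R) := act phi w = w.

Lemma fixesP phi x y z : phi *m x = x -> phi *m y = y -> phi *m z = z ->
  fixes phi (x, y, z).
Proof. by rewrite /fixes /act /= => -> -> ->. Qed.

Lemma C0_eq0 Q x y z : C0 Q (x, y, z) -> x = 0.
Proof. by case=> q _ /(congr1 (fun w : triple R => w.1.1)). Qed.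

Ltac shape h x0 :=
  move=> h x0; repeat case: h => [h|h];
  [by move: x0; rewrite (C0_eq0 h) eqxx|..];
  case: h => -[[+ + +] [+ + +]] [+ + +];
  rewrite /= => *; repeat split; intros; lra.

(** Uniqueness is deduced from these implications alone, which avoids comparing the patterns in
    pairs. *)
Lemma C1_shape Q x y z : C1 Q (x, y, z) -> x != 0 ->
  [/\ 0 < x 0 0, x 1 0 = 0, x 2 0 = 0 &
      [/\ y 2 0 = 0, 0 <= y 1 0 & (y 1 0 = 0 -> z 2 0 = 0 /\ 0 <= z 1 0)]].
Proof. shape h x0. Qed.

Lemma C2_shape Q x y z : C2 Q (x, y, z) -> x != 0 ->
  [/\ x 0 0 = 0, 0 <= x 1 0 & 0 <= x 2 0] /\
  [/\ x 1 0 = 0 -> [/\ 0 < x 2 0, y 0 0 = 0 & 0 <= y 1 0],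
      x 1 0 = 0 -> y 1 0 = 0 -> z 0 0 = 0 /\ 0 <= z 1 0 &
      x 2 0 = 0 -> 0 < x 1 0 -> [/\ 0 <= y 0 0, y 0 0 = 0 -> 0 <= y 2 0,
        y 0 0 = 0 -> y 2 0 = 0 -> 0 <= z 0 0 &
        y 0 0 = 0 -> y 2 0 = 0 -> z 0 0 = 0 -> 0 <= z 2 0]].
Proof. shape h x0. Qed.

Lemma C3_shape Q x y z : C3 Q (x, y, z) -> x != 0 ->
  [/\ x 1 0 = 0, 0 <= x 0 0 & 0 <= x 2 0] /\
  [/\ x 2 0 = 0 -> [/\ 0 < x 0 0, y 2 0 = 0 & 0 <= y 1 0],
      x 2 0 = 0 -> y 1 0 = 0 -> z 2 0 = 0 /\ 0 <= z 1 0 &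
      x 0 0 = 0 -> 0 < x 2 0 -> [/\ 0 <= y 1 0, y 1 0 = 0 -> 0 <= y 0 0,
        y 1 0 = 0 -> y 0 0 = 0 -> 0 <= z 1 0 &
        y 1 0 = 0 -> y 0 0 = 0 -> z 1 0 = 0 -> 0 <= z 0 0]].
Proof. shape h x0. Qed.

Lemma C4_shape Q x y z : C4 Q (x, y, z) -> x != 0 ->
  [/\ 0 <= x 0 0, 0 <= x 1 0, x 0 0 = 0 -> 0 <= x 2 0 & x 1 0 = 0 -> 0 <= x 2 0] /\
  [/\ x 1 0 = 0 -> x 2 0 = 0 ->
        [/\ 0 <= y 1 0, y 1 0 = 0 -> 0 <= y 2 0,
        y 1 0 = 0 -> y 2 0 = 0 -> 0 <= z 1 0 &
        y 1 0 = 0 -> y 2 0 = 0 -> z 1 0 = 0 -> 0 <= z 2 0],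
      x 0 0 = 0 -> x 2 0 = 0 ->
        [/\ 0 <= y 0 0, y 0 0 = 0 -> 0 <= y 2 0,
        y 0 0 = 0 -> y 2 0 = 0 -> 0 <= z 0 0 &
        y 0 0 = 0 -> y 2 0 = 0 -> z 0 0 = 0 -> 0 <= z 2 0] &
      x 0 0 = 0 -> x 1 0 = 0 ->
        [/\ 0 <= y 0 0, y 0 0 = 0 -> 0 <= y 1 0,
        y 0 0 = 0 -> y 1 0 = 0 -> 0 <= z 0 0 &
        y 0 0 = 0 -> y 1 0 = 0 -> z 0 0 = 0 -> 0 <= z 1 0]].
Proof. shape h x0. Qed.

End Uniqueness.

(** * Two normal forms in one orbit coincide *)

Section OrbitUniqueness.
Context (R : realType).
Implicit Types (x y z d u v w : vec3 R) (phi psi : 'M[R]_3) (D : set (vec3 R)).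

Lemma SO3_mul_neq0 phi x : SO3 phi -> x != 0 -> phi *m x != 0.
Proof.
move=> [h _]; apply: contra => /eqP e.
by rewrite -[x]mul1mx -h -mulmxA e mulmx0.
Qed.

Lemma rotation_fix (a b t : R) : a ^+ 2 + b ^+ 2 = 1 -> 0 <= t -> 0 <= a * t ->
  b * t = 0 -> t = 0 \/ a = 1 /\ b = 0.
Proof.
move=> h t0 at0 /eqP; rewrite mulf_eq0 => /orP[/eqP b0|/eqP]; last by left.
have [->|tn] := eqVneq t 0; [by left|right; split=> //].
have tp : 0 < t by rewrite lt_neqAle eq_sym tn.
have : 0 <= a by rewrite -(pmulr_lge0 _ tp).
by move: h; rewrite b0 expr0n /= addr0 => /sqr1[->|->] //; lra.
Qed.

(** With the first axis fixed, [phi] is a plane rotation in the other two coordinates; by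
    [rotation_fix] it is trivial unless [y] and then [z] lie on the axis, and in that case it fixes
    everything. *)
Lemma axis1_fixes phi x y z : SO3 phi ->
  phi 0 0 = 1 -> phi 1 0 = 0 -> phi 2 0 = 0 -> x 1 0 = 0 -> x 2 0 = 0 ->
  [/\ y 2 0 = 0, 0 <= y 1 0 & (y 1 0 = 0 -> z 2 0 = 0 /\ 0 <= z 1 0)] ->
  [/\ (phi *m y) 2 0 = 0, 0 <= (phi *m y) 1 0 &
    ((phi *m y) 1 0 = 0 -> (phi *m z) 2 0 = 0 /\ 0 <= (phi *m z) 1 0)] ->
  fixes phi (x, y, z).
Proof.
move=> hphi p00 p10 p20 x1 x2 [y2 y1 hz].
have [e00 e11 e22 [e01 e02 e12]] := SO3_entries hphi.
have hd := hphi.2; rewrite det3E in hd.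
rewrite p00 p10 p20 in e00 e01 e02 hd.
have p01 : phi 0 1 = 0 by lra.
have p02 : phi 0 2 = 0 by lra.
rewrite p01 p02 in e11 e22 e12 hd.
rewrite !mul3v p10 p20 y2 => -[k2 k1 kz].
have fix1 : phi 1 1 = 1 /\ phi 2 1 = 0 -> fixes phi (x, y, z).
  move=> [p11 p21]; rewrite p11 p21 in e12 hd.
  have p12 : phi 1 2 = 0 by lra.
  have p22 : phi 2 2 = 1 by rewrite p12 in hd; lra.
  apply: fixesP; apply: vec3P; rewrite mul3v ?p00 ?p10 ?p20 ?p01 ?p02 ?p11 ?p12 ?p21 ?p22; ring.
have h1 : phi 1 1 ^+ 2 + phi 2 1 ^+ 2 = 1 by lra.
have a1 : 0 <= phi 1 1 * y 1 0 by lra.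
have b1 : phi 2 1 * y 1 0 = 0 by lra.
case: (rotation_fix h1 y1 a1 b1) => [y10|]; last exact: fix1.
have [z2 z1] := hz y10.
have [|l2 l1] := kz; first by rewrite y10; ring.
rewrite z2 in l1 l2.
have a2 : 0 <= phi 1 1 * z 1 0 by lra.
have b2 : phi 2 1 * z 1 0 = 0 by lra.
case: (rotation_fix h1 z1 a2 b2) => [z10|]; last exact: fix1.
apply: fixesP; apply: vec3P; rewrite mul3v ?x1 ?x2 ?y10 ?y2 ?z10 ?z2 ?p00 ?p10 ?p20 ?p01 ?p02; ring.
Qed.

Lemma axis3_fixes phi x y z : SO3 phi ->
  phi 2 2 = 1 -> phi 1 2 = 0 -> phi 0 2 = 0 -> x 0 0 = 0 -> x 1 0 = 0 ->
  [/\ y 0 0 = 0, 0 <= y 1 0 & (y 1 0 = 0 -> z 0 0 = 0 /\ 0 <= z 1 0)] ->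
  [/\ (phi *m y) 0 0 = 0, 0 <= (phi *m y) 1 0 &
    ((phi *m y) 1 0 = 0 -> (phi *m z) 0 0 = 0 /\ 0 <= (phi *m z) 1 0)] ->
  fixes phi (x, y, z).
Proof.
move=> hphi p22 p12 p02 x0 x1 [y0 y1 hz].
have [e00 e11 e22 [e01 e02 e12]] := SO3_entries hphi.
have hd := hphi.2; rewrite det3E in hd.
rewrite p22 p12 p02 in e22 e02 e12 hd.
have p20 : phi 2 0 = 0 by lra.
have p21 : phi 2 1 = 0 by lra.
rewrite p20 p21 in e00 e11 e01 hd.
rewrite !mul3v p12 p02 y0 => -[k2 k1 kz].
have fix1 : phi 1 1 = 1 /\ phi 0 1 = 0 -> fixes phi (x, y, z).
  move=> [p11 p01]; rewrite p11 p01 in e01 hd.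
  have p10 : phi 1 0 = 0 by lra.
  have p00 : phi 0 0 = 1 by rewrite p10 in hd; lra.
  apply: fixesP; apply: vec3P; rewrite mul3v ?p00 ?p10 ?p20 ?p01 ?p02 ?p11 ?p12 ?p21 ?p22; ring.
have h1 : phi 1 1 ^+ 2 + phi 0 1 ^+ 2 = 1 by lra.
have a1 : 0 <= phi 1 1 * y 1 0 by lra.
have b1 : phi 0 1 * y 1 0 = 0 by lra.
case: (rotation_fix h1 y1 a1 b1) => [y10|]; last exact: fix1.
have [z0 z1] := hz y10.
have [|l2 l1] := kz; first by rewrite y10; ring.
rewrite z0 in l1 l2.
have a2 : 0 <= phi 1 1 * z 1 0 by lra.
have b2 : phi 0 1 * z 1 0 = 0 by lra.
case: (rotation_fix h1 z1 a2 b2) => [z10|]; last exact: fix1.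
apply: fixesP; apply: vec3P; rewrite mul3v ?x0 ?x1 ?y10 ?y0 ?z10 ?z0 ?p22 ?p12 ?p02 ?p20 ?p21; ring.
Qed.

Lemma unique1 Q phi x y z : stab (@T1 R) phi -> x != 0 ->
  C1 Q (x, y, z) -> C1 Q (act phi (x, y, z)) -> fixes phi (x, y, z).
Proof.
move=> [hphi _] xn /C1_shape/(_ xn)[x0 x1 x2 hy].
move/C1_shape/(_ (SO3_mul_neq0 hphi xn)) => [].
rewrite /= 3!mul3v x1 x2 !mulr0 !addr0 => x0' x1' x2' hy'.
have xn0 := lt0r_neq0 x0.
have p10 : phi 1 0 = 0 by move/eqP: x1'; rewrite mulf_eq0 (negPf xn0) orbF => /eqP.
have p20 : phi 2 0 = 0 by move/eqP: x2'; rewrite mulf_eq0 (negPf xn0) orbF => /eqP.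
have [e00 _ _ _] := SO3_entries hphi; rewrite p10 p20 in e00.
have p00 : phi 0 0 = 1.
  have [|//|h] := @sqr1 R (phi 0 0); first by lra.
  by rewrite h in x0'; lra.
exact: axis1_fixes.
Qed.

Lemma vec3_witness (a b c : R) : exists d : vec3 R,
  [/\ d 0 0 = a, d 1 0 = b & d 2 0 = c].
Proof. by exists (mkvec a b c); rewrite !mkvecE. Qed.

Lemma sqr1_nneg (a t : R) : a ^+ 2 = 1 -> 0 < t -> 0 <= a * t -> a = 1.
Proof. by move=> /sqr1[//|->] t0; lra. Qed.

Lemma diag_mul phi x a b c : phi = mx3 a 0 0 0 b 0 0 0 c ->
  [/\ (phi *m x) 0 0 = a * x 0 0, (phi *m x) 1 0 = b * x 1 0 &
      (phi *m x) 2 0 = c * x 2 0].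
Proof. by move=> ->; rewrite !mul3v !mx3E; split; ring. Qed.

Lemma fixes1 (w : triple R) : fixes 1%:M w.
Proof. by case: w => -[x y] z; apply: fixesP; rewrite mul1mx. Qed.

Lemma mx3_1 : mx3 1 0 0 0 1 0 0 0 1 = 1%:M :> 'M[R]_3.
Proof. by apply: mat3P; rewrite mx3E mxE. Qed.

(** The conditions say that the first non-zero entry is positive, which cannot hold for a non-zero
    tuple and its negative. *)
Lemma flip_zero (a b c d : R) :
  [/\ 0 <= a, a = 0 -> 0 <= b, a = 0 -> b = 0 -> 0 <= c &
    a = 0 -> b = 0 -> c = 0 -> 0 <= d] ->
  [/\ 0 <= -1 * a, -1 * a = 0 -> 0 <= -1 * b, -1 * a = 0 -> -1 * b = 0 -> 0 <= -1 * c &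
    -1 * a = 0 -> -1 * b = 0 -> -1 * c = 0 -> 0 <= -1 * d] ->
  [/\ a = 0, b = 0, c = 0 & d = 0].
Proof.
move=> [a1 b1 c1 d1] [a2 b2 c2 d2].
have a0 : a = 0 by lra.
rewrite a0 mulr0 in b1 c1 d1 b2 c2 d2.
have b0 : b = 0 by have := b1 erefl; have := b2 erefl; lra.
rewrite b0 mulr0 in c1 d1 c2 d2.
have c0 : c = 0 by have := c1 erefl erefl; have := c2 erefl erefl; lra.
rewrite c0 mulr0 in d1 d2.
have d0 : d = 0 by have := d1 erefl erefl erefl; have := d2 erefl erefl erefl; lra.
by [].
Qed.

Lemma unique2 Q phi x y z : stab (@T2 R) phi -> x != 0 ->
  C2 Q (x, y, z) -> C2 Q (act phi (x, y, z)) -> fixes phi (x, y, z).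
Proof.
move=> st xn /C2_shape/(_ xn)[[x0 x1 x2] [A B C]].
have hphi := st.1.
move/C2_shape/(_ (SO3_mul_neq0 hphi xn)) => /=.
(* A sample element of [T2]: its distinct entries show which entries of [phi] vanish. *)
have [d [d0 d1 d2]] := vec3_witness 1 1 2.
have dD : T2 d by rewrite /T2 /calT /= d0 d1 d2; repeat split; lra.
have zr := stab_zero dD st.
have d02 : d 0 0 != d 2 0 by rewrite d0 d2 lt_eqF //; lra.
have d12 : d 1 0 != d 2 0 by rewrite d1 d2 lt_eqF //; lra.
have p20 : phi 2 0 = 0 by apply: zr.
have p21 : phi 2 1 = 0 by apply: zr.
have p02 : phi 0 2 = 0 by apply: zr; rewrite eq_sym.
have p12 : phi 1 2 = 0 by apply: zr; rewrite eq_sym.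
have [e00 e11 e22 [e01 e02 e12]] := SO3_entries hphi.
have hd := hphi.2; rewrite det3E in hd.
rewrite p20 p21 p02 p12 in e00 e11 e22 e01 hd.
have q22 : phi 2 2 ^+ 2 = 1 by lra.
rewrite 3!(mul3v phi x) p02 p12 p20 p21 x0 !mulr0 !mul0r !add0r !addr0.
move=> -[[X0 X1 X2] [A' B' C']].
have [x1z|x1z] := eqVneq (x 1 0) 0.
  have [x2p y0 y1] := A x1z.
  have [|_ y0' y1'] := A'; first by rewrite x1z mulr0.
  apply: axis3_fixes => //; first exact: sqr1_nneg X2.
    by split=> //; apply: B.
  by split=> //; apply: B'; rewrite x1z mulr0.
have x1p : 0 < x 1 0 by rewrite lt_neqAle eq_sym x1z.
have p01 : phi 0 1 = 0 by move/eqP: X0; rewrite mulf_eq0 (negPf x1z) orbF => /eqP.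
rewrite p01 in e11 e01 hd.
have p11 : phi 1 1 = 1 by apply: sqr1_nneg X1 => //; lra.
rewrite p11 in e01 hd X1 B' C'.
have p10 : phi 1 0 = 0 by lra.
rewrite p10 in hd.
case: (sqr1 q22) => p22; rewrite p22 in hd X2 C'.
  have p00 : phi 0 0 = 1 by lra.
  have -> : phi = 1%:M; last exact: fixes1.
  by rewrite -mx3_1; apply: mat3P; rewrite mx3E.
(* What is left is the half-turn about the second axis. *)
have p00 : phi 0 0 = -1 by lra.
have phiE : phi = mx3 (-1) 0 0 0 1 0 0 0 (-1) by apply: mat3P; rewrite mx3E.
have [Y0 Y1 Y2] := diag_mul y phiE; have [Z0 Z1 Z2] := diag_mul z phiE.
rewrite Y0 Y2 Z0 Z2 in C'.
have x2z : x 2 0 = 0 by lra.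
have [c1 c2 c3 c4] := C x2z x1p.
have [||c1' c2' c3' c4'] := C'; [by rewrite x2z mulr0|by rewrite mul1r|].
have [y0 y2 z0 z2] : [/\ y 0 0 = 0, y 2 0 = 0, z 0 0 = 0 & z 2 0 = 0].
  by apply: flip_zero.
by rewrite phiE; apply: fixesP; apply: vec3P; rewrite mul3v !mx3E ?x0 ?x2z ?y0 ?y2 ?z0 ?z2; ring.
Qed.

Lemma unique3 Q phi x y z : stab (@T3 R) phi -> x != 0 ->
  C3 Q (x, y, z) -> C3 Q (act phi (x, y, z)) -> fixes phi (x, y, z).
Proof.
move=> st xn /C3_shape/(_ xn)[[x1 x0 x2] [A B C]].
have hphi := st.1.
move/C3_shape/(_ (SO3_mul_neq0 hphi xn)) => /=.
have [d [d0 d1 d2]] := vec3_witness 1 2 2.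
have dD : T3 d by rewrite /T3 /calT /= d0 d1 d2; repeat split; lra.
have zr := stab_zero dD st.
have d01 : d 0 0 != d 1 0 by rewrite d0 d1 lt_eqF //; lra.
have d02 : d 0 0 != d 2 0 by rewrite d0 d2 lt_eqF //; lra.
have p10 : phi 1 0 = 0 by apply: zr.
have p20 : phi 2 0 = 0 by apply: zr.
have p01 : phi 0 1 = 0 by apply: zr; rewrite eq_sym.
have p02 : phi 0 2 = 0 by apply: zr; rewrite eq_sym.
have [e00 e11 e22 [e01 e02 e12]] := SO3_entries hphi.
have hd := hphi.2; rewrite det3E in hd.
rewrite p10 p20 p01 p02 in e00 e11 e22 e12 hd.
have q00 : phi 0 0 ^+ 2 = 1 by lra.
rewrite 3!(mul3v phi x) p10 p20 p01 p02 x1 !mulr0 !mul0r !add0r !addr0.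
move=> -[[X1 X0 X2] [A' B' C']].
have [x2z|x2z] := eqVneq (x 2 0) 0.
  have [x0p y2 y1] := A x2z.
  have [|_ y2' y1'] := A'; first by rewrite x2z mulr0.
  apply: axis1_fixes => //; first exact: sqr1_nneg X0.
    by split=> //; apply: B.
  by split=> //; apply: B'; rewrite x2z mulr0.
have x2p : 0 < x 2 0 by rewrite lt_neqAle eq_sym x2z.
have p12 : phi 1 2 = 0 by move/eqP: X1; rewrite mulf_eq0 (negPf x2z) orbF => /eqP.
rewrite p12 in e22 e12 hd.
have p22 : phi 2 2 = 1 by apply: sqr1_nneg X2 => //; lra.
rewrite p22 in e12 hd X2 B' C'.
have p21 : phi 2 1 = 0 by lra.
rewrite p21 in hd.
case: (sqr1 q00) => p00; rewrite p00 in hd X0 C'.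
  have p11 : phi 1 1 = 1 by lra.
  have -> : phi = 1%:M; last exact: fixes1.
  by rewrite -mx3_1; apply: mat3P; rewrite mx3E.
have p11 : phi 1 1 = -1 by lra.
have phiE : phi = mx3 (-1) 0 0 0 (-1) 0 0 0 1 by apply: mat3P; rewrite mx3E.
have [Y0 Y1 Y2] := diag_mul y phiE; have [Z0 Z1 Z2] := diag_mul z phiE.
rewrite Y0 Y1 Z0 Z1 in C'.
have x0z : x 0 0 = 0 by lra.
have [c1 c2 c3 c4] := C x0z x2p.
have [||c1' c2' c3' c4'] := C'; [by rewrite x0z mulr0|by rewrite mul1r|].
have [y1 y0 z1 z0] : [/\ y 1 0 = 0, y 0 0 = 0, z 1 0 = 0 & z 0 0 = 0].
  by apply: flip_zero.
by rewrite phiE; apply: fixesP; apply: vec3P; rewrite mul3v !mx3E ?x0z ?x1 ?y0 ?y1 ?z0 ?z1; ring.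
Qed.

Lemma unique4 Q phi x y z : stab (@T4 R) phi -> x != 0 ->
  C4 Q (x, y, z) -> C4 Q (act phi (x, y, z)) -> fixes phi (x, y, z).
Proof.
move=> st xn /C4_shape/(_ xn)[[x0 x1 x20 x21] [A B C]].
have hphi := st.1.
move/C4_shape/(_ (SO3_mul_neq0 hphi xn)) => /=.
have [d [d0 d1 d2]] := vec3_witness 1 2 3.
have dD : T4 d by rewrite /T4 /calT /= d0 d1 d2; repeat split; lra.
have zr := stab_zero dD st.
have d01 : d 0 0 != d 1 0 by rewrite d0 d1 lt_eqF //; lra.
have d02 : d 0 0 != d 2 0 by rewrite d0 d2 lt_eqF //; lra.
have d12 : d 1 0 != d 2 0 by rewrite d1 d2 lt_eqF //; lra.
have p10 : phi 1 0 = 0 by apply: zr.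
have p20 : phi 2 0 = 0 by apply: zr.
have p21 : phi 2 1 = 0 by apply: zr.
have p01 : phi 0 1 = 0 by apply: zr; rewrite eq_sym.
have p02 : phi 0 2 = 0 by apply: zr; rewrite eq_sym.
have p12 : phi 1 2 = 0 by apply: zr; rewrite eq_sym.
have [e00 e11 e22 _] := SO3_entries hphi.
have hd := hphi.2; rewrite det3E in hd.
rewrite p10 p20 p01 p02 p12 p21 in e00 e11 e22 hd.
have q00 : phi 0 0 ^+ 2 = 1 by lra.
have q11 : phi 1 1 ^+ 2 = 1 by lra.
have q22 : phi 2 2 ^+ 2 = 1 by lra.
have phiE : phi = mx3 (phi 0 0) 0 0 0 (phi 1 1) 0 0 0 (phi 2 2).
  by apply: mat3P; rewrite mx3E.
move: (phi 0 0) (phi 1 1) (phi 2 2) q00 q11 q22 hd phiE => a b c qa qb qc hd phiE.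
have [X0 X1 X2] := diag_mul x phiE.
have [Y0 Y1 Y2] := diag_mul y phiE; have [Z0 Z1 Z2] := diag_mul z phiE.
rewrite X0 X1 X2 Y0 Y1 Y2 Z0 Z1 Z2 phiE {X0 X1 X2 Y0 Y1 Y2 Z0 Z1 Z2}.
(* Determinant 1 leaves the identity and the half-turns about the first, second and third axis, in
   this order. *)
move: qa qb qc hd {phiE} => /sqr1[] -> /sqr1[] -> /sqr1[] -> hd; try (exfalso; lra);
  rewrite ?mul1r => -[[X0 X1 X20 X21] [A' B' C']].
- by rewrite mx3_1; exact: fixes1.
- have x1z : x 1 0 = 0 by lra.
  have x2z : x 2 0 = 0.
    by rewrite x1z mulr0 in X21; have := x21 x1z; have := X21 erefl; lra.
  rewrite x1z x2z mulr0 in A'.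
  have [y1 y2 z1 z2] := flip_zero (A x1z x2z) (A' erefl erefl).
  by apply: fixesP; apply: vec3P; rewrite mul3v !mx3E ?x1z ?x2z ?y1 ?y2 ?z1 ?z2; ring.
- have x0z : x 0 0 = 0 by lra.
  have x2z : x 2 0 = 0.
    by rewrite x0z mulr0 in X20; have := x20 x0z; have := X20 erefl; lra.
  rewrite x0z x2z mulr0 in B'.
  have [y0 y2 z0 z2] := flip_zero (B x0z x2z) (B' erefl erefl).
  by apply: fixesP; apply: vec3P; rewrite mul3v !mx3E ?x0z ?x2z ?y0 ?y2 ?z0 ?z2; ring.
have x0z : x 0 0 = 0 by lra.
have x1z : x 1 0 = 0 by lra.
rewrite x0z x1z mulr0 in C'.
have [y0 y1 z0 z1] := flip_zero (C x0z x1z) (C' erefl erefl).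
by apply: fixesP; apply: vec3P; rewrite mul3v !mx3E ?x0z ?x1z ?y0 ?y1 ?z0 ?z1; ring.
Qed.

End OrbitUniqueness.

(** * The members of the family are division algebras *)

Section Converse.
Context (R : realType).
Implicit Types (x y z d u v w : vec3 R) (M : 'M[R]_3).

Lemma inj_linear_bij (V : vectType R) (f : V -> V) : linear f ->
  (forall t, f t = 0 -> t = 0) -> bijective f.
Proof.
move=> lf h; pose F := linfun (mklin lf).
have FE t : F t = f t by rewrite lfunE.
have kF : lker F == 0%VS.
  rewrite -subv0; apply/subvP => v; rewrite memv_ker FE => /eqP/h ->.
  exact: mem0v.
by exists (F^-1)%VF => v; rewrite -FE ?lker0_lfunK ?lker0_lfunVK.
Qed.

(** Pairing the vector part with [cross u v] leaves only the term with [M], so [cross u v = 0].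
    Pairing with [u] and [v] then produces the sums of squares in [hu] and [hv]. *)
Lemma Kmul_eq0 x M (p q : R * vec3 R) : (forall w, dot w (M *m w) = 0 -> w = 0) ->
  Kmul x M p q = (0, 0) -> p = (0, 0) \/ q = (0, 0).
Proof.
move=> hM; case: p q => [a u] [b v]; rewrite /Kmul /= => -[h1 h2].
have uc : dot u (cross u v) = 0 by rewrite dotE !crossE; ring.
have vc : dot v (cross u v) = 0 by rewrite dotE !crossE; ring.
have c0 : cross u v = 0.
  apply: hM; have := congr1 (dot (cross u v)) h2.
  rewrite !dotDr' !dotZr (dotC _ u) (dotC _ v) uc vc dot0r.
  by rewrite !mulr0 !add0r.
move: h1 h2; rewrite c0 dot0r mulmx0 !addr0 => /eqP; rewrite subr_eq0 => /eqP h1 h2.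
have hu : b * (a ^+ 2 + dot u u) = 0.
  have := congr1 (dot u) h2; rewrite dotDr' !dotZr -h1 dot0r => <-; ring.
have hv : a * (b ^+ 2 + dot v v) = 0.
  have := congr1 (dot v) h2; rewrite dotDr' !dotZr (dotC v u) -h1 dot0r => <-; ring.
have nz (e : R) w : e != 0 \/ w != 0 -> e ^+ 2 + dot w w != 0.
  have [->|w0] := eqVneq w 0; first by rewrite dot0r addr0 => -[e0|//]; rewrite expf_neq0.
  by move=> _; rewrite gt_eqF // ltr_wpDl ?sqr_ge0 ?dot_gt0.
have [a0|a0] := eqVneq a 0; last first.
  right; move/eqP: hv; rewrite mulf_eq0 (negPf a0) /= => /eqP hv.
  have [b0|b0] := eqVneq b 0; last by have /eqP := nz b v (or_introl b0).
  have [->|v0] := eqVneq v 0; first by rewrite b0.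
  by have /eqP := nz b v (or_intror v0).
have [b0|b0] := eqVneq b 0; last first.
  left; move/eqP: hu; rewrite mulf_eq0 (negPf b0) /= => /eqP hu.
  have [->|u0] := eqVneq u 0; first by rewrite a0.
  by have /eqP := nz a u (or_intror u0).
have [->|u0] := eqVneq u 0; first by left; rewrite a0.
right; have := triple_cross u v; rewrite (crossN v) c0 oppr0.
rewrite (_ : cross u 0 = 0); last by apply: vec3P; rewrite crossE !mxE; ring.
rewrite -h1 a0 mul0r scale0r subr0 => /esym/eqP.
by rewrite scaler_eq0 (gt_eqF (dot_gt0 u0)) /= => /eqP ->; rewrite b0.
Qed.

(** The skew part [epsilon y] contributes nothing to the quadratic form, and [delta d] is
    positive. *)
Lemma epsilon_delta_definite y d w : calT d ->
  dot w ((epsilon y + delta d) *m w) = 0 -> w = 0.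
Proof.
move=> [d0 /andP[d1 d2]].
rewrite dotE !mul3v /epsilon /delta !mxE /= => h.
have e : d 0 0 * (w 0 0) ^+ 2 + d 1 0 * (w 1 0) ^+ 2 + d 2 0 * (w 2 0) ^+ 2 = 0.
  by rewrite -[RHS]h; ring.
have dp1 : 0 < d 1 0 by apply: lt_le_trans d1.
have dp2 : 0 < d 2 0 by apply: lt_le_trans d2.
have s0 : 0 <= d 0 0 * (w 0 0) ^+ 2 by rewrite mulr_ge0 ?sqr_ge0 ?ltW.
have s1 : 0 <= d 1 0 * (w 1 0) ^+ 2 by rewrite mulr_ge0 ?sqr_ge0 ?ltW.
have s2 : 0 <= d 2 0 * (w 2 0) ^+ 2 by rewrite mulr_ge0 ?sqr_ge0 ?ltW.
have z0 (k t : R) : 0 < k -> k * t ^+ 2 = 0 -> t = 0.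
  by move=> k0 /eqP; rewrite mulf_eq0 (gt_eqF k0) sqrf_eq0 => /eqP.
by apply: vec3P; rewrite mxE; [apply: (z0 _ _ d0)|apply: (z0 _ _ dp1)|apply: (z0 _ _ dp2)]; lra.
Qed.

Lemma Falg_algdim x y z d l : algdim (Falg (x, y, z, d, l)) = 4%N.
Proof. by rewrite /algdim dimvf /dim /=. Qed.

Lemma Falg_eq0 x y z d l (p q : Falg (x, y, z, d, l)) : calT d -> l != 0 ->
  amul p q = 0 -> p = 0 \/ q = 0.
Proof.
move=> dT l0 h.
have h1 : Kmul x (epsilon y + delta d) (hmap z l p) (hmap z l q) = (0, 0).
  by rewrite -GmulE -Falg_mul; exact: h.
have h00 : (0, 0) = hmap z l (0, 0) by rewrite /hmap /= dot0r addr0 scaler0.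
case: (Kmul_eq0 (fun w => @epsilon_delta_definite y d w dT) h1); rewrite h00 => /hmap_inj -> //.
- by left.
- by right.
Qed.

Lemma Falg_division x y z d l : calT d -> l != 0 ->
  division_algebra (Falg (x, y, z, d, l)).
Proof.
move=> dT l0 a a0; split; apply: inj_linear_bij.
- by move=> c u v; rewrite linearPr.
- by move=> v /(Falg_eq0 dT l0)[h|//]; move: a0; rewrite h eqxx.
- by move=> c u v; rewrite linearPl.
- by move=> v /(Falg_eq0 dT l0)[//|h]; move: a0; rewrite h eqxx.
Qed.

Lemma Falg_unitr x y z d l (p : Falg (x, y, z, d, l)) :
  amul p ((1, 0) : Falg (x, y, z, d, l)) = hmap z l p.
Proof.
rewrite Falg_mul GmulE (_ : hmap z l (1, 0) = (1, 0)) ; last first.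
  by rewrite /hmap /= dot0r addr0 scaler0.
case: (hmap z l p) => a u; rewrite /Kmul /=.
have -> : cross u 0 = 0 by apply: vec3P; rewrite crossE !mxE; ring.
by rewrite !dot0r mulr1 addr0 subr0 scale1r scaler0 mulmx0 add0r addr0.
Qed.

(** The span of [e] and [a] is a commutative subalgebra containing [a], hence everything that [a]
    generates. *)
Lemma plane_generated (A : algebra R) (e a : A) (b c r s : R) :
  amul e e = e -> amul e a = b *: e + c *: a -> amul a e = b *: e + c *: a ->
  amul a a = r *: e + s *: a ->
  forall p q, generated a p -> generated a q -> amul p q = amul q p.
Proof.
move=> ee ea ae aa.
pose U := (<[e]> + <[a]>)%VS.
have UP t : reflect (exists k m : R, t = k *: e + m *: a) (t \in U).
  apply: (iffP memv_addP) => [[t1 /vlineP[k ->] [t2 /vlineP[m ->] ->]]|[k [m ->]]].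
    by exists k, m.
  exists (k *: e); first by rewrite memvZ ?memv_line.
  by exists (m *: a) => //; rewrite memvZ ?memv_line.
have prod (k1 m1 k2 m2 : R) : amul (k1 *: e + m1 *: a) (k2 *: e + m2 *: a) =
    (k1 * k2 + (k1 * m2 + m1 * k2) * b + m1 * m2 * r) *: e +
    ((k1 * m2 + m1 * k2) * c + m1 * m2 * s) *: a.
  have comb (k k' i i' j j' : R) : k *: (i *: e + j *: a) + k' *: (i' *: e + j' *: a) =
      (k * i + k' * i') *: e + (k * j + k' * j') *: a.
    by rewrite !scalerDr !scalerA addrACA -!scalerDl.
  have e1 : e = 1 *: e + 0 *: a by rewrite scale1r scale0r addr0.
  rewrite linearPr linearZr_LR /= !linearPl !linearZl_LR /= ee ea ae aa {1}e1.
  by rewrite !comb; congr (_ *: _ + _ *: _); ring.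
have subU : subalgebra U.
  move=> _ _ /UP[k1 [m1 ->]] /UP[k2 [m2 ->]]; apply/UP.
  by rewrite prod; do 2!eexists.
have aU : a \in U by apply/UP; exists 0, 1; rewrite scale0r scale1r add0r.
move=> p q /(_ U subU aU)/UP[k1 [m1 ->]] /(_ U subU aU)/UP[k2 [m2 ->]].
by rewrite !prod; congr (_ *: _ + _ *: _); ring.
Qed.

Lemma Falg_power_commutative x y z d l :
  power_commutative (Falg (x, y, z, d, l)).
Proof.
move=> a p q hp hq.
have [e eE] : exists e : Falg (x, y, z, d, l), e = (1, 0) by eexists.
have el t : amul e t = hmap z l t by rewrite eE; exact: Falg_unit.
have er t : amul t e = hmap z l t by rewrite eE; exact: Falg_unitr.
have ee : amul e e = e by rewrite el eE /hmap /= dot0r addr0 scaler0.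
have [b [c hea]] : exists b c : R, hmap z l a = b *: e + c *: a.
  exists (a.1 + dot z a.2 - l * a.1), l; rewrite eE; case: (a) => s u.
  rewrite /hmap /=; congr pair; last by rewrite /= scaler0 add0r.
  by rewrite /= /GRing.scale /=; ring.
have [r [s haa]] : exists r s : R, amul a a = r *: e + s *: a.
  by rewrite eE; exact: Falg_sqr.
apply: (plane_generated ee _ _ haa hp hq); first exact: etrans (el a) hea.
exact: etrans (er a) hea.
Qed.

End Converse.

(** * Transversals and the parameter set *)

Section Classification.
Context (R : realType).
Implicit Types (x y z d : vec3 R) (w : triple R) (phi : 'M[R]_3)
  (D : set (vec3 R)) (Q : set (vec3 R * vec3 R)).

Definition normal_forms D (C : set (triple R)) :=
  (forall w, normalisable D C w) /\
  (forall phi w, stab D phi -> C w -> C (act phi w) -> fixes phi w).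

(** For [x = 0] both halves come from the transversal [Q]; a non-zero [x] is left to the explicit
    patterns. *)
Lemma normal_forms_of D C Q : transversal2 (stab D) Q -> C0 Q `<=` C ->
  (forall y z, C (0, y, z) -> Q (y, z)) ->
  (forall x y z, x != 0 -> normalisable D C (x, y, z)) ->
  (forall phi x y z, stab D phi -> x != 0 -> C (x, y, z) ->
    C (act phi (x, y, z)) -> fixes phi (x, y, z)) ->
  normal_forms D C.
Proof.
move=> tQ sub sup hn hu; split=> [[[x y] z]|phi [[x y] z] hphi].
  have [->|x0] := eqVneq x 0; last exact: hn.
  have [q [[qQ [phi hphi qE]] _]] := tQ (y, z); rewrite -qE in qQ.
  exists phi; split=> //; apply: sub; exists (phi *m y, phi *m z) => //.
  by rewrite /act /= mulmx0.
have [->|x0] := eqVneq x 0; last exact: hu.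
rewrite /act /= mulmx0 => /sup h1 /sup h2.
have [q [_ uq]] := tQ (y, z).
have [] : (y, z) = (phi *m y, phi *m z).
  rewrite -(uq (y, z)); last first.
    split=> //; exists 1%:M; [exact: stab_1|by rewrite /= !mul1mx].
  by apply: uq; split=> //; exists phi.
by move=> e1 e2; apply: fixesP; rewrite -?e1 -?e2 // mulmx0.
Qed.

Lemma C0_mem Q y z : C0 Q (0, y, z) -> Q (y, z).
Proof. by move=> [[y' z'] h [<- <-]]. Qed.

Ltac pattern_zero :=
  let h := fresh in
  move=> y z h; repeat case: h => [h|h]; [exact: C0_mem h|..];
  case: h => -[[+ _ _] [+ _ _]] [+ _ _]; rewrite /= !mxE ?ltxx.

Lemma normal_forms1 Q : transversal2 (stab (@T1 R)) Q ->
  normal_forms (@T1 R) (C1 Q).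
Proof.
move=> tQ; apply: (normal_forms_of tQ _ _ (@nf1 _ Q) (@unique1 _ Q)).
  by move=> w h; do ?left.
pattern_zero; by [].
Qed.

Lemma normal_forms2 Q : transversal2 (stab (@T2 R)) Q ->
  normal_forms (@T2 R) (C2 Q).
Proof.
move=> tQ; apply: (normal_forms_of tQ _ _ (@nf2 _ Q) (@unique2 _ Q)).
  by move=> w h; do ?left.
by pattern_zero.
Qed.

Lemma normal_forms3 Q : transversal2 (stab (@T3 R)) Q ->
  normal_forms (@T3 R) (C3 Q).
Proof.
move=> tQ; apply: (normal_forms_of tQ _ _ (@nf3 _ Q) (@unique3 _ Q)).
  by move=> w h; do ?left.
by pattern_zero.
Qed.

Lemma normal_forms4 Q : transversal2 (stab (@T4 R)) Q ->
  normal_forms (@T4 R) (C4 Q).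
Proof.
move=> tQ; apply: (normal_forms_of tQ _ _ (@nf4 _ Q) (@unique4 _ Q)).
  by move=> w h; do ?left.
by pattern_zero.
Qed.

Lemma calT_cases d : calT d -> T1 d \/ T2 d \/ T3 d \/ T4 d.
Proof.
move=> dT; have [_ /andP[]] := dT; rewrite le_eqVlt => /orP[/eqP|] h1;
rewrite le_eqVlt => /orP[/eqP|] h2;
  [left|right; left|right; right; left|right; right; right]; split=> //; split=> //.
Qed.

Section CalS.
Context (Q1 Q2 Q3 Q4 : set (vec3 R * vec3 R)).
Context (nf1 : normal_forms (@T1 R) (C1 Q1)) (nf2 : normal_forms (@T2 R) (C2 Q2))
  (nf3 : normal_forms (@T3 R) (C3 Q3)) (nf4 : normal_forms (@T4 R) (C4 Q4)).

Lemma calS_calT w d l : calS Q1 Q2 Q3 Q4 (w, d, l) -> calT d /\ l != 0.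
Proof. by case=> [[[]|]|] [[/= _ [dT _]] l0]. Qed.

Lemma calS_ex w d l : calT d -> l != 0 -> exists phi,
  [/\ SO3 phi, conj3 phi (delta d) = delta d & calS Q1 Q2 Q3 Q4 (act phi w, d, l)].
Proof.
move=> /calT_cases dT l0.
have step D (C : set (triple R)) : normal_forms D C -> D d -> exists phi,
    [/\ SO3 phi, conj3 phi (delta d) = delta d & C (act phi w)].
  by move=> [h _] dD; have [phi [/stabE[? hd] ?]] := h w; exists phi; split=> //; apply: hd.
by case: dT => [|[|[|]]] dT;
  [have [phi [? ? ?]] := step _ _ nf1 dT|have [phi [? ? ?]] := step _ _ nf2 dT
  |have [phi [? ? ?]] := step _ _ nf3 dT|have [phi [? ? ?]] := step _ _ nf4 dT];
  exists phi; split=> //; [do 3!left|do 2!left; right|left; right|right].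
Qed.

(** [T1], ..., [T4] are disjoint, so [w] and its image lie in the same [C_i]. *)
Lemma calS_unique phi w d l : SO3 phi -> conj3 phi (delta d) = delta d ->
  calS Q1 Q2 Q3 Q4 (w, d, l) -> calS Q1 Q2 Q3 Q4 (act phi w, d, l) -> act phi w = w.
Proof.
move=> hphi hd.
have step D (C : set (triple R)) : eqpat D -> normal_forms D C -> D d ->
    C w -> C (act phi w) -> act phi w = w.
  by move=> ep [_ h] dD; apply: h; apply: (stab_of_one ep dD).
case=> [[[]|]|] [[/= c dT] _]; case=> [[[]|]|] [[/= c' dT'] _];
  try (exfalso; case: dT dT' => _ [+ +] [_ [+ +]]; lra).
- exact: (step _ _ (@eqpat1 R) nf1 dT c c').
- exact: (step _ _ (@eqpat2 R) nf2 dT c c').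
- exact: (step _ _ (@eqpat3 R) nf3 dT c c').
- exact: (step _ _ (@eqpat4 R) nf4 dT c c').
Qed.

End CalS.
End Classification.

(** * Existence and uniqueness within the family *)

Section Main.
Context (R : realType) (Q1 Q2 Q3 Q4 : set (vec3 R * vec3 R)).
Context (hQ1 : transversal2 (stab (@T1 R)) Q1)
  (hQ2 : transversal2 (stab (@T2 R)) Q2)
  (hQ3 : transversal2 (stab (@T3 R)) Q3)
  (hQ4 : transversal2 (stab (@T4 R)) Q4).

Lemma familyF_ex (A : algebra R) : division_algebra A -> power_commutative A ->
  algdim A = 4%N -> exists B, familyF Q1 Q2 Q3 Q4 B /\ isomorphic A B.
Proof.
move=> h1 h2 h3; have [x [y [z [d [l [dT l0 iA]]]]]] := iso_Falg h1 h2 h3.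
have [phi [hphi hd hS]] := calS_ex (normal_forms1 hQ1) (normal_forms2 hQ2)
  (normal_forms3 hQ3) (normal_forms4 hQ4) (x, y, z) dT l0.
exists (Falg (act phi (x, y, z), d, l)); split; first by exists (act phi (x, y, z), d, l).
exact: isomorphic_trans iA (Falg_iso_of_SO3 _ _ _ _ hphi hd).
Qed.

(** The equality is literal: the parameters are shown to coincide, first [l] and [d], then the
    triples because they are normal forms in one orbit. *)
Lemma familyF_unique (B B' : algebra R) : familyF Q1 Q2 Q3 Q4 B ->
  familyF Q1 Q2 Q3 Q4 B' -> isomorphic B B' -> B = B'.
Proof.
move=> [[[w d] l] hS <-] [[[w' d'] l'] hS' <-].
have [dT l0] := calS_calT hS; have [dT' l0'] := calS_calT hS'.
case: w w' hS hS' => [[x y] z] [[x' y'] z'] hS hS' i.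
have [ll [phi [hphi hd [e1 e2 e3]]]] := Falg_iso_inv l0 l0' dT dT' i.
have dd := delta_unique hphi.1 dT dT' hd; rewrite -dd -ll in hd hS' *.
have ew : (x', y', z') = act phi (x, y, z) by rewrite e1 e2 e3.
rewrite ew in hS' *.
by rewrite (calS_unique (normal_forms1 hQ1) (normal_forms2 hQ2)
  (normal_forms3 hQ3) (normal_forms4 hQ4) hphi hd hS hS').
Qed.

End Main.

Theorem corollary13 (R : realType) (Q1 Q2 Q3 Q4 : set (vec3 R * vec3 R))
  (hQ1 : transversal2 (stab (@T1 R)) Q1)
  (hQ2 : transversal2 (stab (@T2 R)) Q2)
  (hQ3 : transversal2 (stab (@T3 R)) Q3)
  (hQ4 : transversal2 (stab (@T4 R)) Q4) :
  (forall A : algebra R,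
     division_algebra A -> power_commutative A -> algdim A = 4%N ->
     exists! B : algebra R,
       familyF Q1 Q2 Q3 Q4 B /\ isomorphic A B) /\
  (forall B : algebra R, familyF Q1 Q2 Q3 Q4 B ->
     [/\ power_commutative B, division_algebra B & algdim B = 4%N]).
Proof.
split=> [A h1 h2 h3|_ [[[[[x y] z] d] l] hS <-]].
  have [B [hB iB]] := familyF_ex hQ1 hQ2 hQ3 hQ4 h1 h2 h3.
  exists B; split=> // B' [hB' iB'].
  apply: (familyF_unique hQ1 hQ2 hQ3 hQ4 hB hB').
  exact: isomorphic_trans (isomorphic_sym iB) iB'.
have [dT l0] := calS_calT hS; split.
- exact: Falg_power_commutative.
- exact: Falg_division.
- exact: Falg_algdim.
Qed.
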